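(* Let $c\colon Q\to G$ be a continuous homomorphism of an $r$-discrete Hausdorff groupoid $Q$ into a discrete group $G$, and suppose $Q$ is amenable. Then the action $\beta$ of $G$ on $C^*(Q\times_cG)$ determined by $\beta_s(f)(x,t)=f(x,ts)$ (for $s,t\in G$, $f\in C_c(Q\times_cG)$, $x\in Q$) is amenable in the sense that the regular representation of the full crossed product $C^*(Q\times_cG)\times_\beta G$ (onto the reduced crossed product $C^*(Q\times_cG)\times_{\beta,r}G$) is faithful.
   Context: Groupoids are locally compact topological groupoids. A groupoid $Q$ is $r$-discrete if its range map $r$ is a local homeomorphism onto the unit space $Q^0$ (so counting measures on the sets $Q^u=r^{-1}(u)$ give a Haar system). Amenability of $Q$ is topological amenability in the sense of Renault and Anantharaman-Delaroche: there is a net $(g_i)$ of nonnegative functions in $C_c(Q)$ with $\sum_{x\in Q^u}g_i(x)\le 1$ for all $u\in Q^0$, $\sum_{x\in Q^u}g_i(x)\to1$ uniformly on compact subsets of $Q^0$, and $\sum_{y\in Q^{r(x)}}|g_i(x^{-1}y)-g_i(y)|\to0$ uniformly for $x$ in compact subsets of $Q$. $C_c(Q)$ is a $^*$-algebra with $(fg)(x)=\sum_{r(y)=r(x)}f(y)g(y^{-1}x)$ and $f^*(x)=\overline{f(x^{-1})}$, and $C^*(Q)$, the full groupoid $C^*$-algebra, is the enveloping $C^*$-algebra of $C_c(Q)$. The skew-product groupoid $Q\times_cG$ is the set $Q\times G$ with the product topology and operations $(x,c(y)s)(y,s)=(xy,s)$ for composable $(x,y)$ and $s\in G$, and $(x,s)^{-1}=(x^{-1},c(x)s)$;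 it is $r$-discrete. $\beta$ is induced by the action $s\cdot(x,t)=(x,ts^{-1})$ of $G$ on $Q\times_cG$. *)

(* Defs.v *)
From HB Require Import structures.
From mathcomp Require Import all_boot all_order all_algebra.
From mathcomp Require Import all_classical all_reals all_analysis.
From mathcomp Require Import complex.

Set Implicit Arguments.
Unset Strict Implicit.
Unset Printing Implicit Defensive.

Import Order.TTheory GRing.Theory Num.Theory numFieldNormedType.Exports.

Local Open Scope classical_set_scope.
Local Open Scope ring_scope.

(** Units are identified with elements of the groupoid.  [gmul] is total, but
    its value is constrained only on composable pairs. *)
Record groupoid (Q : Type) := Groupoid {
  grng : Q -> Q;
  gsrc : Q -> Q;
  gmul : Q -> Q -> Q;
  ginv : Q -> Q;
  grng_rng : forall x, grng (grng x) = grng x;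
  gsrc_rng : forall x, gsrc (grng x) = grng x;
  grng_src : forall x, grng (gsrc x) = gsrc x;
  gsrc_src : forall x, gsrc (gsrc x) = gsrc x;
  grngM : forall x y, gsrc x = grng y -> grng (gmul x y) = grng x;
  gsrcM : forall x y, gsrc x = grng y -> gsrc (gmul x y) = gsrc y;
  gmulA : forall x y z, gsrc x = grng y -> gsrc y = grng z ->
    gmul x (gmul y z) = gmul (gmul x y) z;
  gmul1l : forall x, gmul (grng x) x = x;
  gmul1r : forall x, gmul x (gsrc x) = x;
  grngV : forall x, grng (ginv x) = gsrc x;
  gsrcV : forall x, gsrc (ginv x) = grng x;
  gmulV : forall x, gmul x (ginv x) = grng x;
  gmulVl : forall x, gmul (ginv x) x = gsrc x }.

Definition units (Q : Type) (Gr : groupoid Q) : set Q := range (grng Gr).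

Definition rfiber (Q : Type) (Gr : groupoid Q) (u : Q) : set Q :=
  [set x | grng Gr x = u].

Definition topological_groupoid (Q : topologicalType) (Gr : groupoid Q) :=
  continuous (ginv Gr) /\
  {within [set p : Q * Q | gsrc Gr p.1 = grng Gr p.2],
    continuous (fun p : Q * Q => gmul Gr p.1 p.2)}.

Definition local_homeomorphism_onto (X Y : topologicalType) (Z : set Y)
    (f : X -> Y) :=
  [/\ continuous f, range f = Z &
      forall x, exists U : set X,
        [/\ open U, U x, set_inj U f &
            forall V : set X, open V -> V `<=` U ->
              exists2 W : set Y, open W & f @` V = W `&` Z]].

Definition r_discrete (Q : topologicalType) (Gr : groupoid Q) :=
  local_homeomorphism_onto (units Gr) (grng Gr).

Definition Cc (K : numFieldType) (X : topologicalType) : set (X -> K) :=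
  [set f | continuous f /\ compact (closure [set x | f x != 0])].

Definition directed (I : Type) (le : I -> I -> Prop) :=
  [/\ inhabited I, forall i, le i i,
      forall i j k, le i j -> le j k -> le i k &
      forall i j, exists k, le i k /\ le j k].

(** For [f] in [Cc Q] the sums over [rfiber], here and in [groupoid_conv] below,
    have finite support because [Gr] is r-discrete. *)
Definition amenable (R : realType) (Q : topologicalType) (Gr : groupoid Q) :=
  exists (I : Type) (le : I -> I -> Prop) (g : I -> Q -> R),
  [/\ directed le,
      forall i, Cc (g i) /\ (forall x, 0 <= g i x),
      forall i u, units Gr u -> \sum_(x \in rfiber Gr u) g i x <= 1,
      forall K : set Q, compact K -> K `<=` units Gr ->
        forall e : R, 0 < e -> exists i0, forall i, le i0 i -> forall u, K u ->
          `|\sum_(x \in rfiber Gr u) g i x - 1| < e &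
      forall K : set Q, compact K ->
        forall e : R, 0 < e -> exists i0, forall i, le i0 i -> forall x, K x ->
          \sum_(y \in rfiber Gr (grng Gr x))
             `|g i (gmul Gr (ginv Gr x) y) - g i y| < e].

Definition groupoid_hom (Q : Type) (Gr : groupoid Q) (G : groupType)
    (c : Q -> G) :=
  forall x y, gsrc Gr x = grng Gr y -> c (gmul Gr x y) = (c x * c y)%g.

Section SkewProduct.
Variables (Q : Type) (Gr : groupoid Q) (G : groupType) (c : Q -> G).
Hypothesis cM : groupoid_hom Gr c.

Local Notation QG := (Q * discrete_topology G)%type.

Definition skew_rng (p : QG) : QG := (grng Gr p.1, (c p.1 * p.2)%g).
Definition skew_src (p : QG) : QG := (gsrc Gr p.1, p.2).
Definition skew_mul (p q : QG) : QG := (gmul Gr p.1 q.1, q.2).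
Definition skew_inv (p : QG) : QG := (ginv Gr p.1, (c p.1 * p.2)%g).

Lemma groupoid_hom_rng x : c (grng Gr x) = 1%g.
Proof.
have := cM (gsrc_rng Gr x); rewrite gmul1l => h.
by apply: (@mulIg _ (c x)); rewrite mul1g -h.
Qed.

Lemma groupoid_hom_src x : c (gsrc Gr x) = 1%g.
Proof. by rewrite -grngV groupoid_hom_rng. Qed.

Lemma groupoid_homV x : c (ginv Gr x) = (c x)^-1%g.
Proof.
have := cM (esym (grngV Gr x)); rewrite gmulV groupoid_hom_rng => h.
by apply: (@mulgI _ (c x)); rewrite mulgV -h.
Qed.

(** Composability of [(x, t)] and [(y, s)] reads [gsrc x = grng y] and
    [t = c y * s]. *)
Definition skew_product : groupoid QG.
Proof.
refine (@Groupoid QG skew_rng skew_src skew_mul skew_inv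
          _ _ _ _ _ _ _ _ _ _ _ _ _); rewrite /skew_rng /skew_src /skew_mul
          /skew_inv => -[x t] /=.
- by rewrite grng_rng groupoid_hom_rng mul1g.
- by rewrite gsrc_rng.
- by rewrite grng_src groupoid_hom_src mul1g.
- by rewrite gsrc_src.
- by move=> [y s] /= [xy ->]; rewrite grngM // cM // mulgA.
- by move=> [y s] /= [xy _]; rewrite gsrcM.
- by move=> [y s] [z u] /= [xy _] [yz _]; rewrite gmulA.
- by rewrite gmul1l.
- by rewrite gmul1r.
- by rewrite grngV groupoid_homV mulKg.
- by rewrite gsrcV.
- by rewrite gmulV.
- by rewrite gmulVl.
Defined.

End SkewProduct.

(** Norms on modules over [R[i]] take values in (the nonnegative reals of)
    [R[i]]. *)
Definition normR (R : realType) (V : normedModType R[i]) (x : V) : R :=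
  complex.Re `|x|.

Record hilbert (R : realType) := Hilbert {
  hcar :> completeNormedModType R[i];
  hdot : {dot hcar for Num.conj};
  hdot_norm : forall x : hcar, `|x| ^+ 2 = hdot x x }.

(** A *-algebra presented as a linear subspace [sa_dom] of an ambient vector
    space; the operations are only meaningful on [sa_dom]. *)
Record star_algebra (R : realType) := StarAlgebra {
  sa_car :> lmodType R[i];
  sa_dom : set sa_car;
  sa_mul : sa_car -> sa_car -> sa_car;
  sa_star : sa_car -> sa_car }.

Record cstar_algebra (R : realType) := CstarAlgebra {
  ca_car :> completeNormedModType R[i];
  ca_mul : ca_car -> ca_car -> ca_car;
  ca_star : ca_car -> ca_car;
  ca_mul_linearl : forall z, linear (ca_mul ^~ z);
  ca_mul_linearr : forall z, linear (ca_mul z);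
  ca_mulA : forall x y z, ca_mul x (ca_mul y z) = ca_mul (ca_mul x y) z;
  ca_starD : forall x y, ca_star (x + y) = ca_star x + ca_star y;
  ca_starZ : forall (a : R[i]) x, ca_star (a *: x) = a^* *: ca_star x;
  ca_starK : involutive ca_star;
  ca_starM : forall x y, ca_star (ca_mul x y) = ca_mul (ca_star y) (ca_star x);
  ca_normM : forall x y, `|ca_mul x y| <= `|x| * `|y|;
  ca_cstar : forall x, `|ca_mul (ca_star x) x| = `|x| ^+ 2 }.

Definition cstar_star (R : realType) (A : cstar_algebra R) : star_algebra R :=
  @StarAlgebra R A setT (@ca_mul R A) (@ca_star R A).

Definition star_hom (R : realType) (A : star_algebra R) (B : cstar_algebra R)
    (h : A -> B) :=
  [/\ forall (a : R[i]) f g, sa_dom f -> sa_dom g ->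
        h (a *: f + g) = a *: h f + h g,
      forall f g, sa_dom f -> sa_dom g -> h (sa_mul f g) = ca_mul (h f) (h g) &
      forall f, sa_dom f -> h (sa_star f) = ca_star (h f)].

(** *-representations by bounded operators, possibly degenerate. *)
Definition star_rep (R : realType) (A : star_algebra R) (H : hilbert R)
    (pi : A -> H -> H) :=
  [/\ forall f, sa_dom f -> linear (pi f) /\ continuous (pi f),
      forall (a : R[i]) f g, sa_dom f -> sa_dom g -> forall x,
        pi (a *: f + g) x = a *: pi f x + pi g x,
      forall f g, sa_dom f -> sa_dom g -> forall x,
        pi (sa_mul f g) x = pi f (pi g x) &
      forall f, sa_dom f -> forall x y,
        hdot H (pi f x) y = hdot H x (pi (sa_star f) y)].

Definition opnorm (R : realType) (H : hilbert R) (T : H -> H) : \bar R :=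
  ereal_sup [set (normR (T x))%:E | x in [set x : H | normR x <= 1]].

(** [B], with [k], is the (Hausdorff) completion of [A] in the C*-seminorm
    [N]. *)
Definition cstar_completion (R : realType) (A : star_algebra R)
    (N : A -> \bar R) (B : cstar_algebra R) (k : A -> B) :=
  [/\ star_hom k, forall f, sa_dom f -> (normR (k f))%:E = N f &
      dense (k @` @sa_dom R A)].

Definition universal_norm (R : realType) (A : star_algebra R) (f : A) :
    \bar R :=
  ereal_sup [set x | exists (H : hilbert R) (pi : A -> H -> H),
    star_rep pi /\ x = opnorm (pi f)].

Definition enveloping_cstar (R : realType) (A : star_algebra R)
    (B : cstar_algebra R) (k : A -> B) :=
  cstar_completion (@universal_norm R A) k.

Section ConvolutionAlgebra.
Variables (R : realType) (Q : topologicalType) (Gr : groupoid Q).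

Definition groupoid_conv (f g : Q -> R[i]) : Q -> R[i] := fun x =>
  \sum_(y \in rfiber Gr (grng Gr x)) f y * g (gmul Gr (ginv Gr y) x).

Definition conv_star (f : Q -> R[i]) : Q -> R[i] := fun x =>
  (f (ginv Gr x))^*.

Definition Cc_groupoid : star_algebra R :=
  @StarAlgebra R (Q -> R[i]) (@Cc R[i] Q) groupoid_conv conv_star.

Definition groupoid_cstar (A : cstar_algebra R) (k : (Q -> R[i]) -> A) :=
  @enveloping_cstar R Cc_groupoid A k.

End ConvolutionAlgebra.

Section CrossedProduct.
Variables (R : realType) (G : groupType) (A : cstar_algebra R).

(** Continuity of each [beta s] is automatic for *-homomorphisms between
    C*-algebras. *)
Definition cstar_action (beta : G -> A -> A) :=
  [/\ forall s, star_hom (beta s : cstar_star A -> A) /\ continuous (beta s),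
      forall a, beta 1%g a = a &
      forall s t a, beta (s * t)%g a = beta s (beta t a)].

Variable beta : G -> A -> A.

Definition cp_mul (f g : G -> A) : G -> A := fun t =>
  \sum_(s \in [set: G]) ca_mul (f s) (beta s (g (s^-1 * t)%g)).

Definition cp_star (f : G -> A) : G -> A := fun t =>
  beta t (ca_star (f t^-1%g)).

Definition Cc_crossed : star_algebra R :=
  @StarAlgebra R (G -> A) [set f | finite_set [set s | f s != 0]]
    cp_mul cp_star.

Definition unitary_rep (H : hilbert R) (U : G -> H -> H) :=
  [/\ forall s, linear (U s), forall x, U 1%g x = x,
      forall s t x, U (s * t)%g x = U s (U t x) &
      forall s x y, hdot H (U s x) (U s y) = hdot H x y].

Definition covariant_rep (H : hilbert R) (pi : A -> H -> H) (U : G -> H -> H) :=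
  [/\ star_rep (pi : cstar_star A -> H -> H), unitary_rep U &
      forall s a x, U s (pi a x) = pi (beta s a) (U s x)].

Definition integrated (H : hilbert R) (pi : A -> H -> H) (U : G -> H -> H)
    (f : G -> A) : H -> H := fun x =>
  \sum_(s \in [set: G]) pi (f s) (U s x).

Definition full_norm (f : G -> A) : \bar R :=
  ereal_sup [set x | exists (H : hilbert R) (pi : A -> H -> H)
      (U : G -> H -> H), covariant_rep pi U /\ x = opnorm (integrated pi U f)].

(** The Hilbert space [l^2(G, H)] consists of the [xi : G -> H] with
    [l2norm xi < +oo]. *)
Definition l2norm (H : hilbert R) (xi : G -> H) : \bar R :=
  sqrte (\esum_(t in [set: G]) (normR (xi t) ^+ 2)%:E).

Definition l2opnorm (H : hilbert R) (T : (G -> H) -> G -> H) : \bar R :=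
  ereal_sup [set l2norm (T xi) | xi in [set xi | (l2norm xi <= 1)%E]].

(** The regular covariant representation [(regular_pi pi, regular_U)] on
    [l^2(G, H)] induced from a representation [pi] of [A] on [H], and its
    integrated form. *)
Definition regular_pi (H : hilbert R) (pi : A -> H -> H) (a : A)
    (xi : G -> H) : G -> H := fun t => pi (beta t^-1%g a) (xi t).

Definition regular_U (H : hilbert R) (s : G) (xi : G -> H) : G -> H :=
  fun t => xi (s^-1 * t)%g.

Definition regular_integrated (H : hilbert R) (pi : A -> H -> H) (f : G -> A)
    (xi : G -> H) : G -> H := fun t =>
  \sum_(s \in [set: G]) regular_pi pi (f s) (regular_U s xi) t.

Definition reduced_norm (f : G -> A) : \bar R :=
  ereal_sup [set x | exists (H : hilbert R) (pi : A -> H -> H),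
    star_rep (pi : cstar_star A -> H -> H) /\
    x = l2opnorm (regular_integrated pi f)].

Definition full_crossed_product (B : cstar_algebra R) (k : (G -> A) -> B) :=
  @cstar_completion R Cc_crossed full_norm B k.

Definition reduced_crossed_product (B : cstar_algebra R)
    (k : (G -> A) -> B) :=
  @cstar_completion R Cc_crossed reduced_norm B k.

(** The regular representation is the extension by continuity of the identity
    of [Cc_crossed]. *)
Definition regular_representation (B Br : cstar_algebra R)
    (k : (G -> A) -> B) (kr : (G -> A) -> Br) (L : B -> Br) :=
  [/\ star_hom (L : cstar_star B -> Br), continuous L &
      forall f : Cc_crossed, sa_dom f -> L (k f) = kr f].

End CrossedProduct.

(* Main.v *)
(** For [m] in [G] there is a *-homomorphism [corner m] from [C_c(Q)] to
    [C_c(G, A)], whose image is dense in the corner of the crossed product cut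
    out by the indicator function of [Q^0 x {m}].

    A *-representation [rho] of [C_c(Q)], [Q] amenable, is dominated by every
    C*-seminorm [normR (kap f)] that dominates the sup norm: for [xi] in
    [C_c(Q)] the functional [f |-> <rho ((xi * xi^* ) . f) h, h>] is positive
    and, on functions supported in a fixed compact set, bounded by a constant
    times the sup norm, hence times [normR (kap f)]; iterating Cauchy-Schwarz
    removes the constant, and amenability makes [xi * xi^*] tend to [1]
    uniformly on compact sets.  The reduced norm dominates the sup norm on
    corners, as the regular representation of [Q x_c G] on [l^2] shows, so [L]
    is isometric on the image of each corner.

    If [L b = 0] and [e] is the image under [corner m] of a function supported
    on the units, then [e^* b^* b e] lies in the closure of the corner and in
    the kernel of [L], so it vanishes and [b e = 0].  These [e] generate [B] as
    a right ideal, hence [b b^* = 0]. *)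

Require Import Defs.
From HB Require Import structures.
From mathcomp Require Import all_boot all_order all_algebra.
From mathcomp Require Import all_classical all_reals all_analysis.
From mathcomp Require Import complex ring lra.

Set Implicit Arguments.
Unset Strict Implicit.
Unset Printing Implicit Defensive.

Import Order.TTheory GRing.Theory Num.Theory numFieldNormedType.Exports.

Local Open Scope classical_set_scope.
Local Open Scope ring_scope.

(** * Norms, Hilbert spaces and finite sums *)

(** The crossed product is morally the algebra of the semidirect product groupoid of [Q x_c G] by
    [G]. Its reduction to [Q^0 x {m}] is a copy of [Q]: a point over [x] must have second coordinate
    [c(x)^-1 m] and group element [m^-1 c(x) m]. This is the origin of the formula for [corner m],
    and it lets amenability of [Q] act on each corner directly.

    The obstacle in comparing norms is that the iterated squares of [f] have growing supports, so a
    bound of [rho] by the sup norm on compact sets is not uniform along them. Pointwise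
    multiplication by a fixed positive definite [phi = xi * xi^*] confines all of them to the
    support of [phi] and, as a Schur product, preserves positivity. The constant is governed by the
    number of bisections that cover this support and is the same at every stage of the iteration.

    [A] and the crossed products are known only as completions, so inequalities on [C_c] must be
    carried over by density. Hence the extension of the regular representation of [Q x_c G] to [A],
    and the contractivity of representations of C*-algebras, which makes integrated forms
    bounded. *)

Section complex_norm.
Variable R : realType.
Local Notation C := (R[i] : numFieldType).
Lemma real_complex_continuous : continuous ((fun x : R => real_complex R x) : R -> C).
Proof.
move=> x; apply/cvgrPdist_lt => e e0.
have er : e = (complex.Re e)%:C%C by rewrite RRe_real // gtr0_real.
have e0' : 0 < complex.Re e by move: e0; rewrite er ltcR.
exists (complex.Re e) => // y /= xy.
by rewrite -rmorphB /= normc_def /= expr0n addr0 sqrtr_sqr er ltcR.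
Qed.

Lemma Re_continuous : continuous ((fun x => complex.Re x): C -> R).
Proof.
move=> x; apply/(@cvgrPdist_lt _ _ _ _ (@nbhs_filter C x)) => e e0.
exists (e%:C)%C => /=; first by rewrite ltcR.
move=> y /= xy; rewrite -ltcR; apply: le_lt_trans xy.
have -> : complex.Re x - complex.Re y = complex.Re (x - y) by case: (x) (y) => [a b] [c d].
exact: normc_ge_Re.
Qed.

Lemma conj_continuous : continuous ((fun x => x^*): C -> C).
Proof.
move=> x; apply/(@cvgrPdist_lt _ _ _ _ (@nbhs_filter C x)) => e e0.
by exists e => // y /= xy; rewrite -rmorphB norm_conjC.
Qed.

(** [R[i]] is only partially ordered; estimates are made with this real-valued modulus. *)
Definition cabs (z : R[i]) : R := complex.Re `|z|.
Lemma cabsE z : `|z| = (cabs z)%:C%C.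
Proof. by rewrite /cabs RRe_real // ger0_real. Qed.
Lemma cabs_ge0 z : 0 <= cabs z.
Proof. by rewrite -lecR -cabsE; exact: normr_ge0. Qed.
Lemma cabsM z w : cabs (z * w) = cabs z * cabs w.
Proof. by apply/complexI; rewrite rmorphM /= -!cabsE normrM. Qed.
Lemma cabsD z w : cabs (z + w) <= cabs z + cabs w.
Proof. by rewrite -lecR rmorphD /= -!cabsE ler_normD. Qed.
Lemma cabs0 : cabs 0 = 0.
Proof. by rewrite /cabs normr0. Qed.
Lemma cabs1 : cabs 1 = 1.
Proof. by rewrite /cabs normr1. Qed.
Lemma cabsN z : cabs (- z) = cabs z.
Proof. by rewrite /cabs normrN. Qed.
Lemma cabs0_eq0 z : cabs z = 0 -> z = 0.
Proof. by move=> h; apply/normr0_eq0; rewrite cabsE h. Qed.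
Lemma cabsJ z : cabs z^* = cabs z.
Proof. by rewrite /cabs norm_conjC. Qed.
Lemma cabs_real (x : R) : cabs x%:C%C = `|x|.
Proof. by rewrite /cabs normc_def /= expr0n addr0 sqrtr_sqr. Qed.
Lemma conj_real_complex (x : R) : (x%:C%C)^* = x%:C%C.
Proof. by rewrite conj_Creal // complex_real. Qed.
Lemma conjM z : z^* * z = (cabs z ^+ 2)%:C%C.
Proof. by rewrite mulrC -normCK cabsE rmorphXn. Qed.
Lemma cabs_sum (I : Type) (l : seq I) (P : pred I) (F : I -> R[i]) :
  cabs (\sum_(i <- l | P i) F i) <= \sum_(i <- l | P i) cabs (F i).
Proof.
elim/big_ind2: _ => //; first by rewrite cabs0.
by move=> a x b y ha hb; apply: le_trans (cabsD _ _) _; exact: lerD.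
Qed.
Section normR.
Variable V : normedModType R[i].
Implicit Types x y : V.
Lemma normRE x : `|x| = (normR x)%:C%C.
Proof. by rewrite /normR RRe_real // ger0_real. Qed.
Lemma normR_ge0 x : 0 <= normR x.
Proof. by rewrite -lecR -normRE; exact: normr_ge0. Qed.
Lemma normRD x y : normR (x + y) <= normR x + normR y.
Proof. by rewrite -lecR rmorphD /= -!normRE ler_normD. Qed.
Lemma normR0 : normR (0 : V) = 0.
Proof. by rewrite /normR normr0. Qed.
Lemma normR0_eq0 x : normR x = 0 -> x = 0.
Proof. by move=> h; apply/normr0_eq0; rewrite normRE h. Qed.
Lemma normRN x : normR (- x) = normR x.
Proof. by rewrite /normR normrN. Qed.
Lemma normRB x y : normR (x - y) = normR (y - x).
Proof. by rewrite /normR distrC. Qed.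
Lemma normRZ (a : R[i]) x : normR (a *: x) = cabs a * normR x.
Proof.
apply/complexI; rewrite rmorphM /= -[(normR (a *: x))%:C%C]normRE normrZ.
by rewrite -[(normR x)%:C%C]normRE; congr (_ * _); rewrite RRe_real // normr_real.
Qed.
End normR.

Section hilbert.
Variable H : hilbert R.
Implicit Types x y z : H.
Local Notation "'[ x , y ]" := (hdot H x y) : ring_scope.
Lemma hdotDl x y z : '[x + y, z] = '[x, z] + '[y, z].
Proof. exact: linearDl. Qed.
Lemma hdotBl x y z : '[x - y, z] = '[x, z] - '[y, z].
Proof. exact: linearBl. Qed.
Lemma hdotZl (a : R[i]) x z : '[a *: x, z] = a * '[x, z].
Proof. exact: linearZl_LR. Qed.
Lemma hdotC x y : '[x, y] = '[y, x]^*.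
Proof. by rewrite hermC expr0 mul1r. Qed.
Lemma hdotDr x y z : '[x, y + z] = '[x, y] + '[x, z].
Proof. exact: linearDr. Qed.
Lemma hdotBr x y z : '[x, y - z] = '[x, y] - '[x, z].
Proof. exact: linearBr. Qed.
Lemma hdotZr (a : R[i]) x z : '[x, a *: z] = a^* * '[x, z].
Proof. by rewrite linearZr_LR. Qed.
Lemma hdot0l x : '[0, x] = 0.
Proof. exact: linear0l. Qed.
Lemma hdot0r x : '[x, 0] = 0.
Proof. exact: linear0r. Qed.
Lemma hdotE x : '[x, x] = (normR x ^+ 2)%:C%C.
Proof. by rewrite -hdot_norm normRE rmorphXn. Qed.

(** With [a = |x|] and [b = |y|], expanding [|b x - a y|^2 >= 0] gives
    [2 a b (a b - Re <x, y>) >= 0], from which [a b] is cancelled. *)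
Lemma hdot_le x y : complex.Re '[x, y] <= normR x * normR y.
Proof.
have [/normR0_eq0 ->|x0] := eqVneq (normR x) 0.
  by rewrite hdot0l normR0 mul0r.
have [/normR0_eq0 ->|y0] := eqVneq (normR y) 0.
  by rewrite hdot0r normR0 mulr0.
have xp : 0 < normR x by rewrite lt_neqAle eq_sym x0 normR_ge0.
have yp : 0 < normR y by rewrite lt_neqAle eq_sym y0 normR_ge0.
set a := normR x in xp *; set b := normR y in yp *; set t := complex.Re _.
suff h : 0 <= (a * b) * (a * b - t).
  by move: h; rewrite pmulr_rge0 ?mulr_gt0 // subr_ge0.
have : 0 <= normR ((b%:C)%C *: x - (a%:C)%C *: y) ^+ 2 by exact: sqr_ge0.
suff -> : normR ((b%:C)%C *: x - (a%:C)%C *: y) ^+ 2 = (a * b) * (a * b - t) *+ 2.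
  by rewrite pmulrn_lge0.
apply/complexI; rewrite -hdotE hdotBl !hdotBr !hdotZl !hdotZr.
rewrite (hdotC y x) !hdotE -/a -/b /t; case: '[x, y] => u v.
by apply/eqP; rewrite eq_complex /=; apply/andP; split; apply/eqP; ring.
Qed.

End hilbert.
End complex_norm.

(** Compactness as an induction principle. If [P K] failed, the sets whose complement within [K]
    satisfies [P] would form a proper filter containing [K], and a cluster point in [K] would
    contradict the local hypothesis. *)
Lemma compact_ind (X : topologicalType) (P : set X -> Prop) (K : set X) :
  P set0 -> (forall A B, P A -> P B -> P (A `|` B)) ->
  (forall A B, A `<=` B -> P B -> P A) ->
  (forall x, K x -> exists2 U, nbhs x U & P (U `&` K)) ->
  compact K -> P K.
Proof.
move=> P0 PU PS Pl cK; apply: contrapT => nPK.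
pose F : set_system X := [set A | P (~` A `&` K)].
have FF : ProperFilter F.
  split.
    by rewrite /F /= setC0 setTI.
  split.
  - by rewrite /F /= setCT set0I.
  - by move=> A B FA FB; rewrite /F /= setCI setIUl; exact: PU.
  - move=> A B AB; rewrite /F /=; apply: PS; apply: setSI; exact: subsetC.
have FK : F K by rewrite /F /= setICl.
have [x [Kx cx]] := cK F FF FK.
have [U Ux PUK] := Pl x Kx.
have FU : F (~` U) by rewrite /F /= setCK.
by have [y []] := cx _ _ FU Ux.
Qed.

(** * Sums of finite support over arbitrary sets *)

Section fsum.
Variables (V : zmodType).

(** A sum whose support is infinite is 0 by convention, so linearity and exchange hold only under
    control of supports. Each such law is proved by passing to a common set [S] outside which the
    terms vanish. *)
Lemma fsum_fin (I : choiceType) (S P : set I) (F : I -> V) :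
  (forall i, P i -> ~ S i -> F i = 0) ->
  \sum_(i \in P) F i = \sum_(i \in P `&` S) F i.
Proof.
move=> h; apply/esym/fsbig_widen; first exact: subIsetl.
by move=> i [Pi /= nPS]; apply: h => // Si; apply: nPS.
Qed.

Lemma exchange_fsum (I J : choiceType) (S : set I) (T : set J) (P : set I) (Q : set J)
    (F : I -> J -> V) : finite_set S -> finite_set T ->
  (forall i j, P i -> Q j -> F i j <> 0 -> S i /\ T j) ->
  \sum_(i \in P) \sum_(j \in Q) F i j = \sum_(j \in Q) \sum_(i \in P) F i j.
Proof.
move=> fS fT h.
have h1 i j : P i -> Q j -> ~ S i -> F i j = 0.
  by move=> Pi Qj; apply: contra_notP => F0; case: (h i j Pi Qj F0).
have h2 i j : P i -> Q j -> ~ T j -> F i j = 0.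
  by move=> Pi Qj; apply: contra_notP => F0; case: (h i j Pi Qj F0).
transitivity (\sum_(i \in P `&` S) \sum_(j \in Q `&` T) F i j).
  rewrite (@fsum_fin _ S); last first.
    by move=> i Pi nSi; apply: fsbig1 => j Qj; exact: h1.
  apply: eq_fsbigr => i; rewrite inE => -[Pi _].
  by apply: fsum_fin => j Qj; exact: h2.
rewrite exchange_fsbig; [|exact: finite_setIr|exact: finite_setIr].
rewrite [RHS](@fsum_fin _ T); last first.
  by move=> j Qj nTj; apply: fsbig1 => i Pi; exact: h2.
apply: eq_fsbigr => j; rewrite inE => -[Qj _].
by apply/esym/fsum_fin => i Pi; exact: h1.
Qed.

Lemma fsum_split (I : choiceType) (S P : set I) (F G : I -> V) : finite_set S ->
  (forall i, P i -> ~ S i -> F i = 0) -> (forall i, P i -> ~ S i -> G i = 0) ->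
  \sum_(i \in P) (F i + G i) = \sum_(i \in P) F i + \sum_(i \in P) G i.
Proof.
move=> fS hF hG.
rewrite (@fsum_fin _ S P F) // (@fsum_fin _ S P G) // -fsbig_split; last exact: finite_setIr.
by apply: fsum_fin => i Pi nSi; rewrite hF // hG // addr0.
Qed.

End fsum.

Lemma raddf_fsum (V W : zmodType) (h : V -> W) (I : choiceType) (S P : set I) (F : I -> V) :
  h 0 = 0 -> (forall x y, h (x + y) = h x + h y) -> finite_set S ->
  (forall i, P i -> ~ S i -> F i = 0) ->
  h (\sum_(i \in P) F i) = \sum_(i \in P) h (F i).
Proof.
move=> h0 hD fS hF.
rewrite (fsum_fin (S := S)) // [RHS](fsum_fin (S := S)); last by move=> i Pi nSi; rewrite hF.
have fPS := finite_setIr P fS.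
by rewrite !fsbig_finite // (big_morph h hD h0).
Qed.

Lemma reindex_fsum (V : zmodType) (I J : choiceType) (f : I -> J) (g : J -> I) (P : set I) (Q : set J)
   (F : J -> V) :
  (forall i, P i -> Q (f i)) -> (forall j, Q j -> P (g j)) ->
  (forall i, P i -> g (f i) = i) -> (forall j, Q j -> f (g j) = j) ->
  \sum_(j \in Q) F j = \sum_(i \in P) F (f i).
Proof.
move=> PQ QP gf fg; apply: reindex_fsbig; split => //.
- by move=> i j; rewrite !inE => Pi Pj fij; rewrite -(gf i) // fij gf.
- by move=> j Qj; exists (g j); [exact: QP|exact: fg].
Qed.

(** * Compactly supported functions on an r-discrete groupoid *)

Section CcTheory.
Variables (K : numFieldType) (X : topologicalType).
Hypothesis Xh : hausdorff_space X.
Implicit Types f g : X -> K.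

Lemma CcI f (S : set X) : compact S -> continuous f -> (forall x, ~ S x -> f x = 0) ->
  Cc f.
Proof.
move=> cS cf f0; split=> //.
apply: (subclosed_compact _ cS); first exact: closed_closure.
have -> : S = closure S by apply/closure_id; exact: compact_closed.
by apply: closure_subset => x /= fx; apply: contrapT => /f0 /eqP; exact/negP.
Qed.

Lemma Cc_supp f : Cc f -> exists S, compact S /\ (forall x, ~ S x -> f x = 0).
Proof.
move=> [_ cf]; exists (closure [set x | f x != 0]); split => // x nx.
by apply/eqP/negPn/negP => fx; apply: nx; exact: subset_closure.
Qed.

Lemma Cc0 : Cc (0 : X -> K).
Proof. by apply: (@CcI _ set0) => //; [exact: compact0|move=> x; exact: cvg_cst]. Qed.

Lemma CcM f g : continuous f -> Cc g -> Cc (fun x => f x * g x).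
Proof.
move=> cf Cg; have [S [cS gS]] := Cc_supp Cg.
apply: (CcI cS); last by move=> x /gS ->; rewrite mulr0.
by move=> x; apply: continuousM; [exact: cf|exact: Cg.1].
Qed.

Lemma CcD f g : Cc f -> Cc g -> Cc (f + g).
Proof.
move=> Cf Cg; have [S [cS gS]] := Cc_supp Cg; have [T [cT gT]] := Cc_supp Cf.
apply: (@CcI _ (S `|` T)); first exact: compactU.
- by move=> x; apply: continuousD; [exact: Cf.1|exact: Cg.1].
- by move=> x nx; rewrite /GRing.add /= gT ?gS ?addr0 // => xS; apply: nx; [left|right].
Qed.

Lemma CcZ (a : K) f : Cc f -> Cc (a *: f).
Proof. by move=> Cf; apply: (@CcM (cst a)) => // x; exact: cvg_cst. Qed.

Lemma Cc_lin (a : K) f g : Cc f -> Cc g -> Cc (a *: f + g).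
Proof. by move=> Cf Cg; apply: CcD => //; exact: CcZ. Qed.

Lemma Cc_sum n (F : 'I_n -> X -> K) : (forall i, Cc (F i)) -> Cc (\sum_(i < n) F i).
Proof.
by move=> h; elim/big_ind: _ => //; [exact: Cc0|exact: CcD].
Qed.

End CcTheory.

Lemma hausdorff_prod (X Y : topologicalType) : hausdorff_space X -> hausdorff_space Y ->
  hausdorff_space (X * Y)%type.
Proof.
move=> hX hY [x y] [x' y'] cl; congr pair.
- apply: hX => A B xA xB.
  have nA : nbhs (x, y) (fst @^-1` A) by exact: cvg_fst.
  have nB : nbhs (x', y') (fst @^-1` B) by exact: cvg_fst.
  by have [p [pA pB]] := cl _ _ nA nB; exists p.1.
- apply: hY => A B xA xB.
  have nA : nbhs (x, y) (snd @^-1` A) by exact: cvg_snd.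
  have nB : nbhs (x', y') (snd @^-1` B) by exact: cvg_snd.
  by have [p [pA pB]] := cl _ _ nA nB; exists p.2.
Qed.

(** * Bisections, bump functions and partitions of unity *)

Section etale.
Variables (R : realType) (Q : topologicalType) (Gr : groupoid Q).
Local Notation C := (R[i] : numFieldType).
Hypothesis Qtop : topological_groupoid Gr.
Hypothesis Qh : hausdorff_space Q.
Hypothesis Qlc : locally_compact [set: Q].
Hypothesis Qrd : r_discrete Gr.
Local Notation r := (grng Gr).
Local Notation s := (gsrc Gr).
Local Notation inv := (ginv Gr).
Local Notation mul := (gmul Gr).

(** The third clause, openness of [r] on [U] relative to the units, is carried along because it
    provides the continuous section of [bisection_sec]. *)
Definition bisection (U : set Q) := [/\ open U, set_inj U r,
  forall V, open V -> V `<=` U -> exists2 W, open W & r @` V = W `&` units Gr &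
  set_inj U s].

Lemma rng_continuous : continuous r.
Proof. by case: Qrd. Qed.

Lemma inv_continuous : continuous inv.
Proof. by case: Qtop. Qed.

Lemma grng_inv x : r (inv x) = s x. Proof. exact: grngV. Qed.

Lemma ginvK x : inv (inv x) = x.
Proof.
have e1 : s (inv x) = r x by rewrite gsrcV.
have e2 : s (inv (inv x)) = r (inv x) by rewrite gsrcV.
rewrite -[LHS](gmul1r Gr) gsrcV grng_inv -(gmulVl Gr x) gmulA // ?gmulVl ?gsrcV ?gmul1l //.
Qed.

Lemma src_continuous : continuous s.
Proof.
have -> : s = r \o inv by apply/funext => x /=; rewrite grngV.
by move=> x; apply: continuous_comp; [exact: inv_continuous|exact: rng_continuous].
Qed.

Lemma bisection_ex x : exists2 U, bisection U & U x.
Proof.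
have [_ _ h] := Qrd.
have [U [oU Ux iU hU]] := h x; have [V [oV Vx iV hV]] := h (inv x).
exists (U `&` inv @^-1` V) => //; split.
- by apply: openI => //; apply: open_comp => // y _; exact: inv_continuous.
- by move=> y z; rewrite !inE => -[Uy _] [Uz _]; apply: iU; rewrite inE.
- by move=> W oW WU; apply: hU => // y /WU[].
- move=> y z; rewrite !inE => -[_ Vy] [_ Vz] yz.
  by rewrite -[y]ginvK -[z]ginvK; congr inv; apply: iV; rewrite ?inE // !grngV.
Qed.

Lemma gmulKV x y : r x = r y -> mul x (mul (inv x) y) = y.
Proof. by move=> xy; rewrite gmulA ?gsrcV ?grngV // gmulV xy gmul1l. Qed.
Lemma gmulK x y : s x = r y -> mul (inv x) (mul x y) = y.
Proof. by move=> xy; rewrite gmulA ?gsrcV // gmulVl xy gmul1l. Qed.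
Lemma grng_mulV x y : r x = r y -> r (mul (inv x) y) = s x.
Proof. by move=> xy; rewrite grngM ?grngV ?gsrcV. Qed.
Lemma ginv_mul x y : s x = r y -> inv (mul x y) = mul (inv y) (inv x).
Proof.
move=> xy.
have e : mul (mul x y) (mul (inv y) (inv x)) = r x.
  rewrite -gmulA ?grngM ?gsrcV ?grngV ?gsrcM //.
  by rewrite [mul y _]gmulA ?grngV ?gsrcV // gmulV -xy -{1}grng_inv gmul1l gmulV.
have rm : r (mul (inv y) (inv x)) = s y by rewrite grngM ?gsrcV ?grngV.
rewrite -(@gmulK (mul x y) (mul (inv y) (inv x))) ?gsrcM // e.
by rewrite -[r x](grngM xy) -gsrcV gmul1r.
Qed.
Lemma ginv_mulV x y : r x = r y -> inv (mul (inv x) y) = mul (inv y) x.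
Proof. by move=> xy; rewrite ginv_mul ?gsrcV // ginvK. Qed.
Lemma units_rng x : units Gr (r x). Proof. by exists x. Qed.

(** A bisection meets a fibre of [r] in at most one point, and finitely many bisections cover
    [K]. *)
Lemma compact_fiber_finite K u : compact K -> finite_set (rfiber Gr u `&` K).
Proof.
apply: (@compact_ind Q (fun A => finite_set (rfiber Gr u `&` A))).
- by rewrite setI0.
- by move=> A B fA fB; rewrite setIUr finite_setU.
- by move=> A B AB; apply: sub_finite_set; exact: setIS.
- move=> x Kx; have [U bU Ux] := bisection_ex x; exists U.
    by case: bU => oU _ _ _; exact: open_nbhs_nbhs.
  case: bU => _ iU _ _.
  have [[y [yu yU]]|ne] := pselect (exists y, rfiber Gr u y /\ (U `&` K) y); last first.
    rewrite (_ : _ `&` _ = set0) // -subset0 => y [yu yU]; apply: ne; by exists y.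
  apply: (@sub_finite_set _ _ [set y]) => // z [zu zU] /=.
  by apply: iU; rewrite ?inE; [case: zU|case: yU|rewrite zu yu].
Qed.

Lemma mul_cvg (T : Type) (F : set_system T) (FF : Filter F) (f g : T -> Q) a b :
  f @ F --> a -> g @ F --> b -> s a = r b ->
  (\forall x \near F, s (f x) = r (g x)) ->
  (fun x => mul (f x) (g x)) @ F --> mul a b.
Proof.
move=> fa gb ab fg; have [_ /subspace_continuousP mc] := Qtop.
have := mc (a, b) ab.
apply: cvg_trans => A /= hA.
have h : (f x, g x) @[x --> F] --> nbhs (a, b) by exact: cvg_pair.
have := h _ hA; rewrite /nbhs /= /within => h'.
by apply: filterS2 fg h' => x fgx; exact.
Qed.

Lemma bisection_sec (U : set Q) x0 y0 : bisection U -> U y0 -> r y0 = r x0 ->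
  exists t : Q -> Q, [/\ t @ x0 --> y0, t x0 = y0 &
    \forall x \near x0, U (t x) /\ r (t x) = r x].
Proof.
move=> [oU iU hU _] Uy0 yx0.
(* The inverse of [r] on [U]; the default [y0] is not met near [x0], because [r] maps [U] onto a
   relatively open set of units. *)
pose t x := xget y0 [set y | U y /\ r y = r x].
have tE x y : U y -> r y = r x -> t x = y.
  move=> Uy yx; apply: xget_unique => // z [Uz zx].
  by apply: iU; rewrite ?inE // zx yx.
(* For [V = U] this says that [t] is a section near [x0]; for small neighbourhoods [V] of [y0] it is
   the continuity of [t] at [x0]. *)
have key V : open V -> V `<=` U -> V y0 -> \forall x \near x0, V (t x) /\ r (t x) = r x.
  move=> oV VU Vy0; have [W oW rV] := hU V oV VU.
  have Wx0 : W (r x0).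
    have : (r @` V) (r y0) by exists y0.
    by rewrite rV yx0 => -[].
  have : nbhs x0 (r @^-1` W).
    by apply: rng_continuous; exact: open_nbhs_nbhs.
  apply: filterS => x Wx.
  have : (W `&` units Gr) (r x) by split => //; exact: units_rng.
  rewrite -rV => -[y Vy yx]; by rewrite (tE x y) //; exact: VU.
exists t; split.
- move=> A /= Ay0.
  have oV : open (U `&` A°) by apply: openI => //; exact: open_interior.
  have := key _ oV (@subIsetl _ _ _); rewrite /nbhs /=.
  move=> /(_ (conj Uy0 Ay0)); apply: filterS => x [[_ +] _].
  exact: interior_subset.
- exact: tE.
- exact: key.
Qed.

Lemma conv_bis (U K : set Q) (f g : Q -> R[i]) x y : bisection U -> K `<=` U ->
  (forall x, ~ K x -> f x = 0) -> U y -> r y = r x ->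
  groupoid_conv Gr f g x = f y * g (mul (inv y) x).
Proof.
move=> [_ iU _ _] KU fK Uy yx.
rewrite /groupoid_conv (@fsum_fin _ _ [set y]); last first.
  move=> z /= zx zy; rewrite fK ?mul0r // => /KU Uz; apply: zy.
  by apply: iU; rewrite ?inE // zx yx.
rewrite (_ : _ `&` _ = [set y]) ?fsbig_set1 //.
by apply/seteqP; split => [z []|z ->] //.
Qed.

Lemma conv_bis0 (K : set Q) (f g : Q -> R[i]) x :
  (forall x, ~ K x -> f x = 0) -> (forall y, K y -> r y <> r x) ->
  groupoid_conv Gr f g x = 0.
Proof.
move=> fK h; apply: fsbig1 => y yx; rewrite fK ?mul0r // => Ky; exact: h yx.
Qed.

(** Near a point whose range lies in [r U] the convolution is the single term
    [f (t x) * g ((t x)^-1 x)] for a continuous section [t]. At any other point it vanishes in a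
    neighbourhood, since [r K] is compact and hence closed. *)
Lemma conv_continuous_bis (U K : set Q) (f g : Q -> R[i]) : bisection U -> K `<=` U ->
  compact K -> (forall x, ~ K x -> f x = 0) ->
  continuous (f : Q -> C) -> continuous (g : Q -> C) -> continuous (groupoid_conv Gr f g : Q -> C).
Proof.
move=> bU KU cK fK cf cg x0.
have [[y0 [Uy0 yx0]]|ne] := pselect (exists y0, U y0 /\ r y0 = r x0).
  have [t [tc tx ht]] := bisection_sec bU Uy0 yx0.
  rewrite /continuous_at (conv_bis _ bU KU fK Uy0 yx0).
  have h : ((fun x => f (t x) * g (mul (inv (t x)) x)) : Q -> C) @ x0 --> (f y0 * g (mul (inv y0) x0) : C).
    apply: (@cvgM C).
      by apply: cvg_comp tc _; exact: cf.
    apply: (@cvg_comp _ _ _ (fun x => mul (inv (t x)) x) g _ (nbhs (mul (inv y0) x0))); last exact: cg.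
    apply: mul_cvg => //.
    - by apply: cvg_comp tc _; exact: inv_continuous.
    - by rewrite gsrcV.
    - by apply: filterS ht => x [_ ?]; rewrite gsrcV.
  apply: cvg_trans h; apply: near_eq_cvg.
  by apply: filterS ht => x [Utx tx']; rewrite (conv_bis _ bU KU fK Utx tx').
have rK : closed (r @` K).
  apply: compact_closed => //; apply: continuous_compact => //.
  by apply: continuous_subspaceT => x; exact: rng_continuous.
have N : nbhs x0 (r @^-1` (~` (r @` K))).
  apply: rng_continuous; apply: open_nbhs_nbhs; split; first by rewrite openC.
  by move=> [y Ky yx]; apply: ne; exists y; split => //; exact: KU.
rewrite /continuous_at (conv_bis0 (K := K)) //; last first.
  by move=> y Ky yx; apply: ne; exists y; split => //; exact: KU.
apply: (@cvg_trans _ (((fun=> 0) : Q -> C) @ x0)); last exact: cvg_cst.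
apply: near_eq_cvg.
apply: filterS N => x nx; rewrite (conv_bis0 (K := K)) // => y Ky yx.
by apply: nx; exists y.
Qed.

Lemma bump_function (x : Q) : exists (U K : set Q) (e : Q -> R), [/\ bisection U, compact K, K `<=` U &
  [/\ continuous e, forall y, 0 <= e y, forall y, ~ K y -> e y = 0 &
  nbhs (x : Q) [set y | 1 <= e y]]].
Proof.
have [U bU Ux] := bisection_ex x.
have [N Nx [cN clN]] : exists2 N, nbhs x N & compact N /\ closed N.
  have [N] := Qlc (I : [set: Q] x); rewrite withinET => Nx cN.
  by exists N.
have oU : open U by case: bU.
have clB : closed (~` (U `&` N°)).
  by rewrite closedC; apply: openI => //; exact: open_interior.
have nBx : ~ (~` (U `&` N°)) x by apply; split.
have := @locally_compact_completely_regular Q R Qlc Qh x _ clB nBx.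
move=> /(@uniform_separatorP _ R)[f [cf f01 fx fB]].
have fx0 : f x = 0 by apply: fx; exists x.
have f1 y : ~ (U `&` N°) y -> f y = 1 by move=> ny; apply: fB; exists y.
(* The separating function [f] is 0 at [x] and 1 off [U] and the interior of [N]. So [e >= 1] where
   [f <= 1/4], and [e] vanishes outside the compact set [f <= 1/2]. *)
pose e y := Num.max 0 (2 - 4 * f y).
exists U, [set y | f y <= 2^-1], e; split => //.
- apply: (subclosed_compact _ cN).
    apply: (@preimage_closed _ _ f [set y | y <= 2^-1]); last exact: closed_le.
    by move=> ? _; exact: cf.
  move=> y /= fy; apply: interior_subset; apply: contrapT => ny.
  by have := f1 y; rewrite (_ : f y = 1 <-> False) => [|]; [apply=> -[]|split=> // h; move: fy; rewrite h; lra].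
- move=> y /= fy; apply: contrapT => ny.
  have h : f y = 1 by apply: f1 => -[].
  by move: fy; rewrite h; lra.
- split.
  + move=> y; apply: (@continuous_max _ _ (cst 0) (fun y => 2 - 4 * f y)); first exact: cvg_cst.
    apply: (@continuousB R R _ (cst 2)); first exact: cvg_cst.
    by apply: (@continuousM R _ (cst 4)); [exact: cvg_cst|exact: cf].
  + by move=> y; rewrite /e le_max lexx.
  + move=> y /= /negP; rewrite -ltNge /e => fy; apply/max_idPl; lra.
  + have : nbhs x (f @^-1` [set z | z < 4^-1]).
      apply: cf; apply: open_nbhs_nbhs; split; first exact: open_lt.
      by rewrite /= fx0 invr_gt0.
    apply: filterS => y /= fy; rewrite /e le_max; apply/orP; right; lra.
Qed.

Definition bisected (e : Q -> R) := exists U K,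
  [/\ bisection U, compact K, K `<=` U & forall y, ~ K y -> e y = 0].

Lemma cover_bump K : compact K -> exists n (e : nat -> Q -> R),
  [/\ forall i, continuous (e i), forall i y, 0 <= e i y,
     forall i, bisected (e i) & forall y, K y -> 1 <= \sum_(i < n) e i y].
Proof.
pose P A := exists n (e : nat -> Q -> R), [/\ forall i, continuous (e i), forall i y, 0 <= e i y,
     forall i, bisected (e i) & forall y, A y -> 1 <= \sum_(i < n) e i y].
apply: (@compact_ind Q P).
(* The families are indexed by all of [nat], so even the empty family needs a bisection carrying the
   zero function; when [Q] has no point, the empty set is one. *)
- have b0 : bisected (cst 0).
    have [[x]|ne] := pselect (exists x : Q, True).
      by have [U bU Ux] := bisection_ex x; exists U, set0; split => //; exact: compact0.
    have q0 (A : set Q) : A = set0 by apply/seteqP; split => x // _; case: ne; exists x.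
    exists set0, set0; split => //; last exact: compact0.
    split; [exact: open0|by move=> x y; rewrite inE| |by move=> x y; rewrite inE].
    move=> V oV _; exists set0; first exact: open0.
    by rewrite (q0 V) image_set0 set0I.
  by exists 0, (fun=> cst 0); split => // i; exact: cst_continuous.
- move=> A B [n [e [ce e0 be hA]]] [m [d [cd d0 bd hB]]].
  exists (n + m)%N, (fun i => if (i < n)%N then e i else d (i - n)%N); split.
  + by move=> i; case: ifP.
  + by move=> i; case: ifP.
  + by move=> i; case: ifP.
  + move=> y ABy; rewrite big_split_ord /=.
    under eq_bigr do rewrite ltn_ord.
    under [X in _ + X]eq_bigr do rewrite ltnNge leq_addr /= addKn.
    have he : 0 <= \sum_(i < n) e i y by apply: sumr_ge0.
    have hd : 0 <= \sum_(i < m) d i y by apply: sumr_ge0.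
    case: ABy => [/hA|/hB] h; lra.
- move=> A B AB [n [e [ce e0 be hB]]]; exists n, e; split => // y /AB; exact: hB.
- move=> x Kx; have [U [N [e [bU cN NU [ce e0 eN ex]]]]] := bump_function x.
  exists [set y | 1 <= e y] => //; exists 1, (fun=> e); split => //.
    by move=> _; exists U, N.
  by move=> y [/= ey _]; rewrite big_ord_recl big_ord0 addr0.
Qed.

Lemma continuous_sum_ord (n : nat) (e : nat -> Q -> R) : (forall i, continuous (e i)) ->
  continuous (fun y => \sum_(i < n) e i y).
Proof.
move=> ce; elim: n => [|n IH].
  by under eq_fun do rewrite big_ord0; exact: cst_continuous.
under eq_fun do rewrite big_ord_recr /=.
by move=> x; apply: (@continuousD R R); [exact: IH|exact: ce].
Qed.

Lemma partition_of_unity K : compact K -> exists n (e : nat -> Q -> R),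
  [/\ forall i, continuous (e i), forall i y, 0 <= e i y <= 1,
     forall i, bisected (e i) & forall y, K y -> \sum_(i < n) e i y = 1].
Proof.
move=> /cover_bump[n [e [ce e0 be hK]]].
(* The maximum with 1 keeps the quotients continuous and at most 1 everywhere; on [K] the divisor is
   the sum itself. *)
pose S y := Num.max 1 (\sum_(i < n) e i y).
have S1 y : 1 <= S y by rewrite /S le_max lexx.
have Sp y : 0 < S y by apply: lt_le_trans (S1 y).
have cS : continuous S.
  move=> y; apply: (@continuous_max _ _ (cst 1)); first exact: cvg_cst.
  exact: (continuous_sum_ord ce).
pose d i := if (i < n)%N then fun y => e i y / S y else cst 0.
exists n, d; split.
- move=> i; rewrite /d; case: ifP => _; last exact: cst_continuous.
  move=> y; apply: (@continuousM R _ (e i) (fun y => (S y)^-1)); first exact: ce.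
  by apply: (@cvgV R); [rewrite gt_eqF|exact: cS].
- move=> i y; rewrite /d; case: ifP => lin; last by rewrite lexx ler01.
  rewrite divr_ge0 ?(ltW (Sp y)) //= ler_pdivrMr // mul1r /S le_max; apply/orP; right.
  rewrite (bigD1 (Ordinal lin)) //= lerDl; exact: sumr_ge0.
- move=> i; have [U [N [bU cN NU eN]]] := be i; exists U, N; split => // y /eN.
  by rewrite /d; case: ifP => //= _ ->; rewrite mul0r.
- move=> y /hK h; rewrite /d; under eq_bigr do rewrite ltn_ord.
  by rewrite -mulr_suml /S (max_idPr h) divff // gt_eqF //; apply: lt_le_trans h.
Qed.

(** * Convolution and involution on [C_c(Q)] *)

Local Notation conv := (groupoid_conv Gr).
Local Notation star := (conv_star Gr).
Implicit Types (f g h : Q -> R[i]).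

Lemma fct_addE (T : Type) (V : zmodType) (u v : T -> V) x : (u + v) x = u x + v x.
Proof. by []. Qed.
Lemma fct_scaleE (T : Type) (a : R[i]) (u : T -> R[i]) x : (a *: u) x = a * u x.
Proof. by []. Qed.

Lemma fiber_fin K u f : compact K -> (forall y, ~ K y -> f y = 0) ->
  forall y, rfiber Gr u y -> ~ (rfiber Gr u `&` K) y -> f y = 0.
Proof. by move=> cK fK y yx ny; rewrite fK // => Ky; exact: ny. Qed.

Lemma conv_linl a f1 f2 g : @Cc C Q f1 -> @Cc C Q f2 ->
  conv (a *: f1 + f2) g = a *: conv f1 g + conv f2 g.
Proof.
move=> /Cc_supp[K1 [cK1 f1K]] /Cc_supp[K2 [cK2 f2K]]; apply/funext => x.
rewrite fct_addE fct_scaleE /groupoid_conv mulr_fsumr.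
have cK := compactU cK1 cK2.
rewrite -(@fsum_split _ _ (rfiber Gr (r x) `&` (K1 `|` K2))).
- by apply: eq_fsbigr => y _; rewrite fct_addE fct_scaleE mulrDl mulrA.
- exact: compact_fiber_finite.
- move=> y yx ny; rewrite f1K ?mul0r ?mulr0 // => Ky; apply: ny; split => //; by left.
- move=> y yx ny; rewrite f2K ?mul0r ?mulr0 // => Ky; apply: ny; split => //; by right.
Qed.

Lemma conv_linr a f g1 g2 : @Cc C Q f ->
  conv f (a *: g1 + g2) = a *: conv f g1 + conv f g2.
Proof.
move=> /Cc_supp[K [cK fK]]; apply/funext => x.
rewrite fct_addE fct_scaleE /groupoid_conv mulr_fsumr.
rewrite -(@fsum_split _ _ (rfiber Gr (r x) `&` K)).
- by apply: eq_fsbigr => y _; rewrite fct_addE fct_scaleE mulrDr mulrCA.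
- exact: compact_fiber_finite.
- by move=> y yx ny; rewrite (fiber_fin cK fK yx ny) mul0r mulr0.
- by move=> y yx ny; rewrite (fiber_fin cK fK yx ny) mul0r.
Qed.

Lemma conv0l g : conv 0 g = 0.
Proof. by apply/funext => x; apply: fsbig1 => y _; rewrite mul0r. Qed.

Lemma conv_suml n (F : 'I_n -> Q -> R[i]) g : (forall i, @Cc C Q (F i)) ->
  conv (\sum_(i < n) F i) g = \sum_(i < n) conv (F i) g.
Proof.
elim: n F => [|n IH] F hF; first by rewrite !big_ord0 conv0l.
rewrite !big_ord_recl -[F ord0 as X in conv (X + _)]scale1r conv_linl //.
  by rewrite scale1r IH.
by apply: (@Cc_sum C).
Qed.

Lemma bisected_decomposition f : @Cc C Q f -> exists n (F : 'I_n -> Q -> R[i]),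
  [/\ forall i, @Cc C Q (F i), f = \sum_(i < n) F i,
   forall i x, cabs (F i x) <= cabs (f x) &
   forall i, exists U K, [/\ bisection U, compact K, K `<=` U & forall y, ~ K y -> F i y = 0]].
Proof.
move=> Cf; have [K [cK fK]] := Cc_supp Cf.
have [n [e [ce e01 be eK]]] := partition_of_unity cK.
exists n, (fun i x => (e i x)%:C%C * f x); split.
- move=> i; apply: (@CcM C) => //.
  move=> x; apply: (@continuous_comp _ _ _ (e i) (fun y : R => real_complex R y : C)); first exact: ce.
  exact: real_complex_continuous.
- apply/funext => x; rewrite fct_sumE -mulr_suml -(raddf_sum (real_complex R)) /=.
  have [Kx|nKx] := pselect (K x); first by rewrite eK // mul1r.
  by rewrite fK // mulr0.
- move=> i x; rewrite cabsM -[leRHS]mul1r ler_wpM2r ?cabs_ge0 //.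
  have /andP[h0 h1] := e01 i x.
  by rewrite cabs_real ger0_norm.
- move=> i; have [U [N [bU cN NU eN]]] := be i; exists U, N; split => // y /eN ->.
  by rewrite mul0r.
Qed.

Lemma conv_continuous f g : @Cc C Q f -> continuous (g : Q -> C) ->
  continuous (conv f g : Q -> C).
Proof.
move=> Cf cg; have [n [F [CF fE _ bF]]] := bisected_decomposition Cf.
rewrite fE conv_suml; last exact: CF.
have hF : forall i, continuous (conv (F i) g : Q -> C).
  move=> i; have [U [K [bU cK KU FK]]] := bF i.
  by apply: (conv_continuous_bis bU KU cK FK _ cg); case: (CF i).
apply: (big_ind (fun G : Q -> R[i] => continuous (G : Q -> C))).
- by move=> x; exact: cvg_cst.
- by move=> a b ha hb x; apply: (@continuousD C C); [exact: ha|exact: hb].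
- by move=> i _; exact: hF.
Qed.

Lemma closed_eqfun (X : topologicalType) (u v : X -> Q) : continuous u -> continuous v ->
  closed [set x | u x = v x].
Proof.
move=> cu cv p clp; apply: Qh => A B uA vB.
have nA : nbhs p (u @^-1` A) by exact: cu.
have nB : nbhs p (v @^-1` B) by exact: cv.
have := clp _ (filterI nA nB).
by move=> [x [/= uv [Aux Bvx]]]; exists (u x); split => //; rewrite uv.
Qed.

Definition setmul (K1 K2 : set Q) := (fun p => mul p.1 p.2) @`
  ((K1 `*` K2) `&` [set p : Q * Q | s p.1 = r p.2]).

Lemma compact_setmul K1 K2 : compact K1 -> compact K2 -> compact (setmul K1 K2).
Proof.
move=> c1 c2; apply: continuous_compact.
  apply: (@continuous_subspaceW _ _ _ [set p : Q * Q | s p.1 = r p.2]); last by case: Qtop.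
  by move=> ? [].
apply: (@subclosed_compact _ _ (K1 `*` K2)).
- apply: closedI; first by apply: compact_closed; [exact: hausdorff_prod|exact: compact_setX].
  apply: closed_eqfun => p.
    by apply: (@continuous_comp _ _ _ fst s); [exact: cvg_fst|exact: src_continuous].
  by apply: (@continuous_comp _ _ _ snd r); [exact: cvg_snd|exact: rng_continuous].
- exact: compact_setX.
- exact: subIsetl.
Qed.

Lemma conv_supp K1 K2 f g : (forall x, ~ K1 x -> f x = 0) -> (forall x, ~ K2 x -> g x = 0) ->
  forall x, ~ setmul K1 K2 x -> conv f g x = 0.
Proof.
move=> fK gK x nx; apply: fsbig1 => y yx.
have [Ky|/fK ->] := pselect (K1 y); last by rewrite mul0r.
have [Kz|/gK ->] := pselect (K2 (mul (inv y) x)); last by rewrite mulr0.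
exfalso; apply: nx; exists (y, mul (inv y) x) => /=; last by rewrite gmulKV.
by split; [split|rewrite /= grng_mulV].
Qed.

Lemma conv_Cc f g : @Cc C Q f -> @Cc C Q g -> @Cc C Q (conv f g).
Proof.
move=> Cf Cg; have [K1 [cK1 fK]] := Cc_supp Cf; have [K2 [cK2 gK]] := Cc_supp Cg.
apply: (@CcI C _ Qh _ (setmul K1 K2)).
- exact: compact_setmul.
- by apply: conv_continuous => //; case: Cg.
- exact: conv_supp.
Qed.

Lemma compact_inv K : compact K -> compact (inv @` K).
Proof.
move=> cK; apply: continuous_compact => //; apply: continuous_subspaceT.
exact: inv_continuous.
Qed.

Lemma compact_rng K : compact K -> compact (r @` K).
Proof.
move=> cK; apply: continuous_compact => //; apply: continuous_subspaceT.
exact: rng_continuous.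
Qed.

Lemma star_supp K f : (forall x, ~ K x -> f x = 0) ->
  forall x, ~ (inv @` K) x -> star f x = 0.
Proof.
move=> fK x nx; rewrite /conv_star fK ?conjC0 // => Kx; apply: nx.
by exists (inv x) => //; rewrite ginvK.
Qed.

Lemma star_Cc f : @Cc C Q f -> @Cc C Q (star f).
Proof.
move=> Cf; have [K [cK fK]] := Cc_supp Cf.
apply: (@CcI C _ Qh _ (inv @` K)).
- exact: compact_inv.
- move=> x; have cfi : {for x, continuous (f \o inv : Q -> C)}.
    by apply: continuous_comp; [exact: inv_continuous|exact: Cf.1].
  exact: (@continuous_comp Q C C _ (fun y : C => y^* : C) x cfi (@conj_continuous _ _)).
- exact: star_supp.
Qed.

Lemma conv_starK f : star (star f) = f.
Proof. by apply/funext => x; rewrite /conv_star ginvK conjCK. Qed.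

Lemma conv_starM f g : @Cc C Q f -> star (conv f g) = conv (star g) (star f).
Proof.
move=> Cf; have [K [cK fK]] := Cc_supp Cf; apply/funext => x.
rewrite /conv_star /groupoid_conv grng_inv.
rewrite (@raddf_fsum _ _ (fun z : R[i] => z^*) _ (rfiber Gr (s x) `&` K)); last first.
- by move=> y yx ny; rewrite (fiber_fin cK fK yx ny) mul0r.
- exact: compact_fiber_finite.
- by move=> u v; rewrite rmorphD.
- by rewrite conjC0.
rewrite (@reindex_fsum _ _ _ (fun z => mul (inv x) z) (fun y => mul x y) (rfiber Gr (r x))) /=.
- apply: eq_fsbigr => z; rewrite inE /rfiber /= => zx.
  rewrite ginv_mulV // -gmulA ?gsrcV ?grngV // gmulV -zx -gsrcV gmul1r.
  by rewrite rmorphM mulrC ginv_mulV ?zx.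
- by move=> z zx; rewrite /rfiber /= grng_mulV.
- by move=> y yx; rewrite /rfiber /= grngM.
- by move=> z zx; rewrite gmulKV.
- by move=> y yx; rewrite gmulK.
Qed.
Lemma conv_assoc f g h : @Cc C Q f -> @Cc C Q g -> conv f (conv g h) = conv (conv f g) h.
Proof.
move=> Cf Cg; have [K [cK fK]] := Cc_supp Cf; have [L [cL gL]] := Cc_supp Cg.
apply/funext => x; rewrite /groupoid_conv.
(* The summand after the substitution [w = y z], which brings both sums over the range fibre of
   [x]. *)
pose F y w := f y * g (mul (inv y) w) * h (mul (inv w) x).
transitivity (\sum_(y \in rfiber Gr (r x)) \sum_(w \in rfiber Gr (r x)) F y w).
  apply: eq_fsbigr => y; rewrite inE /rfiber /= => yx.
  rewrite grng_mulV // mulr_fsumr.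
  rewrite (@reindex_fsum _ _ _ (fun w => mul (inv y) w) (fun z => mul y z) (rfiber Gr (r x))) /=.
  - apply: eq_fsbigr => w; rewrite inE /rfiber /= => wx.
    rewrite /F -mulrA; congr (_ * (_ * h _)).
    rewrite ginv_mulV ?yx // -gmulA ?gsrcV ?grng_mulV ?yx //.
    by rewrite gmulKV.
  - by move=> w; rewrite /rfiber /= => wx; rewrite grng_mulV ?yx.
  - by move=> z; rewrite /rfiber /= => zx; rewrite grngM.
  - by move=> w wx; rewrite gmulKV ?yx.
  - by move=> z zx; rewrite gmulK.
pose S := rfiber Gr (r x) `&` K.
have fS : finite_set S by exact: compact_fiber_finite.
rewrite (@exchange_fsum _ _ _ S (\bigcup_(y in S) (mul y @` (rfiber Gr (s y) `&` L)))) //.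
- apply: eq_fsbigr => w; rewrite inE /rfiber /= => wx.
  by rewrite mulr_fsuml wx.
- by apply: bigcup_finite => // y _; apply: finite_image; exact: compact_fiber_finite.
- move=> y w yx wx; rewrite /F => F0.
  have Ky : K y by apply: contrapT => /fK fy; apply: F0; rewrite fy !mul0r.
  have Lw : L (mul (inv y) w).
    by apply: contrapT => /gL gy; apply: F0; rewrite gy mulr0 mul0r.
  split => //; exists y => //; exists (mul (inv y) w).
    by split => //; rewrite /rfiber /= grng_mulV // yx wx.
  by rewrite gmulKV // yx wx.
Qed.

Lemma Cc_bounded f : @Cc C Q f -> exists2 M : R, 0 <= M & forall x, cabs (f x) <= M.
Proof.
move=> Cf; have [K [cK fK]] := Cc_supp Cf.
have [[x0 Kx0]|ne] := pselect (exists x, K x); last first.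
  by exists 0 => // x; rewrite fK ?cabs0 // => Kx; apply: ne; exists x.
have cn : {within K, continuous (fun x => cabs (f x))}.
  apply: continuous_subspaceT => x.
  apply: (@continuous_comp Q C R (fun x => `|f x| : C) (fun y : C => complex.Re y)).
    apply: (@continuous_comp Q C C (f : Q -> C) (fun y : C => `|y| : C)); first exact: Cf.1.
    exact: (@norm_continuous C C).
  exact: Re_continuous.
have [|c _ hc] := compact_EVT_max _ cK cn; first by exists x0.
exists (cabs (f c)); first exact: cabs_ge0.
move=> x; have [Kx|nKx] := pselect (K x); first by apply: hc; rewrite inE.
by rewrite fK // cabs0 cabs_ge0.
Qed.

(** Each of the [n] pieces of [f] lives on a bisection and contributes at most one term of size [M]
    to a fibre. Applied to [f] and to [star f], this is the finiteness of the I-norm that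
    [conv_ell2_bound] needs. *)
Lemma Cc_fiber_bound f : @Cc C Q f -> exists2 M : R, 0 <= M &
  forall u, \sum_(y \in rfiber Gr u) cabs (f y) <= M.
Proof.
move=> Cf; have [M M0 fM] := Cc_bounded Cf.
have [n [F [CF fE Ff bF]]] := bisected_decomposition Cf.
exists (n%:R * M); first by rewrite mulr_ge0.
move=> u; have [K [cK fK]] := Cc_supp Cf.
pose S := rfiber Gr u `&` K.
have fS : finite_set S by exact: compact_fiber_finite.
rewrite (@fsum_fin _ _ S); last first.
  by move=> y yu ny; rewrite (fiber_fin cK fK yu ny) cabs0.
have fS' := finite_setIr (rfiber Gr u) fS.
set l := finmap.enum_fset (fset_set (rfiber Gr u `&` S)).
have lE (F' : Q -> R) : \sum_(y \in rfiber Gr u `&` S) F' y = \sum_(y <- l) F' y.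
  by rewrite fsbig_finite.
rewrite lE; apply: (@le_trans _ _ (\sum_(y <- l) \sum_(i < n) cabs (F i y))).
  by apply: ler_sum => y _; rewrite fE fct_sumE; exact: cabs_sum.
rewrite exchange_big /= mulr_natl.
rewrite -[X in _ *+ X](card_ord n) -sumr_const; apply: ler_sum => i _.
have [U [L [[_ iU _ _] cL LU FL]]] := bF i.
have fM' y : cabs (F i y) <= M by apply: le_trans (Ff i y) (fM y).
rewrite -lE.
have [[y [[yu _] Ly]]|ne] := pselect (exists y, (rfiber Gr u `&` S) y /\ L y); last first.
  rewrite fsbig1 // => y yS; rewrite FL ?cabs0 // => Ly.
  by apply: ne; exists y.
rewrite (@fsum_fin _ _ [set y]); last first.
  move=> z [zu _] zy; rewrite FL ?cabs0 // => Lz; apply: zy.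
  by apply: iU; rewrite ?inE; [exact: LU|exact: LU|rewrite zu yu].
have [/eqP Fy|Fy] := boolP (F i y == 0).
  rewrite fsbig1 // => z [_ ->]; by rewrite Fy cabs0.
rewrite (_ : rfiber Gr u `&` S `&` [set y] = [set y]) ?fsbig_set1 //.
apply/seteqP; split => [z []//|z ->]; split => //; split => //; split => //.
apply: contrapT => /fK fy; move/eqP: Fy; apply; apply: cabs0_eq0; apply/eqP.
by rewrite eq_le cabs_ge0 andbT; apply: le_trans (Ff i y) _; rewrite fy cabs0.
Qed.

End etale.

(** * Representations of an amenable groupoid *)

Section star_rep_theory.
Variables (R : realType) (A : star_algebra R) (H : hilbert R) (rho : A -> H -> H).
Hypothesis hrho : star_rep rho.

Lemma rep_linear f : sa_dom f -> linear (rho f).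
Proof. by move=> df; case: hrho => /(_ f df)[]. Qed.
Lemma repDr f x y : sa_dom f -> rho f (x + y) = rho f x + rho f y.
Proof. by move=> df; rewrite -[x]scale1r rep_linear // !scale1r. Qed.
Lemma rep0r f : sa_dom f -> rho f 0 = 0.
Proof.
move=> df; have := repDr 0 0 df; rewrite addr0 => /(congr1 (fun z => z - rho f 0)).
by rewrite addrK subrr.
Qed.
Lemma repZr f a x : sa_dom f -> rho f (a *: x) = a *: rho f x.
Proof. by move=> df; rewrite -[a *: x]addr0 rep_linear // rep0r // addr0. Qed.
Lemma rep_lin a f g x : sa_dom f -> sa_dom g ->
  rho (a *: f + g) x = a *: rho f x + rho g x.
Proof. by move=> df dg; case: hrho => _ ->. Qed.
Lemma repD f g x : sa_dom f -> sa_dom g -> rho (f + g) x = rho f x + rho g x.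
Proof. by move=> df dg; rewrite -[f]scale1r rep_lin // !scale1r. Qed.
Lemma rep0 x : @sa_dom R A 0 -> rho 0 x = 0.
Proof.
move=> d0; have := repD x d0 d0; rewrite addr0 => /(congr1 (fun z => z - rho 0 x)).
by rewrite addrK subrr.
Qed.
Lemma repZ a f x : @sa_dom R A 0 -> sa_dom f -> rho (a *: f) x = a *: rho f x.
Proof. by move=> d0 df; rewrite -[a *: f]addr0 rep_lin // rep0 // addr0. Qed.
Lemma repM f g x : sa_dom f -> sa_dom g -> rho (sa_mul f g) x = rho f (rho g x).
Proof. by move=> df dg; case: hrho => _ _ ->. Qed.
Lemma rep_adj f x y : sa_dom f -> hdot H (rho f x) y = hdot H x (rho (sa_star f) y).
Proof. by move=> df; case: hrho => _ _ _ ->. Qed.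
Lemma rep_norm f x : sa_dom f -> sa_dom (sa_star f) ->
  (normR (rho f x) ^+ 2)%:C%C = hdot H x (rho (sa_mul (sa_star f) f) x).
Proof. by move=> df dsf; rewrite -hdotE rep_adj // repM. Qed.
End star_rep_theory.

Lemma exchange_fsum_ord (V : zmodType) (I : choiceType) n (S P : set I) (F : 'I_n -> I -> V) :
  finite_set S -> (forall i z, P z -> ~ S z -> F i z = 0) ->
  \sum_(z \in P) \sum_(i < n) F i z = \sum_(i < n) \sum_(z \in P) F i z.
Proof.
move=> fS F0.
rewrite [RHS](eq_bigr (fun i => \sum_(z \in P `&` S) F i z)); last first.
  by move=> i _; apply: fsum_fin => z; exact: F0.
rewrite (fsum_fin (S := S)); last by move=> z Pz nz; rewrite big1 // => i _; exact: F0.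
have fPS := finite_setIr P fS.
rewrite fsbig_finite // exchange_big; apply: eq_bigr => i _.
by rewrite fsbig_finite.
Qed.

(** * Inequalities in the reals *)

Section real_lemmas.
Variable R : realType.

(** The quadratic is evaluated at its minimum [g / b]; if [b = 0] and [g != 0] it is affine and
    takes the value -1 at [(c + 1) / (2 g)]. *)
Lemma discriminant_le (c g b : R) : 0 <= b ->
  (forall t, 0 <= c - t * g *+ 2 + t ^+ 2 * b) -> g ^+ 2 <= c * b.
Proof.
rewrite le_eqVlt => /predU1P[<-|b0] h.
  rewrite mulr0; have [->|g0] := eqVneq g 0; first by rewrite expr0n.
  have := h ((c + 1) / (g *+ 2)).
  rewrite mulr0 addr0 -mulrnAr divfK ?mulrn_eq0 //; lra.
have := h (g / b).
have -> : c - g / b * g *+ 2 + (g / b) ^+ 2 * b = (c * b - g ^+ 2) / b.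
  by field; rewrite gt_eqF.
by rewrite pmulr_lge0 ?invr_gt0 // subr_ge0.
Qed.

Lemma bernoulli_ineq n (t : R) : 1 < t -> 1 + n%:R * (t - 1) <= t ^+ n.
Proof.
move=> t1; elim: n => [|n IH]; first by rewrite mul0r addr0 expr0.
rewrite exprS -(ler_pM2l (lt_trans ltr01 t1)) in IH *.
apply: le_trans IH; rewrite -natr1.
have : 0 <= n%:R * (t - 1) ^+ 2 by rewrite mulr_ge0 // sqr_ge0.
nra.
Qed.

Lemma exists_expn_gt (c t : R) : 1 < t -> exists n, c < t ^+ n.
Proof.
move=> t1; exists (Num.bound (`|c| / (t - 1))).
apply: lt_le_trans (bernoulli_ineq _ t1).
rewrite -ltrBlDl -ltr_pdivrMr ?subr_gt0 //; apply: le_lt_trans (archi_boundP _); last first.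
  by rewrite divr_ge0 // subr_ge0 ltW.
rewrite ler_pM2r ?invr_gt0 ?subr_gt0 //; apply: le_trans (ler_norm c).
by rewrite lerBlDr lerDl.
Qed.

(** Removes the constant [c] from the bound on [a 0]. *)
Lemma iterated_square_le (a : nat -> R) (b c M : R) : 0 <= b -> 0 <= M ->
  (forall n, 0 <= a n) -> (forall n, a n ^+ 2 <= b * a n.+1) ->
  (forall n, a n <= c * M ^+ (2 ^ n)) -> a 0 <= b * M.
Proof.
move=> b0 M0 a0 aS aM; rewrite leNgt; apply/negP => h.
have ap : 0 < a 0 by apply: le_lt_trans h; exact: mulr_ge0.
have bp : 0 < b.
  rewrite lt_neqAle b0 andbT; apply/eqP => b00.
  by have := aS 0%N; rewrite -b00 mul0r leNgt exprn_gt0.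
have Mp : 0 < M.
  rewrite lt_neqAle M0 andbT; apply/eqP => b00.
  by have := aM 0%N; rewrite -b00 expr1 mulr0 leNgt ap.
(* The excess factor [t > 1] propagates through the square inequalities as [b (t M)^(2^n) <= a n],
   so [t^(2^n) <= c / b] for every [n], which is absurd. *)
set t := a 0 / (b * M).
have bM : 0 < b * M by exact: mulr_gt0.
have t1 : 1 < t by rewrite /t ltr_pdivlMr // mul1r.
have low n : b * (t * M) ^+ (2 ^ n) <= a n.
  elim: n => [|n IH]; first by rewrite expr1 mulrCA mulrA -mulrA /t divfK ?gt_eqF.
  rewrite -(ler_pM2l bp); apply: le_trans (aS n).
  have -> : b * (b * (t * M) ^+ (2 ^ n.+1)) = (b * (t * M) ^+ (2 ^ n)) ^+ 2.
    by rewrite expnS mulnC exprM; ring.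
  rewrite ler_pXn2r ?nnegrE //.
  by rewrite mulr_ge0 // exprn_ge0 // mulr_ge0 // ltW // (lt_trans ltr01).
have tb n : t ^+ (2 ^ n) <= c / b.
  rewrite ler_pdivlMr // -(@ler_pM2r _ (M ^+ (2 ^ n))) ?exprn_gt0 //.
  rewrite [t ^+ _ * b]mulrC -mulrA -exprMn; exact: le_trans (low n) (aM n).
have [N hN] := exists_expn_gt (c / b) t1.
have := tb N; rewrite leNgt => /negP; apply; apply: (lt_le_trans hN).
by apply: ler_weXn2l; [exact: ltW|exact/ltnW/ltn_expl].
Qed.
End real_lemmas.


Section cstar_theory.
Variables (R : realType) (A : cstar_algebra R).
Local Notation "x ** y" := (ca_mul x y) (at level 40).
Local Notation st := (@ca_star R A).
Implicit Types x y : A.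

Lemma ca_norm_mul x y : normR (x ** y) <= normR x * normR y.
Proof. by rewrite -lecR rmorphM /= -!normRE ca_normM. Qed.
Lemma ca_norm_star x : normR (st x ** x) = normR x ^+ 2.
Proof. by apply/complexI; rewrite rmorphXn /= -!normRE ca_cstar. Qed.
Lemma ca_star_le x : normR x <= normR (st x).
Proof.
have [/eqP|x0] := eqVneq (normR x) 0; first by move=> /eqP ->; exact: normR_ge0.
have xp : 0 < normR x by rewrite lt_neqAle eq_sym x0 normR_ge0.
by rewrite -(ler_pM2r xp) -expr2 -ca_norm_star ca_norm_mul.
Qed.
Lemma ca_norm_adj x : normR (st x) = normR x.
Proof. by apply/eqP; rewrite eq_le ca_star_le -{2}[x]ca_starK ca_star_le. Qed.
End cstar_theory.

(** One list serves every group [V] and every summand, so that real and complex sums over the same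
    set can be compared term by term. *)
Lemma finite_enum (I : choiceType) (P : set I) : finite_set P -> exists l : seq I,
  [/\ uniq l, forall y, y \in l -> P y &
  forall (V : zmodType) (F : I -> V), \sum_(y \in P) F y = \sum_(y <- l) F y].
Proof.
move=> /finite_seqP[l ->]; exists (undup l); split => [|y|V F]; rewrite ?undup_uniq ?mem_undup //.
rewrite [RHS]fsbig_seq ?undup_uniq //; apply: eq_fsbigl.
by apply/seteqP; split => y /=; rewrite mem_undup.
Qed.

(** * Bounds for a representation of [C_c(Q)] *)

Section amenable_rep.
Variables (R : realType) (Q : topologicalType) (Gr : groupoid Q).
Local Notation C := (R[i] : numFieldType).
Hypothesis Qtop : topological_groupoid Gr.
Hypothesis Qh : hausdorff_space Q.
Hypothesis Qlc : locally_compact [set: Q].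
Hypothesis Qrd : r_discrete Gr.
Local Notation r := (grng Gr).
Local Notation s := (gsrc Gr).
Local Notation inv := (ginv Gr).
Local Notation mul := (gmul Gr).
Local Notation conv := (groupoid_conv Gr).
Local Notation star := (conv_star Gr).
Local Notation pmul f g := (fun x => f x * g x).
Implicit Types (f g h a b phi xi : Q -> R[i]).
Variables (H : hilbert R) (rho : (Q -> R[i]) -> H -> H).
Hypothesis hrho : @star_rep R (Cc_groupoid R Gr) H rho.

Definition unit_supported f := forall x, r x <> x -> f x = 0.

Lemma unit_src x : r x = x -> s x = x.
Proof. by move=> rx; rewrite -{1}rx gsrc_rng. Qed.

Lemma unit_inv x : r x = x -> inv x = x.
Proof.
by move=> rx; rewrite -[inv x](gmul1l Gr) grngV unit_src // -{3}rx -gmulV.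
Qed.

Lemma conv_unit f g x : unit_supported f -> conv f g x = f (r x) * g x.
Proof.
move=> uf; rewrite /groupoid_conv (@fsum_fin _ _ [set r x]); last first.
  move=> y /= yx ny; rewrite uf ?mul0r // => ry; apply: ny; by rewrite -ry yx.
have rr := grng_rng Gr x.
rewrite (_ : _ `&` _ = [set r x]) ?fsbig_set1 ?unit_inv ?gmul1l //.
by apply/seteqP; split => [y []//|y ->].
Qed.

(** [M^2 - p] is the square of [M - k] for [k = M - sqrt (M^2 - p)]. Unlike the square root, [k]
    vanishes wherever [p] does and so belongs to [C_c]; hence [M^2 |h|^2 - <h, rho p h> = |M h - rho
    k h|^2] makes sense in an algebra without unit. *)
Lemma unit_rep_bound p (M : R) (h : H) : @Cc C Q p -> unit_supported p -> 0 <= M ->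
  (forall x, exists2 t : R, p x = (t%:C)%C & 0 <= t <= M ^+ 2) ->
  complex.Re (hdot H h (rho p h)) <= M ^+ 2 * normR h ^+ 2.
Proof.
move=> Cp up M0 pM.
have pE x : p x = (complex.Re (p x))%:C%C by have [t ->] := pM x.
have pM' x : 0 <= complex.Re (p x) <= M ^+ 2 by have [t ->] := pM x.
pose k0 x : R := M - Num.sqrt (M ^+ 2 - complex.Re (p x)).
pose k : Q -> R[i] := fun x => (k0 x)%:C%C.
have k00 x : p x = 0 -> k x = 0.
  by move=> px; rewrite /k /k0 px /= subr0 sqrtr_sqr ger0_norm // subrr.
have uk : unit_supported k by move=> x /up /k00.
have Ck : @Cc C Q k.
  have [K [cK pK]] := Cc_supp Cp.
  apply: (CcI Qh cK); last by move=> x /pK /k00.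
  move=> x; apply: (@continuous_comp Q R C k0 (fun y : R => real_complex R y : C)); last exact: real_complex_continuous.
  apply: (@continuousB R R _ (cst M)); first exact: cvg_cst.
  apply: (@continuous_comp Q R R (fun x => M ^+ 2 - complex.Re (p x))); last exact: sqrt_continuous.
  apply: (@continuousB R R _ (cst (M ^+ 2))); first exact: cvg_cst.
  by apply: (@continuous_comp Q C R p); [exact: Cp.1|exact: Re_continuous].
have kk : conv k k + p = (M *+ 2)%:C%C *: k + 0.
  apply/funext => x; rewrite !fct_addE fct_scaleE conv_unit // [X in _ = _ + X](_ : _ = 0) // addr0.
  have [rx|nx] := pselect (r x = x); last first.
    by rewrite (uk x nx) (up x nx) !mulr0 addr0.
  rewrite rx [p x]pE /k -!rmorphM -rmorphD /=; congr (_%:C)%C.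
  have /andP[_ p2] := pM' x.
  have := @sqr_sqrtr _ (M ^+ 2 - complex.Re (p x)); rewrite subr_ge0 => /(_ p2).
  rewrite /k0; set q := Num.sqrt _; set P := complex.Re _ => qq.
  have -> : P = M ^+ 2 - q ^+ 2 by rewrite qq; ring.
  ring.
have kE : star k = k.
  apply/funext => x; rewrite /conv_star.
  have [rx|nx] := pselect (r x = x); first by rewrite unit_inv // /k conj_real_complex.
  rewrite [RHS]uk // uk ?conjC0 // => rx; apply: nx.
  by rewrite -[x](ginvK Gr) unit_inv // rx.
have Ckk : @Cc C Q (conv k k) by exact: conv_Cc.
have C0 := @Cc0 C _ Qh.
have := congr1 (fun f => hdot H h (rho f h)) kk.
rewrite /= (repD hrho) // (rep_lin hrho) // (rep0 hrho) // addr0.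
rewrite (repM hrho) // hdotDr hdotZr conj_real_complex.
have -> : hdot H h (rho k (rho k h)) = (normR (rho k h) ^+ 2)%:C%C.
  by rewrite -hdotE (rep_adj hrho) // [sa_star _]kE.
move=> /(congr1 (@complex.Re R)); rewrite raddfD /=.
set v := hdot H h (rho k h); set w := complex.Re (hdot H h (rho p h)).
have -> : complex.Re ((M *+ 2)%:C%C * v) = M *+ 2 * complex.Re v.
  by case: v => a b /=; rewrite mul0r subr0.
move=> e.
have : 0 <= normR ((M%:C)%C *: h - rho k h) ^+ 2 by exact: sqr_ge0.
have -> : normR ((M%:C)%C *: h - rho k h) ^+ 2 =
   M ^+ 2 * normR h ^+ 2 - M *+ 2 * complex.Re v + normR (rho k h) ^+ 2.
  apply/complexI; rewrite -hdotE hdotBl !hdotBr !hdotZl !hdotZr conj_real_complex !hdotE.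
  rewrite (hdotC (rho k h) h) -/v; case: v {e} => a b.
  by apply/eqP; rewrite eq_complex /=; apply/andP; split; apply/eqP; ring.
rewrite -e; lra.
Qed.

(** [f^* f] vanishes off the units because [r] is injective on [U], and its value at a unit is a
    single [|f|^2] or 0 because [s] is; [unit_rep_bound] then applies to it. *)
Lemma bis_rep_bound U K f (M : R) (h : H) : bisection Gr U -> K `<=` U ->
  (forall x, ~ K x -> f x = 0) -> @Cc C Q f -> 0 <= M -> (forall x, cabs (f x) <= M) ->
  normR (rho f h) <= M * normR h.
Proof.
move=> [oU iU _ sU] KU fK Cf M0 fM.
have Csf : @Cc C Q (star f) by exact: star_Cc.
rewrite -(@ler_pXn2r _ 2) ?nnegrE ?normR_ge0 ?mulr_ge0 ?normR_ge0 //.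
rewrite exprMn -[leLHS](_ : complex.Re ((normR (rho f h) ^+ 2)%:C%C) = _) //.
rewrite (rep_norm hrho) //.
have fU x : f x <> 0 -> U x by move=> fx; apply: KU; apply: contrapT => /fK.
apply: unit_rep_bound => //.
- exact: conv_Cc.
- move=> x nx; apply: fsbig1 => z /= zx; rewrite /conv_star.
  have [f0|/eqP f0] := eqVneq (f (inv z)) 0; first by rewrite f0 conjC0 mul0r.
  have [g0|/eqP g0] := eqVneq (f (mul (inv z) x)) 0; first by rewrite g0 mulr0.
  exfalso; apply: nx.
  have e : inv z = mul (inv z) x.
    by apply: iU; rewrite ?inE; [exact: fU|exact: fU|rewrite grng_mulV // grngV].
  have := congr1 (mul z) e; rewrite gmulKV // gmulV => <-.
  by rewrite grng_rng.
- move=> x.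
  have [rx|nx] := pselect (r x = x); last first.
    exists 0; last by rewrite lexx sqr_ge0.
    apply: fsbig1 => z /= zx; rewrite /conv_star.
    have [f0|/eqP f0] := eqVneq (f (inv z)) 0; first by rewrite f0 conjC0 mul0r.
    have [g0|/eqP g0] := eqVneq (f (mul (inv z) x)) 0; first by rewrite g0 mulr0.
    exfalso; apply: nx.
    have e : inv z = mul (inv z) x.
      by apply: iU; rewrite ?inE; [exact: fU|exact: fU|rewrite grng_mulV // grngV].
    have := congr1 (mul z) e; rewrite gmulKV // gmulV => <-.
    by rewrite grng_rng.
  have [[z [zx fz]]|ne] := pselect (exists z, r z = r x /\ f (inv z) <> 0); last first.
    exists 0; last by rewrite lexx sqr_ge0.
    apply: fsbig1 => z /= zx; rewrite /= /conv_star.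
    have [f0|/eqP f0] := eqVneq (f (inv z)) 0; first by rewrite f0 conjC0 mul0r.
    by exfalso; apply: ne; exists z.
  exists (cabs (f (inv z)) ^+ 2); last first.
    by rewrite sqr_ge0 /= ler_pXn2r ?nnegrE ?cabs_ge0.
  rewrite /= /groupoid_conv (@fsum_fin _ _ [set z]); last first.
    move=> y /= yx; apply: contra_notP => F0.
    rewrite -[y](ginvK Gr) -[z](ginvK Gr); congr inv; apply: sU; rewrite ?inE ?gsrcV ?yx //.
      by apply: fU => f0; apply: F0; rewrite /conv_star f0 conjC0 mul0r.
    exact: fU.
  rewrite (_ : rfiber Gr (r x) `&` [set z] = [set z]) ?fsbig_set1; last first.
    by apply/seteqP; split => [y []//|y ->].
  rewrite /conv_star -conjM; congr (_ * f _).
  by rewrite -[RHS](gmul1r Gr) gsrcV zx rx.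
Qed.

(** A product of two sums has no cross terms when [nu] meets the fibre in at most one point. This is
    what allows the weights of a partition of unity to be split between two factors in
    [posdef_mul_square]. *)
Lemma bisection_prod U (nu A B : Q -> R[i]) u : set_inj U r ->
  (forall x, ~ U x -> nu x = 0) ->
  (\sum_(w \in rfiber Gr u) nu w * A w) * (\sum_(w \in rfiber Gr u) nu w * B w) =
  \sum_(w \in rfiber Gr u) nu w ^+ 2 * (A w * B w).
Proof.
move=> iU nuU.
have [[w [wu Uw]]|ne] := pselect (exists w, rfiber Gr u w /\ U w); last first.
  rewrite !fsbig1 ?mul0r // => w wu; rewrite nuU ?mul0r ?expr0n ?mul0r // => Uw; by apply: ne; exists w.
have nu0 z : rfiber Gr u z -> ~ [set w] z -> nu z = 0.
  move=> zu zw; apply: nuU => Uz; apply: zw; apply: iU; rewrite ?inE //.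
  by rewrite zu wu.
have e : rfiber Gr u `&` [set w] = [set w] by apply/seteqP; split => [y []//|y ->].
have eF (F : Q -> R[i]) k : \sum_(z \in rfiber Gr u) nu z ^+ k.+1 * F z = nu w ^+ k.+1 * F w.
  rewrite (fsum_fin (S := [set w])) ?e ?fsbig_set1 //.
  by move=> z zu zw; rewrite (nu0 z zu zw) expr0n mul0r.
by rewrite (eF A 0%N) (eF B 0%N) (eF _ 1%N) expr1; ring.
Qed.

(** [b_i] is [a (nu_i * xi^* )], the squares [nu_i ^ 2] forming a partition of
    unity. *)
Lemma posdef_mul_square xi a : @Cc C Q xi -> @Cc C Q a ->
  exists n (b : 'I_n -> Q -> R[i]), (forall i, @Cc C Q (b i)) /\
  pmul (conv xi (star xi)) (conv (star a) a) = \sum_(i < n) conv (star (b i)) (b i).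
Proof.
move=> Cxi Ca; have [Kxi [cKxi xiK]] := Cc_supp Cxi; have [Ka [cKa aK]] := Cc_supp Ca.
(* A [w] with [z^-1] in [Ka] and [z w] in [Kxi] lies in this product, so the partition of unity sums
   to 1 at every term that counts. *)
have cK : compact (setmul Gr Ka Kxi) by exact: compact_setmul.
have [n [e [ce e01 be eK]]] := partition_of_unity R Qtop Qh Qlc Qrd cK.
pose nu i : Q -> R[i] := fun x => (Num.sqrt (e i x))%:C%C.
have Cnu i : @Cc C Q (nu i).
  have [U [N [bU cN NU eN]]] := be i.
  apply: (CcI Qh cN); last by move=> x /eN; rewrite /nu => ->; rewrite sqrtr0.
  move=> x; apply: (@continuous_comp Q R C (fun x => Num.sqrt (e i x)) (fun y : R => real_complex R y : C)); last exact: real_complex_continuous.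
  by apply: (@continuous_comp Q R R (e i)); [exact: ce|exact: sqrt_continuous].
have nu2 i x : nu i x ^+ 2 = (e i x)%:C%C.
  rewrite /nu -rmorphXn /= sqr_sqrtr //; by case/andP: (e01 i x).
pose b (i : 'I_n) := pmul a (conv (nu i) (star xi)).
have Cc1 i : @Cc C Q (conv (nu i) (star xi)) by apply: conv_Cc => //; exact: star_Cc.
exists n, b; split.
  by move=> i; apply: (@CcM C) => //; case: Ca.
apply/funext => x; rewrite fct_sumE.
rewrite -(@exchange_fsum_ord _ _ _ (rfiber Gr (r x) `&` (inv @` Ka))); last first.
- move=> i z zx nz; rewrite /conv_star /b aK ?mul0r ?conjC0 ?mul0r // => Kz; apply: nz.
  by split => //; exists (inv z) => //; rewrite ginvK.
- by apply: compact_fiber_finite => //; exact: compact_inv.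
rewrite [X in _ * X]/groupoid_conv mulr_fsumr; apply: eq_fsbigr => z.
rewrite inE /rfiber /= => zx.
have [Kz|nKz] := pselect (Ka (inv z)); last first.
  have -> : star a z = 0 by rewrite /conv_star aK // conjC0.
  rewrite mul0r mulr0 big1 // => i _.
  by rewrite /conv_star /b aK // mul0r conjC0 mul0r.
transitivity (star a z * a (mul (inv z) x) *
   \sum_(i < n) ((conv (nu i) (star xi) (inv z))^* * conv (nu i) (star xi) (mul (inv z) x))); last first.
  rewrite mulr_sumr; apply: eq_bigr => i _; rewrite /b /conv_star rmorphM; ring.
rewrite mulrC; congr (_ * _).
(* After the substitution [y = z w], the value of [xi * xi^*] at [x] is the sum of [T] over the
   range fibre of [s z]. The weights [nu_i^2] are then inserted, and each is shared between the two
   factors of [T]. *)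
pose T w := xi (mul z w) * (xi (mul (inv x) (mul z w)))^*.
transitivity (\sum_(w \in rfiber Gr (s z)) T w).
  rewrite {1}/groupoid_conv -zx.
  rewrite (@reindex_fsum _ _ _ (fun w => mul z w) (fun y => mul (inv z) y) (rfiber Gr (s z))).
  - apply: eq_fsbigr => w; rewrite inE /rfiber /= => wz.
    by rewrite /T /conv_star ginv_mulV // grngM ?wz // zx.
  - by move=> w; rewrite /rfiber /= => wz; rewrite grngM.
  - by move=> y; rewrite /rfiber /= => yz; rewrite grng_mulV.
  - by move=> w; rewrite /rfiber /= => wz; rewrite gmulK.
  - by move=> y; rewrite /rfiber /= => yz; rewrite gmulKV.
transitivity (\sum_(w \in rfiber Gr (s z)) \sum_(i < n) nu i w ^+ 2 * T w).
  apply: eq_fsbigr => w; rewrite inE /rfiber /= => wz.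
  rewrite -mulr_suml.
  have [Kw|nKw] := pselect (Kxi (mul z w)); last first.
    by rewrite /T xiK // mul0r mulr0.
  under eq_bigr do rewrite nu2.
  rewrite -(raddf_sum (real_complex R)) /= eK ?mul1r //.
  exists (inv z, mul z w); last by rewrite /= gmulK.
  by split; [split|rewrite /= gsrcV grngM].
have [N [cN nuN]] : exists N, compact N /\ forall (i : 'I_n) w, ~ N w -> nu i w = 0.
  have h i : exists N, compact N /\ forall w, ~ N w -> nu i w = 0 by exact: (@Cc_supp C).
  exists (\big[setU/set0]_(i < n) (sval (cid (h i)))); split.
    by apply: bigsetU_compact => i _; case: (svalP (cid (h i))).
  move=> i w nw; have [_] := svalP (cid (h i)); apply; apply: contra_not nw => Nw.
  by rewrite (bigD1 i) //=; left.
rewrite (@exchange_fsum_ord _ _ _ (rfiber Gr (s z) `&` N)); last first.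
- by move=> i w wz nw; rewrite (nuN i) ?expr0n ?mul0r // => Nw; exact: nw.
- exact: compact_fiber_finite.
apply: eq_bigr => i _.
have [U [L [[_ iU _ _] cL LU eL]]] := be i.
have nuU w : ~ U w -> nu i w = 0.
  by move=> nw; rewrite /nu eL ?sqrtr0 // => /LU.
rewrite /groupoid_conv grngV grng_mulV //.
rewrite (raddf_fsum (S := rfiber Gr (s z) `&` N) (h := fun t : R[i] => t^*)); last first.
- by move=> w wz nw; rewrite (nuN i) ?mul0r // => Nw; exact: nw.
- exact: compact_fiber_finite.
- by move=> u v; rewrite rmorphD.
- by rewrite conjC0.
transitivity ((\sum_(w \in rfiber Gr (s z)) nu i w * xi (mul z w)) *
   (\sum_(w \in rfiber Gr (s z)) nu i w * star xi (mul (inv w) (mul (inv z) x)))); last first.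
  congr (_ * _); apply: eq_fsbigr => w; rewrite inE /rfiber /= => wz.
  have -> : star xi (mul (inv w) (inv z)) = (xi (mul z w))^*.
    by rewrite /conv_star ginv_mulV ?grngV // ginvK.
  by rewrite rmorphM /= conjCK conj_real_complex.
rewrite (bisection_prod _ _ _ iU nuU); apply: eq_fsbigr => w; rewrite inE /rfiber /= => wz.
rewrite /T /conv_star; congr (_ * (_ * (xi _)^*)).
rewrite ginv_mulV ?grng_mulV ?wz // ginv_mulV // gmulA //.
  by rewrite gsrcV.
Qed.

(** [xi] is the square root [q] of an approximately invariant [g i]. The value of [xi * xi^*] at [x]
    is the sum of [q y * q (x^-1 y)], and [|q q' - q^2| <= |q'^2 - q^2|] for nonnegative reals
    bounds its distance from the sum of [q^2] by the defect of invariance. *)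
Lemma posdef_approx K (e : R) : amenable R Gr -> compact K -> 0 < e ->
  exists xi : Q -> R[i], @Cc C Q xi /\ forall x, K x -> cabs (conv xi (star xi) x - 1) <= e.
Proof.
move=> [I [le [g [[_ _ let_ dirI] hg _ hone hinv]]]] cK e0.
have e20 : 0 < e / 2 by rewrite divr_gt0.
have rKu : r @` K `<=` units Gr by move=> u [x _ <-]; exact: units_rng.
have [i1 h1] := hone (r @` K) (compact_rng Qrd cK) rKu _ e20.
have [i2 h2] := hinv K cK _ e20.
have [i [l1 l2]] := dirI i1 i2.
have {}h1 := h1 i l1; have {}h2 := h2 i l2.
have [Cg g0] := hg i; set G := g i in Cg g0 h1 h2.
have [L [cL GL]] := Cc_supp Cg.
pose q x := Num.sqrt (G x).
pose xi : Q -> R[i] := fun x => (q x)%:C%C.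
exists xi; split.
  apply: (CcI Qh cL); last by move=> x /GL; rewrite /xi /q => ->; rewrite sqrtr0.
  move=> x; apply: (@continuous_comp Q R C q (fun y : R => real_complex R y : C)); last exact: real_complex_continuous.
  by apply: (@continuous_comp Q R R G); [exact: Cg.1|exact: sqrt_continuous].
move=> x Kx.
(* Contains the supports, within the fibre, of [G] and of its translate by [x], so that all the sums
   run over one list [l]. *)
pose S := rfiber Gr (r x) `&` (L `|` [set y | L (mul (inv x) y)]).
have fS : finite_set S.
  rewrite /S setIUr finite_setU; split; first exact: compact_fiber_finite.
  apply: (@sub_finite_set _ _ (mul x @` (rfiber Gr (s x) `&` L))).
    move=> y [yx Ly]; exists (mul (inv x) y); last by rewrite gmulKV.
    by split => //; rewrite /rfiber /= grng_mulV.
  by apply: finite_image; exact: compact_fiber_finite.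
have S1 y : rfiber Gr (r x) y -> ~ S y -> G y = 0.
  by move=> yx ny; apply: GL => Ly; apply: ny; split => //; left.
have S2 y : rfiber Gr (r x) y -> ~ S y -> G (mul (inv x) y) = 0.
  by move=> yx ny; apply: GL => Ly; apply: ny; split => //; right.
have fPS := finite_setIr (rfiber Gr (r x)) fS.
have [l [_ lP lE0]] := finite_enum fPS.
have lE (V : zmodType) (F : Q -> V) : (forall y, rfiber Gr (r x) y -> ~ S y -> F y = 0) ->
    \sum_(y \in rfiber Gr (r x)) F y = \sum_(y <- l) F y.
  by move=> F0; rewrite (fsum_fin (S := S)).
have cE : conv xi (star xi) x = (\sum_(y <- l) q y * q (mul (inv x) y))%:C%C.
  rewrite /groupoid_conv lE; last by move=> y yx ny; rewrite /xi /q S1 // sqrtr0 mul0r.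
  rewrite raddf_sum /=; apply: eq_big_seq => y yl.
  have [yx _] := lP y yl.
  by rewrite /conv_star ginv_mulV // /xi conj_real_complex rmorphM.
have {}h2 := h2 x Kx; have {}h1 := h1 (r x) (ex_intro2 _ _ x Kx erefl).
rewrite lE in h1; last by move=> y yx ny; rewrite S1.
rewrite lE in h2; last by move=> y yx ny; rewrite (S1 y yx ny) (S2 y yx ny) subrr normr0.
rewrite cE -(rmorph1 (real_complex R)) -rmorphB /= cabs_real.
have -> : \sum_(y <- l) q y * q (mul (inv x) y) - 1 =
  (\sum_(y <- l) G y - 1) + \sum_(y <- l) (q y * q (mul (inv x) y) - G y).
  by rewrite sumrB; ring.
apply: (le_trans (ler_normD _ _)); rewrite [leRHS]splitr; apply: lerD; first exact: ltW.
apply: le_trans (ltW h2); apply: le_trans (ler_norm_sum _ _ _) _.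
apply: ler_sum => y _.
rewrite -{1}[G y]sqr_sqrtr ?g0 // -[G (mul _ _)]sqr_sqrtr ?g0 // -[G y in leRHS]sqr_sqrtr ?g0 // -/(q y) -/(q _).
have -> : q y * q (mul (inv x) y) - q y ^+ 2 = q y * (q (mul (inv x) y) - q y) by ring.
have -> : q (mul (inv x) y) ^+ 2 - q y ^+ 2 = (q (mul (inv x) y) + q y) * (q (mul (inv x) y) - q y) by ring.
have q0 z : 0 <= q z by exact: sqrtr_ge0.
rewrite !normrM ler_wpM2r //.
by rewrite !ger0_norm ?addr_ge0 // lerDr.
Qed.

Lemma rep_sum n (F : 'I_n -> Q -> R[i]) (h : H) : (forall i, @Cc C Q (F i)) ->
  rho (\sum_(i < n) F i) h = \sum_(i < n) rho (F i) h.
Proof.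
elim: n F => [|n IH] F CF.
  by rewrite !big_ord0 (rep0 hrho) //; exact: (@Cc0 C).
have CS : @Cc C Q (\sum_(i < n) F (lift ord0 i)) by apply: (@Cc_sum C _ Qh) => i; exact: CF.
by rewrite !big_ord_recl (repD hrho) ?IH //; exact: CF.
Qed.

Lemma normR_sum (V : normedModType R[i]) n (F : 'I_n -> V) : normR (\sum_(i < n) F i) <= \sum_(i < n) normR (F i).
Proof.
elim/big_ind2: _ => //; first by rewrite normR0.
by move=> u x v y hu hv; apply: le_trans (normRD _ _) _; exact: lerD.
Qed.

(** Each of the [n] pieces cut out by a partition of unity on [K] falls under [bis_rep_bound] with
    the same [M]. *)
Lemma compact_rep_bound K : compact K -> exists n : nat, forall f (M : R) (h : H),
  @Cc C Q f -> (forall x, ~ K x -> f x = 0) -> 0 <= M -> (forall x, cabs (f x) <= M) ->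
  normR (rho f h) <= n%:R * (M * normR h).
Proof.
move=> cK; have [n [e [ce e01 be eK]]] := partition_of_unity R Qtop Qh Qlc Qrd cK.
exists n => f M h Cf fK M0 fM.
have CF (i : 'I_n) : @Cc C Q (fun x => (e i x)%:C%C * f x).
  apply: (@CcM C) => // x; apply: (@continuous_comp Q R C (e i) (fun y : R => real_complex R y : C)); first exact: ce.
  exact: real_complex_continuous.
have -> : f = \sum_(i < n) (fun x => (e i x)%:C%C * f x).
  apply/funext => x; rewrite fct_sumE -mulr_suml -(raddf_sum (real_complex R)) /=.
  have [Kx|nKx] := pselect (K x); first by rewrite eK // mul1r.
  by rewrite fK // mulr0.
rewrite rep_sum //; apply: le_trans (normR_sum _) _.
rewrite mulr_natl -[X in _ *+ X](card_ord n) -sumr_const; apply: ler_sum => i _.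
have [U [N [bU cN NU eN]]] := be i.
apply: (bis_rep_bound _ bU NU) => //.
- by move=> x /eN ->; rewrite mul0r.
- move=> x; rewrite cabsM cabs_real; apply: le_trans (fM x).
  have /andP[h0 h1] := e01 i x.
  by rewrite ger0_norm // -[leRHS]mul1r ler_wpM2r // cabs_ge0.
Qed.

Variables (D : cstar_algebra R) (kap : (Q -> R[i]) -> D).
Hypothesis hkap : @star_hom R (Cc_groupoid R Gr) D kap.
Hypothesis sup_le : forall f, @Cc C Q f -> forall x, cabs (f x) <= normR (kap f).

Lemma kapM f g : @Cc C Q f -> @Cc C Q g -> kap (conv f g) = ca_mul (kap f) (kap g).
Proof. by case: hkap => _ h _; exact: h. Qed.
Lemma kap_star f : @Cc C Q f -> kap (star f) = ca_star (kap f).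
Proof. by case: hkap => _ _; exact. Qed.

(** * The positive functional obtained by multiplying with [xi * xi^*] *)

Section omega.
Variables (xi : Q -> R[i]) (h : H).
Hypothesis Cxi : @Cc C Q xi.
Let phi := conv xi (star xi).
Let Cphi : @Cc C Q phi. Proof. by apply: conv_Cc => //; exact: star_Cc. Qed.
Definition omega f : R := complex.Re (hdot H h (rho (pmul phi f) h)).

Let Cpf f : @Cc C Q f -> @Cc C Q (pmul phi f).
Proof. by move=> Cf; apply: (@CcM C) => //; case: Cphi. Qed.

Lemma omega_lin (t : R) f g : @Cc C Q f -> @Cc C Q g ->
  omega ((t%:C)%C *: f + g) = t * omega f + omega g.
Proof.
move=> Cf Cg; rewrite /omega.
have -> : pmul phi ((t%:C)%C *: f + g) = (t%:C)%C *: pmul phi f + pmul phi g.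
  by apply/funext => x; rewrite !fct_addE !fct_scaleE; ring.
rewrite (rep_lin hrho) //; [|exact: Cpf|exact: Cpf].
rewrite hdotDr hdotZr conj_real_complex raddfD /=.
by case: (hdot H h _) => u v /=; rewrite mul0r subr0.
Qed.

(** [posdef_mul_square] turns the pointwise product into a sum of [b_i^* b_i], on which the vector
    functional takes the values [|rho b_i h|^2]. *)
Lemma omega_ge0 a : @Cc C Q a -> 0 <= omega (conv (star a) a).
Proof.
move=> Ca; have [n [b [Cb e]]] := posdef_mul_square Cxi Ca.
have Csb i : @Cc C Q (star (b i)) by exact: star_Cc.
have Cbb i : @Cc C Q (conv (star (b i)) (b i)) by exact: conv_Cc.
rewrite /omega /phi e rep_sum // linear_sumr raddf_sum sumr_ge0 // => i _ /=.
by rewrite -(rep_norm hrho) //= sqr_ge0.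
Qed.

(** The hypothesis makes the real form [omega (b^* x)] symmetric at this pair, so positivity at
    [x - t b] for real [t] is enough for Cauchy-Schwarz. *)
Lemma omega_cs x b : @Cc C Q x -> @Cc C Q b -> conv (star x) b = conv (star b) x ->
  omega (conv (star b) x) ^+ 2 <= omega (conv (star x) x) * omega (conv (star b) b).
Proof.
move=> Cx Cb xb; have Csx := star_Cc Qtop Qh Cx; have Csb := star_Cc Qtop Qh Cb.
have Cl u v : @Cc C Q u -> @Cc C Q v -> @Cc C Q (conv u v) by exact: conv_Cc.
apply: discriminant_le; first exact: omega_ge0.
move=> t; pose y := (- t)%:C%C *: b + x.
have Cy : @Cc C Q y by exact: (@Cc_lin C).
have := omega_ge0 Cy.
have sy : star y = (- t)%:C%C *: star b + star x.
  apply/funext => z; rewrite /conv_star /y !fct_addE !fct_scaleE rmorphD rmorphM /=.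
  by rewrite conj_real_complex.
have -> : conv (star y) y = (- t)%:C%C *: ((- t)%:C%C *: conv (star b) b + conv (star b) x) +
    ((- t)%:C%C *: conv (star x) b + conv (star x) x).
  by rewrite sy (conv_linl Qtop Qrd) // /y !(conv_linr Qtop Qrd).
have C1 : @Cc C Q ((- t)%:C%C *: conv (star b) b + conv (star b) x).
  by apply: (@Cc_lin C) => //; exact: Cl.
have C2 : @Cc C Q ((- t)%:C%C *: conv (star x) b + conv (star x) x).
  by apply: (@Cc_lin C) => //; exact: Cl.
rewrite !omega_lin //; try exact: Cl.
rewrite xb => hh.
suff -> : forall c g d : R, c - t * g *+ 2 + t ^+ 2 * d = - t * (- t * d + g) + (- t * g + c) by exact: hh.
by move=> c g d; ring.
Qed.

Lemma omega_le f b : @Cc C Q f -> @Cc C Q b ->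
  omega (conv (star (conv f b)) (conv f b)) <= omega (conv (star b) b) * normR (kap f) ^+ 2.
Proof.
move=> Cf Cb.
have Cl u v : @Cc C Q u -> @Cc C Q v -> @Cc C Q (conv u v) by exact: conv_Cc.
have Cs u : @Cc C Q u -> @Cc C Q (star u) by exact: star_Cc.
pose sq g := conv (star g) g.
pose F n := iter n sq f.
have CF n : @Cc C Q (F n) by elim: n => //= n IH; apply: (Cl) => //; exact: Cs.
have kF n : normR (kap (F n)) = normR (kap f) ^+ (2 ^ n).
  elim: n => [|n IH]; first by rewrite expr1.
  rewrite /= /sq kapM ?kap_star //; last exact: Cs.
  by rewrite ca_norm_star -/(F n) IH -exprM expnS mulnC.
have sbM u v : @Cc C Q u -> star (conv u v) = conv (star v) (star u).
  by move=> Cu; exact: (conv_starM Qtop Qrd).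
have assoc u v w : @Cc C Q u -> @Cc C Q v -> conv u (conv v w) = conv (conv u v) w.
  by move=> Cu Cv; exact: (conv_assoc Qtop Qrd).
(* [omega_cs] at [F n.+1 * b] and [b] gives [a n ^ 2 <= omega (b^* b) * a n.+1], while the
   C*-identity gives [kap (F n)] the norm [|kap f|^(2^n)]. This is the shape that
   [iterated_square_le] asks for. *)
pose a n := omega (sq (conv (F n) b)).
have [Kp [cKp phiK]] := Cc_supp Cphi.
have [n0 hn0] := compact_rep_bound cKp.
have [Mp Mp0 phiM] := Cc_bounded Cphi.
(* The pointwise factor [phi] keeps the support inside [Kp] for every [g], so the constant does not
   depend on [g]; [sup_le] replaces the sup norm of [g^* g] by [|kap g|^2]. *)
have C0 g : @Cc C Q g -> omega (sq g) <= normR h * (n0%:R * (Mp * normR h)) * normR (kap g) ^+ 2.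
  move=> Cg; apply: le_trans (hdot_le _ _) _.
  rewrite -mulrA ler_wpM2l ?normR_ge0 //.
  have Csq : @Cc C Q (sq g) by apply: (Cl) => //; exact: Cs.
  have -> : n0%:R * (Mp * normR h) * normR (kap g) ^+ 2 =
     n0%:R * (Mp * normR (kap g) ^+ 2 * normR h) by ring.
  apply: hn0.
  - exact: Cpf.
  - by move=> x /phiK ->; rewrite mul0r.
  - by rewrite mulr_ge0 // sqr_ge0.
  - move=> x; rewrite cabsM ler_pM ?cabs_ge0 // -ca_norm_star -kap_star // -kapM //; last exact: Cs.
    exact: sup_le.
have := @iterated_square_le R a (omega (sq b)) (normR h * (n0%:R * (Mp * normR h)) * normR (kap b) ^+ 2) (normR (kap f) ^+ 2).
apply.
- exact: omega_ge0.
- exact: sqr_ge0.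
- by move=> n; apply: omega_ge0; exact: Cl.
- move=> n; set g := F n.
  have Cg : @Cc C Q g by exact: CF.
  have Csg := Cs _ Cg; have Csb := Cs _ Cb.
  have Cgg : @Cc C Q (sq g) by exact: Cl.
  have e1 : sq (conv g b) = conv (star b) (conv (sq g) b).
    by rewrite /sq sbM // -(assoc (star b)) // !assoc //; exact: Cl.
  have ssq : star (sq g) = sq g by rewrite /sq sbM // conv_starK.
  have := @omega_cs (conv (sq g) b) b (Cl _ _ Cgg Cb) Cb.
  rewrite mulrC /a -/g e1; apply.
  by rewrite sbM // ssq -assoc.
- move=> n; apply: le_trans (C0 _ (Cl _ _ (CF n) Cb)) _.
  rewrite -[leRHS]mulrA ler_wpM2l //.
    by rewrite !mulr_ge0 ?normR_ge0.
  rewrite -exprM mulnC exprM -kF -exprMn ler_pXn2r ?nnegrE ?mulr_ge0 ?normR_ge0 //.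
  by rewrite mulrC kapM //; exact: ca_norm_mul.
Qed.
End omega.

Theorem amenable_rep_le f (h : H) : amenable R Gr -> @Cc C Q f ->
  normR (rho f h) <= normR (kap f) * normR h.
Proof.
move=> am Cf0.
have Cl u v : @Cc C Q u -> @Cc C Q v -> @Cc C Q (conv u v) by exact: conv_Cc.
have Cs u : @Cc C Q u -> @Cc C Q (star u) by exact: star_Cc.
(* At a vector [rho b h] both squared norms are values [w F1] and [w F2] of one vector functional on
   [C_c], and these are limits of the values of [omega] as [xi * xi^*] tends to 1 on the supports of
   [F1] and [F2]. *)
have key g b : @Cc C Q g -> @Cc C Q b ->
    normR (rho g (rho b h)) <= normR (kap g) * normR (rho b h).
  move=> Cg Cb.
  pose F1 := conv (star (conv g b)) (conv g b); pose F2 := conv (star b) b.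
  have C1 : @Cc C Q F1 by apply: (Cl); [apply: (Cs)|]; exact: Cl.
  have C2 : @Cc C Q F2 by apply: (Cl) => //; exact: Cs.
  have [K1 [cK1 F1K]] := Cc_supp C1; have [K2 [cK2 F2K]] := Cc_supp C2.
  have cK := compactU cK1 cK2.
  have [n hn] := compact_rep_bound cK.
  have [M1 M10 F1M] := Cc_bounded C1; have [M2 M20 F2M] := Cc_bounded C2.
  pose M := M1 + M2.
  have E F : F = F1 \/ F = F2 -> [/\ @Cc C Q F, forall x, ~ (K1 `|` K2) x -> F x = 0 & forall x, cabs (F x) <= M].
    move=> [->|->]; split => // x.
    - by move=> nx; apply: F1K => Kx; apply: nx; left.
    - by apply: le_trans (F1M x) _; rewrite lerDl.
    - by move=> nx; apply: F2K => Kx; apply: nx; right.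
    - by apply: le_trans (F2M x) _; rewrite lerDr.
  pose w F := complex.Re (hdot H h (rho F h)).
  pose B := normR h * (n%:R * (M * normR h)).
  have B0 : 0 <= B by rewrite !mulr_ge0 ?normR_ge0 ?addr_ge0.
  have close xi (e : R) F : 0 <= e -> @Cc C Q xi ->
      (forall x, (K1 `|` K2) x -> cabs (conv xi (star xi) x - 1) <= e) ->
      F = F1 \/ F = F2 -> `|omega xi h F - w F| <= e * B.
    move=> e0 Cxi he /E[CF FK FM].
    have Cphi : @Cc C Q (conv xi (star xi)) by apply: (Cl) => //; exact: Cs.
    have CpF : @Cc C Q (pmul (conv xi (star xi)) F) by apply: (@CcM C) => //; case: Cphi.
    pose F' := (-1 : R[i]) *: F + pmul (conv xi (star xi)) F.
    have F'E x : F' x = (conv xi (star xi) x - 1) * F x.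
      by rewrite /F' fct_addE fct_scaleE; ring.
    have CF' : @Cc C Q F' by exact: (@Cc_lin C).
    have -> : omega xi h F - w F = complex.Re (hdot H h (rho F' h)).
      rewrite /F' (rep_lin hrho) // hdotDr hdotZr rmorphN1 mulN1r raddfD raddfN /=.
      by rewrite addrC.
    have F'b : normR (rho F' h) <= n%:R * (e * M * normR h).
      apply: hn => //.
      - by move=> x nx; rewrite F'E FK ?mulr0.
      - by rewrite mulr_ge0 // addr_ge0.
      - move=> x; rewrite F'E cabsM.
        have [Kx|nx] := pselect ((K1 `|` K2) x); last first.
          by rewrite FK // cabs0 mulr0 mulr_ge0 // addr_ge0.
        by apply: ler_pM; rewrite ?cabs_ge0 //; exact: he.
    have eB : e * B = normR h * (n%:R * (e * M * normR h)) by rewrite /B; ring.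
    rewrite ler_norml eB; apply/andP; split; last first.
      by apply: le_trans (hdot_le _ _) _; rewrite ler_wpM2l ?normR_ge0.
    rewrite lerNl; apply: le_trans (_ : complex.Re (hdot H h (- rho F' h)) <= _).
      by rewrite linearNr raddfN.
    by apply: le_trans (hdot_le _ _) _; rewrite normRN ler_wpM2l ?normR_ge0.
  have wE b' : @Cc C Q b' -> w (conv (star b') b') = normR (rho b' h) ^+ 2.
    move=> Cb'; have := rep_norm hrho h Cb' (Cs _ Cb').
    by move=> /(congr1 (@complex.Re R)) /= ->.
  suff hh : w F1 <= normR (kap g) ^+ 2 * w F2.
    move: hh; rewrite !wE //; last exact: Cl.
    rewrite (repM hrho) // -exprMn.
    by rewrite ler_pXn2r ?nnegrE ?mulr_ge0 ?normR_ge0.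
  set N := normR (kap g) ^+ 2.
  have N0 : 0 <= N by exact: sqr_ge0.
  apply/ler_addgt0Pr => e e0.
  (* The error on [F1] and [N] times the error on [F2] add up to at most [(1 + N) * e' * B]; the
     added 1 keeps the divisor positive. *)
  pose e' := e / ((1 + N) * B + 1).
  have dp : 0 < (1 + N) * B + 1 by rewrite ltr_wpDl // mulr_ge0 // addr_ge0.
  have e'0 : 0 < e' by rewrite divr_gt0.
  have [xi [Cxi hxi]] := posdef_approx am cK e'0.
  have := close _ _ F1 (ltW e'0) Cxi hxi (or_introl erefl).
  have := close _ _ F2 (ltW e'0) Cxi hxi (or_intror erefl).
  have := omega_le h Cxi Cg Cb; rewrite -/F1 -/F2 -/N.
  rewrite !ler_norml => h1 /andP[h2 h2'] /andP[h3 h3'].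
  have h4 : (1 + N) * (e' * B) <= e.
    have -> : e = e' * ((1 + N) * B + 1) by rewrite /e' divfK // gt_eqF.
    by rewrite mulrCA ler_wpM2l ?(ltW e'0) // lerDl.
  have h5 : N * omega xi h F2 <= N * (w F2 + e' * B) by rewrite ler_wpM2l //; lra.
  nra.
(* [rho] may be degenerate, and [key] concerns only vectors [rho b h]. Taking [g = f^*] and [b = f]
   reaches an arbitrary [h] through [|rho f h|^2 = <h, rho f^* (rho f h)>]. *)
have Csf := Cs _ Cf0.
have := key (star f) f Csf Cf0.
rewrite kap_star // ca_norm_adj => kf.
have [/eqP|x0] := eqVneq (normR (rho f h)) 0.
  by move=> /eqP ->; rewrite mulr_ge0 ?normR_ge0.
have xp : 0 < normR (rho f h) by rewrite lt_neqAle eq_sym x0 normR_ge0.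
rewrite -(ler_pM2r xp) -expr2.
have := rep_norm hrho h Cf0 Csf; move=> /(congr1 (@complex.Re R)) /= ->.
rewrite (repM hrho) //=; apply: le_trans (hdot_le _ _) _.
by rewrite [leRHS]mulrAC mulrC ler_wpM2r ?normR_ge0.
Qed.

End amenable_rep.

(** * The Hilbert space l^2(X) and the regular representation of a groupoid *)

Section ell2_def.
Variables (R : realType) (X : choiceType).
Implicit Types (f g h : X -> R[i]) (l : seq X).

Definition sqsum f l : R := \sum_(x <- l) cabs (f x) ^+ 2.

Definition sq_summable f := exists M : R, forall l, uniq l -> sqsum f l <= M.

Lemma sqsum_ge0 f l : 0 <= sqsum f l.
Proof. by apply: sumr_ge0 => x _; exact: sqr_ge0. Qed.

Lemma sum_cs (a b : X -> R) l :
  (\sum_(x <- l) a x * b x) ^+ 2 <= (\sum_(x <- l) a x ^+ 2) * (\sum_(x <- l) b x ^+ 2).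
Proof.
apply: discriminant_le; first by apply: sumr_ge0 => x _; exact: sqr_ge0.
move=> t; rewrite (_ : _ + _ = \sum_(x <- l) (a x - t * b x) ^+ 2).
  by apply: sumr_ge0 => x _; exact: sqr_ge0.
rewrite -mulrnAr -sumrMnl !mulr_sumr -sumrB -big_split /=.
by apply: eq_bigr => x _; ring.
Qed.

Lemma sqsumD f g l (a b : R) : 0 <= a -> 0 <= b -> sqsum f l <= a ^+ 2 -> sqsum g l <= b ^+ 2 ->
  sqsum (f + g) l <= (a + b) ^+ 2.
Proof.
move=> a0 b0 fa gb.
have cs := sum_cs (fun x => cabs (f x)) (fun x => cabs (g x)) l.
set m := \sum_(x <- l) cabs (f x) * cabs (g x) in cs.
have m0 : 0 <= m by apply: sumr_ge0 => x _; rewrite mulr_ge0 ?cabs_ge0.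
have mab : m <= a * b.
  rewrite -(@ler_pXn2r _ 2) ?nnegrE ?mulr_ge0 // exprMn; apply: le_trans cs _.
  by apply: ler_pM => //; exact: sqsum_ge0.
apply: (@le_trans _ _ (sqsum f l + m *+ 2 + sqsum g l)); last by rewrite sqrrD; lra.
rewrite /sqsum /m -sumrMnl -!big_split /=; apply: ler_sum => x _.
rewrite -sqrrD ler_pXn2r ?nnegrE ?addr_ge0 ?cabs_ge0 //; exact: cabsD.
Qed.

Lemma sqsumZ (a : R[i]) f l : sqsum (a *: f) l = cabs a ^+ 2 * sqsum f l.
Proof. by rewrite /sqsum mulr_sumr; apply: eq_bigr => x _; rewrite cabsM exprMn. Qed.

Lemma sq_summable_submod : GRing.submod_closed [pred f | `[< sq_summable f >]].
Proof.
split.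
  apply: asboolT; exists 0 => l _.
  by rewrite /sqsum big1 // => x _; rewrite cabs0 expr0n.
move=> a f g /asboolW[M fM] /asboolW[N gN]; apply: asboolT.
exists ((Num.sqrt (cabs a ^+ 2 * `|M|) + Num.sqrt `|N|) ^+ 2) => l ul.
apply: sqsumD; rewrite ?sqrtr_ge0 // ?sqr_sqrtr ?mulr_ge0 ?sqr_ge0 ?cabs_ge0 //.
  by rewrite sqsumZ ler_wpM2l ?sqr_ge0 //; apply: le_trans (fM l ul) (ler_norm _).
by apply: le_trans (gN l ul) (ler_norm _).
Qed.
HB.instance Definition _ := GRing.isSubmodClosed.Build R[i] (X -> R[i])
  [pred f | `[< sq_summable f >]] sq_summable_submod.

Record ell2 := Ell2 { ell2_val :> X -> R[i]; _ : ell2_val \in [pred f | `[< sq_summable f >]] }.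
HB.instance Definition _ := [isSub for ell2_val].
HB.instance Definition _ := [Choice of ell2 by <:].
HB.instance Definition _ := [SubChoice_isSubLmodule of ell2 by <:].

Lemma ell2P (u : ell2) : sq_summable u.
Proof. by case: u => f /= /asboolW. Qed.
Implicit Types u v w : ell2.

Definition mk_ell2 f (hf : sq_summable f) : ell2 :=
  @Ell2 f (asboolT hf : f \in [pred f | `[< sq_summable f >]]).

Definition sqn (u : ell2) : R := sup [set sqsum u l | l in [set l | uniq l]].

Lemma has_sup_sqsum (u : ell2) : has_sup [set sqsum u l | l in [set l | uniq l]].
Proof.
split; first by exists (sqsum u [::]); exists [::].
by have [M hM] := ell2P u; exists M => _ [l ul <-]; exact: hM.
Qed.

Lemma sqsum_le u l : uniq l -> sqsum u l <= sqn u.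
Proof. by move=> ul; apply: (sup_upper_bound (has_sup_sqsum u)); exists l. Qed.

Lemma sqn_ge0 u : 0 <= sqn u.
Proof. by apply: le_trans (sqsum_le u (isT : uniq [::])); exact: sqsum_ge0. Qed.

Lemma sqn_le u (M : R) : (forall l, uniq l -> sqsum u l <= M) -> sqn u <= M.
Proof.
move=> h; apply: ge_sup; first by have [] := has_sup_sqsum u.
by move=> _ [l ul <-]; exact: h.
Qed.

Lemma sqsum_sub f l1 l2 : uniq l1 -> uniq l2 -> {subset l1 <= l2} -> sqsum f l1 <= sqsum f l2.
Proof.
move=> u1 u2 s12; have p : perm_eq l2 (l1 ++ [seq x <- l2 | x \notin l1]).
  apply: uniq_perm => //.
    rewrite cat_uniq u1 filter_uniq // andbT; apply/hasPn => x.
    by rewrite mem_filter => /andP[].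
  move=> x; rewrite mem_cat mem_filter.
  by case: (boolP (x \in l1)) => [/s12 ->|].
rewrite /sqsum (perm_big _ p) big_cat /= lerDl; apply: sumr_ge0 => x _; exact: sqr_ge0.
Qed.

Lemma sqn_approx u (e : R) : 0 < e -> exists l0, forall l, uniq l -> {subset l0 <= l} ->
  sqn u - e <= sqsum u l <= sqn u.
Proof.
move=> e0; have [_ [l0 ul0 <-] h] := sup_adherent e0 (has_sup_sqsum u).
exists l0 => l ul sl; rewrite sqsum_le // andbT; apply: le_trans (ltW h) _.
exact: sqsum_sub.
Qed.

Definition norm2 (u : ell2) : R := Num.sqrt (sqn u).
Lemma norm2_sq u : norm2 u ^+ 2 = sqn u.
Proof. by rewrite sqr_sqrtr // sqn_ge0. Qed.
Lemma norm2_ge0 u : 0 <= norm2 u. Proof. exact: sqrtr_ge0. Qed.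
Lemma norm2_le u (M : R) : 0 <= M -> (forall l, uniq l -> sqsum u l <= M ^+ 2) -> norm2 u <= M.
Proof.
move=> M0 h; rewrite -(@ler_pXn2r _ 2) ?nnegrE ?norm2_ge0 // norm2_sq; exact: sqn_le.
Qed.

Lemma norm2D u v : (norm2 (u + v))%:C%C <= (norm2 u)%:C%C + (norm2 v)%:C%C :> R[i].
Proof.
rewrite -rmorphD lecR /=; apply: norm2_le; first by rewrite addr_ge0 ?norm2_ge0.
move=> l ul; apply: sqsumD; rewrite ?norm2_ge0 ?norm2_sq //; exact: sqsum_le.
Qed.

Lemma norm2Z (a : R[i]) u : (norm2 (a *: u))%:C%C = `|a| * (norm2 u)%:C%C :> R[i].
Proof.
rewrite cabsE -rmorphM; congr (_%:C)%C; apply/eqP.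
have sq_le b w : norm2 (b *: w) <= cabs b * norm2 w.
  apply: norm2_le; first by rewrite mulr_ge0 ?cabs_ge0 ?norm2_ge0.
  move=> l ul; rewrite (sqsumZ b w) exprMn ler_wpM2l ?sqr_ge0 // norm2_sq; exact: sqsum_le.
rewrite eq_le sq_le /=; have [->|a0] := eqVneq a 0.
  by rewrite cabs0 mul0r norm2_ge0.
rewrite -{1}[u](scalerK a0) -/(cabs _); apply: le_trans (ler_wpM2l (cabs_ge0 a) (sq_le _ _)) _.
by rewrite mulrA -cabsM divff // cabs1 mul1r.
Qed.

Lemma norm2_eq0 u : (norm2 u)%:C%C = 0 :> R[i] -> u = 0.
Proof.
move=> [] h; apply: val_inj; apply/funext => x /=.
apply: cabs0_eq0; apply/eqP; rewrite -sqrf_eq0; apply/eqP; apply: le_anti; rewrite sqr_ge0 andbT.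
have := sqsum_le u (isT : uniq [:: x]); rewrite /sqsum big_seq1 -norm2_sq.
by rewrite h expr0n.
Qed.

HB.instance Definition _ := Lmodule_isNormed.Build R[i] ell2 norm2D norm2Z norm2_eq0.

Lemma ell2_normE (u : ell2) : `|u| = (norm2 u)%:C%C.
Proof. by []. Qed.
Lemma ell2_normR (u : ell2) : normR u = norm2 u.
Proof. by []. Qed.

Definition dot_sum f g l : R[i] := \sum_(x <- l) f x * (g x)^*.

(** Polarization reduces the complex series to four suprema of nonnegative sums; the algebraic laws
    are then read off finite partial sums by [dot_approx]. *)
Definition ell2_dot u v : R[i] :=
  (((sqn (u + v))%:C%C - (sqn (u - v))%:C%C) +
   'i * ((sqn (u + 'i *: v))%:C%C - (sqn (u - 'i *: v))%:C%C)) / 4%:R.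

Lemma dot_sum_polar f g l : dot_sum f g l =
  (((sqsum (f + g) l)%:C%C - (sqsum (f - g) l)%:C%C) +
   'i * ((sqsum (f + 'i *: g) l)%:C%C - (sqsum (f - 'i *: g) l)%:C%C)) / 4%:R.
Proof.
have sqE h : (sqsum h l)%:C%C = \sum_(x <- l) (h x)^* * h x.
  by rewrite /sqsum (rmorph_sum (real_complex R)); apply: eq_bigr => x _; rewrite conjM.
rewrite /dot_sum !sqE -!sumrB mulr_sumr -big_split mulr_suml /=.
apply: eq_bigr => x _.
have -> : (f + g) x = f x + g x by [].
have -> : (f - g) x = f x - g x by [].
have -> : (f + 'i *: g) x = f x + 'i * g x by [].
have -> : (f - 'i *: g) x = f x - 'i * g x by [].
rewrite !(rmorphD, rmorphN, rmorphM) /= conjCi.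
have i2 : 'i * 'i = -1 :> R[i] by rewrite -expr2 sqrCi.
set a := f x; set b := g x; set a' := a^*; set b' := b^*.
have n4 : 4%:R != 0 :> R[i] by rewrite pnatr_eq0.
apply: (mulIf n4); rewrite divfK //.
have -> : 'i * ((a' + - 'i * b') * (a + 'i * b) + - ((a' - (- 'i * b')) * (a - 'i * b))) =
  ('i * 'i) * 2%:R * (a' * b - b' * a) by ring.
by rewrite i2; ring.
Qed.

(** Truth along the directed set of finite subsets of [X], given as lists without repetition. *)
Definition eventually_on (P : seq X -> Prop) :=
  exists l0, forall l, uniq l -> {subset l0 <= l} -> P l.

Lemma ev_and P1 P2 : eventually_on P1 -> eventually_on P2 ->
  eventually_on (fun l => P1 l /\ P2 l).
Proof.
move=> [l1 h1] [l2 h2]; exists (l1 ++ l2) => l ul sl; split; [apply: h1|apply: h2] => // x xl;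
  by apply: sl; rewrite mem_cat xl ?orbT.
Qed.

Lemma ev_imp (P1 P2 : seq X -> Prop) : (forall l, uniq l -> P1 l -> P2 l) ->
  eventually_on P1 -> eventually_on P2.
Proof. by move=> h [l1 h1]; exists l1 => l ul sl; apply: h => //; exact: h1. Qed.

Lemma ev_ex P : eventually_on P -> exists2 l, uniq l & P l.
Proof.
move=> [l h]; exists (undup l); first exact: undup_uniq.
by apply: h => [|x]; rewrite ?undup_uniq // mem_undup.
Qed.

Lemma cabs_i : cabs ('i : R[i]) = 1.
Proof. by rewrite /cabs normCi. Qed.

Lemma dot_approx u v (e : R) : 0 < e ->
  eventually_on (fun l => cabs (ell2_dot u v - dot_sum u v l) <= e).
Proof.
move=> e0.
have sqa w : eventually_on (fun l => cabs ((sqn w)%:C%C - (sqsum w l)%:C%C) <= e).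
  have [l0 h] := sqn_approx w e0; exists l0 => l ul sl.
  have /andP[h1 h2] := h l ul sl.
  by rewrite -rmorphB cabs_real ger0_norm ?subr_ge0 // lerBlDl -lerBlDr.
have := ev_and (ev_and (sqa (u + v)) (sqa (u - v))) (ev_and (sqa (u + 'i *: v)) (sqa (u - 'i *: v))).
apply: ev_imp => l _ [[h1 h2] [h3 h4]].
rewrite dot_sum_polar /ell2_dot -mulrBl.
rewrite cabsM; have -> : cabs (4%:R^-1 : R[i]) = 4^-1.
  by rewrite (_ : 4%:R^-1 = (4^-1)%:C%C) ?cabs_real ?ger0_norm // fmorphV rmorph_nat.
rewrite ler_pdivrMr //.
set p1 := (sqn (u + v))%:C%C in h1 *; set p2 := (sqn (u - v))%:C%C in h2 *.
set p3 := (sqn (u + 'i *: v))%:C%C in h3 *; set p4 := (sqn (u - 'i *: v))%:C%C in h4 *.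
set q1 := (sqsum (u + v) l)%:C%C in h1 *; set q2 := (sqsum (u - v) l)%:C%C in h2 *.
set q3 := (sqsum (u + 'i *: v) l)%:C%C in h3 *; set q4 := (sqsum (u - 'i *: v) l)%:C%C in h4 *.
have -> : (p1 - p2 + 'i * (p3 - p4) - (q1 - q2 + 'i * (q3 - q4))) =
  (p1 - q1) + (- (p2 - q2) + 'i * ((p3 - q3) - (p4 - q4))) by ring.
apply: le_trans (cabsD _ _) _; apply: le_trans (lerD h1 (cabsD _ _)) _.
rewrite cabsN cabsM cabs_i mul1r.
have := cabsD (p3 - q3) (- (p4 - q4)); rewrite cabsN; lra.
Qed.

Lemma eq_eps (z w : R[i]) (M : R) : (forall e : R, 0 < e -> cabs (z - w) <= M * e) -> z = w.
Proof.
move=> h; apply/eqP; rewrite -subr_eq0; apply/eqP; apply: cabs0_eq0.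
apply: le_anti; rewrite cabs_ge0 andbT.
have M0 : 0 <= `|M| by [].
apply/ler_addgt0Pr => e e0; rewrite add0r.
have d0 : 0 < `|M| + 1 by rewrite ltr_wpDl.
apply: le_trans (h (e / (`|M| + 1)) _) _; first by rewrite divr_gt0.
rewrite mulrA ler_pdivrMr // mulrC ler_wpM2l ?(ltW e0) //.
by apply: le_trans (ler_norm _) _; rewrite lerDl.
Qed.

Let lin_bound (A p q e : R) : 0 <= A -> p <= e -> q <= e -> e + (A * p + q) <= (2 + A) * e.
Proof. by move=> A0 pe qe; have := ler_wpM2l A0 pe; lra. Qed.

Lemma ell2_dotPl (a : R[i]) u v w : ell2_dot (a *: u + v) w = a * ell2_dot u w + ell2_dot v w.
Proof.
apply: (@eq_eps _ _ (2 + cabs a)) => e e0.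
have [l ul [h1 [h2 h3]]] := ev_ex (ev_and (dot_approx (a *: u + v) w e0)
  (ev_and (dot_approx u w e0) (dot_approx v w e0))).
have E : dot_sum (a *: u + v) w l = a * dot_sum u w l + dot_sum v w l.
  rewrite /dot_sum mulr_sumr -big_split /=; apply: eq_bigr => x _.
  by transitivity ((a * u x + v x) * (w x)^*); [by []|ring].
rewrite (_ : _ - _ = (ell2_dot (a *: u + v) w - dot_sum (a *: u + v) w l) +
  (- (a * (ell2_dot u w - dot_sum u w l)) + - (ell2_dot v w - dot_sum v w l))); last first.
  rewrite E; move: (ell2_dot (a *: u + v) w) (ell2_dot u w) (ell2_dot v w) => p q r.
  by move: (dot_sum u w l) (dot_sum v w l) => p' q'; ring.
apply: le_trans (cabsD _ _) _; apply: le_trans (lerD h1 (cabsD _ _)) _.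
rewrite !cabsN cabsM.
exact: lin_bound (cabs_ge0 a) h2 h3.
Qed.

Lemma ell2_dotC u v : ell2_dot u v = (ell2_dot v u)^*.
Proof.
apply: (@eq_eps _ _ 2) => e e0.
have [l ul [h1 h2]] := ev_ex (ev_and (dot_approx u v e0) (dot_approx v u e0)).
have E : dot_sum u v l = (dot_sum v u l)^*.
  rewrite /dot_sum rmorph_sum /=; apply: eq_bigr => x _.
  by rewrite rmorphM /= conjCK mulrC.
rewrite (_ : _ - _ = (ell2_dot u v - dot_sum u v l) - (ell2_dot v u - dot_sum v u l)^*); last first.
  by rewrite rmorphB /= E; ring.
apply: le_trans (cabsD _ _) _; rewrite cabsN cabsJ; lra.
Qed.

Lemma ell2_dot_norm u : ell2_dot u u = (norm2 u ^+ 2)%:C%C.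
Proof.
apply: (@eq_eps _ _ 2) => e e0.
have [l0 h0] := sqn_approx u e0.
have sqa : eventually_on (fun l => cabs ((sqn u)%:C%C - (sqsum u l)%:C%C) <= e).
  exists l0 => l ul sl; have /andP[h1 h2] := h0 l ul sl.
  by rewrite -rmorphB cabs_real ger0_norm ?subr_ge0 // lerBlDl -lerBlDr.
have [l ul [h1 h2]] := ev_ex (ev_and (dot_approx u u e0) sqa).
have E : dot_sum u u l = (sqsum u l)%:C%C.
  rewrite /dot_sum /sqsum (rmorph_sum (real_complex R)); apply: eq_bigr => x _.
  by rewrite mulrC conjM.
rewrite norm2_sq (_ : _ - _ = (ell2_dot u u - dot_sum u u l) - ((sqn u)%:C%C - (sqsum u l)%:C%C)); last first.
  by rewrite E; ring.
apply: le_trans (cabsD _ _) _; rewrite cabsN; lra.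
Qed.

Lemma ell2_dotPr (a : R[i]) u v w : ell2_dot w (a *: u + v) = a^* * ell2_dot w u + ell2_dot w v.
Proof.
rewrite ell2_dotC ell2_dotPl rmorphD rmorphM /= [in RHS](ell2_dotC w u).
by rewrite [in RHS](ell2_dotC w v).
Qed.

Lemma ell2_bilinear : bilinear_for (GRing.Scale.Law.clone _ _ ( *%R ) _)
   (GRing.Scale.Law.clone _ _ (Num.conj \; *%R ) _) ell2_dot.
Proof.
split=> w a u v /=; first exact: ell2_dotPl.
exact: ell2_dotPr.
Qed.
HB.instance Definition _ := bilinear_isBilinear.Build R[i] ell2 ell2 R[i]
  (GRing.Scale.Law.clone _ _ ( *%R ) _) (GRing.Scale.Law.clone _ _ (Num.conj \; *%R ) _) ell2_dot ell2_bilinear.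

Lemma ell2_hermitian u v : ell2_dot u v = (-1) ^+ false * (ell2_dot v u)^*.
Proof. by rewrite expr0 mul1r -ell2_dotC. Qed.
HB.instance Definition _ := isHermitianSesquilinear.Build R[i] ell2 false Num.conj ell2_dot ell2_hermitian.

Lemma ell2_dot_gt0 u : u != 0 -> 0 < ell2_dot u u.
Proof.
move=> u0; rewrite ell2_dot_norm (@ltcR _ 0) exprn_gt0 // lt_neqAle norm2_ge0 andbT eq_sym.
by apply: contra u0 => /eqP h; apply/eqP; apply: norm2_eq0; rewrite h.
Qed.
HB.instance Definition _ := isDotProduct.Build R[i] ell2 ell2_dot ell2_dot_gt0.

(** Evaluations are contractive, so coordinatewise limits exist. The Cauchy estimate restricted to a
    finite list survives the limit, and this gives both the square summability of the limit and the
    convergence in norm. *)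
Lemma ell2_complete (F : set_system ell2) : ProperFilter F -> cauchy F -> cvg F.
Proof.
move=> FF cF.
have cau (e : R) : 0 < e -> exists w : ell2, F [set u | norm2 (w - u) < e].
  move=> e0; have /cauchyP h := cF.
  have [|w Fw] := h (e%:C)%C; first by rewrite ltcR.
  exists w; apply: filterS Fw => u; rewrite -ball_normE /= ell2_normE.
  by rewrite ltcR.
have ev_le (w : ell2) x : cabs (w x) <= norm2 w.
  rewrite -(@ler_pXn2r _ 2) ?nnegrE ?cabs_ge0 ?norm2_ge0 // norm2_sq.
  by have := sqsum_le w (isT : uniq [:: x]); rewrite /sqsum big_seq1.
have re_sub (z z' : R[i]) : complex.Re (z - z') = complex.Re z - complex.Re z' by case: z z' => ? ? [].
have im_sub (z z' : R[i]) : complex.Im (z - z') = complex.Im z - complex.Im z' by case: z z' => ? ? [].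
have cabs2 (z : R[i]) : cabs z ^+ 2 = complex.Re z ^+ 2 + complex.Im z ^+ 2.
  by rewrite /cabs normc_def /= sqr_sqrtr // addr_ge0 // sqr_ge0.
have cre x : cvg ((fun u : ell2 => complex.Re (u x)) @ F).
  apply: cauchy_cvg; apply/cauchyP => e e0; have [w Fw] := cau e e0.
  exists (complex.Re (w x)).
  suff: F [set u : ell2 | ball (complex.Re (w x)) e (complex.Re (u x))] by [].
  apply: filterS Fw => u /= wu.
  rewrite -ball_normE /=; apply: le_lt_trans wu; apply: le_trans (ev_le _ x).
  rewrite -re_sub -lecR -cabsE; exact: normc_ge_Re.
have cim x : cvg ((fun u : ell2 => complex.Im (u x)) @ F).
  apply: cauchy_cvg; apply/cauchyP => e e0; have [w Fw] := cau e e0.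
  exists (complex.Im (w x)).
  suff: F [set u : ell2 | ball (complex.Im (w x)) e (complex.Im (u x))] by [].
  apply: filterS Fw => u /= wu.
  rewrite -ball_normE /=; apply: le_lt_trans wu; apply: le_trans (ev_le _ x).
  rewrite -im_sub -sqrtr_sqr -(@ler_pXn2r _ 2) ?nnegrE ?sqrtr_ge0 ?cabs_ge0 //.
  by rewrite cabs2 sqr_sqrtr ?sqr_ge0 // lerDr sqr_ge0.
pose h x : R[i] := Complex (lim ((fun u : ell2 => complex.Re (u x)) @ F)) (lim ((fun u : ell2 => complex.Im (u x)) @ F)).
have cv (w : ell2) l : (fun u : ell2 => sqsum (fun x => w x - u x) l) @ F --> sqsum (fun x => w x - h x) l.
  rewrite /sqsum; elim: l => [|x l IH].
    by under eq_fun do rewrite big_nil; rewrite big_nil; exact: cvg_cst.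
  under eq_fun do rewrite big_cons; rewrite big_cons; apply: (@cvgD R R) => //.
  under eq_fun do rewrite cabs2; rewrite cabs2.
  under eq_fun do rewrite re_sub im_sub; rewrite re_sub im_sub.
  apply: (@cvgD R R); rewrite expr2; under eq_fun do rewrite expr2.
    apply: (@cvgM R); apply: (@cvgB R R); try exact: cvg_cst; exact: cre.
  apply: (@cvgM R); apply: (@cvgB R R); try exact: cvg_cst; exact: cim.
have claim (w : ell2) (e : R) : F [set u | norm2 (w - u) < e] ->
    forall l, uniq l -> sqsum (fun x => w x - h x) l <= e ^+ 2.
  move=> Fw l ul.
  apply: (@closed_cvg _ _ F _ (fun u : ell2 => sqsum (fun x => w x - u x) l)
    (fun y => y <= e ^+ 2) (@closed_le _ _) _ _ (cv w l)).
  apply: filterS Fw => u /= wu; apply: le_trans (sqsum_le (w - u) ul) _.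
  have e0 : 0 <= e by apply: le_trans (norm2_ge0 _) (ltW wu).
  by rewrite -norm2_sq ler_pXn2r ?nnegrE ?norm2_ge0 // ltW.
(* [claim] controls only differences with [h], so the limit is recovered as [w0] minus the square
   summable [w0 - h]. *)
have [w0 Fw0] := cau 1 ltr01.
have sh : sq_summable (fun x => w0 x - h x) by exists (1 ^+ 2); exact: claim.
pose H : ell2 := w0 - mk_ell2 sh.
have HE x : H x = h x by transitivity (w0 x - (w0 x - h x)); [by []|rewrite subKr].
apply/cvg_ex; exists H; apply/cvgrPdist_lt => e e0.
have er : e = (complex.Re e)%:C%C by rewrite RRe_real // gtr0_real.
have e0' : 0 < complex.Re e by move: e0; rewrite er ltcR.
set d := complex.Re e in er e0'.
have d2 : 0 < d / 2 by rewrite divr_gt0.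
have d4 : 0 < d / 4 by rewrite divr_gt0.
have [w Fw] := cau (d / 4) d4.
have wH : norm2 (w - H) <= d / 4.
  apply: norm2_le; first exact: ltW.
  move=> l ul; rewrite (_ : sqsum _ _ = sqsum (fun x => w x - h x) l); first exact: claim.
  by apply: eq_bigr => x _; rewrite -HE.
apply: filterS Fw => u /= wu.
rewrite er ell2_normE ltcR.
have -> : H - u = - (w - H) + (w - u) by rewrite opprB addrA subrK.
have := norm2D (- (w - H)) (w - u); rewrite -rmorphD lecR /=.
have -> : norm2 (- (w - H)) = norm2 (w - H).
  by apply/complexI; rewrite -!ell2_normE normrN.
lra.
Qed.

HB.instance Definition _ := Uniform_isComplete.Build ell2 ell2_complete.

Lemma ell2_dot_normE u : `|u| ^+ 2 = ell2_dot u u.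
Proof. by rewrite ell2_dot_norm rmorphXn. Qed.

Definition ell2_hilbert : hilbert R := @Hilbert R ell2 ell2_dot ell2_dot_normE.
End ell2_def.

Section hilbert_extra.
Variables (R : realType) (H : hilbert R).

(** [hdot_le] bounds a real part; scaling [x] by the conjugate of [z] turns the inner product into
    the nonnegative real [|z|^2]. *)
Lemma hdot_cabs (x y : H) : cabs (hdot H x y) <= normR x * normR y.
Proof.
set z := hdot H x y; have [/eqP z0|z0] := eqVneq (cabs z) 0.
  by rewrite (eqP z0) mulr_ge0 ?normR_ge0.
have zp : 0 < cabs z by rewrite lt_neqAle eq_sym z0 cabs_ge0.
have := hdot_le (z^* *: x) y; rewrite hdotZl -/z conjM /= normRZ cabsJ -mulrA.
by rewrite expr2 ler_pM2l.
Qed.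

Lemma hilbert_bounded_continuous (T : H -> H) (M : R) : linear T ->
  (forall x, normR (T x) <= M * normR x) -> continuous T.
Proof.
move=> lT bT x; apply/cvgrPdist_lt => e e0.
have er : e = (complex.Re e)%:C%C by rewrite RRe_real // gtr0_real.
have e0' : 0 < complex.Re e by move: e0; rewrite er ltcR.
have d0 : 0 < `|M| + 1 by rewrite ltr_wpDl.
have dd : 0 < (complex.Re e / (`|M| + 1))%:C%C :> R[i] by rewrite ltcR divr_gt0.
near=> y.
have -> : T x - T y = T (x - y).
  have := lT (-1) y x; rewrite !scaleN1r [- y + x]addrC => ->.
  by rewrite addrC.
rewrite normRE er ltcR; apply: le_lt_trans (bT _) _.
have : normR (x - y) < complex.Re e / (`|M| + 1).
  rewrite -ltcR -normRE; near: y; exact: cvgr_dist_lt.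
rewrite ltr_pdivlMr // => h; apply: le_lt_trans h.
rewrite mulrC ler_wpM2l ?normR_ge0 //.
by apply: le_trans (ler_norm _) _; rewrite lerDl.
Unshelve. all: by end_near. Qed.
End hilbert_extra.

Section deltas.
Variables (R : realType) (X : choiceType).
Local Notation L2 := (ell2 R X).
Implicit Types u v w : L2.

Lemma delta_summable (z : X) : @sq_summable R X (fun x => (x == z)%:R).
Proof.
exists 1 => l ul; rewrite /sqsum.
have -> : \sum_(x <- l) cabs ((x == z)%:R : R[i]) ^+ 2 = \sum_(x <- l | x == z) 1.
  rewrite [RHS]big_mkcond; apply: eq_bigr => x _; case: eqP => _.
    by rewrite cabs1 expr1n.
  by rewrite cabs0 expr0n.
have [zl|zl] := boolP (z \in l).
  by rewrite (big_rem z) //= eqxx big_seq_cond big1 ?addr0 // => x /andP[xl /eqP xz]; move: xl; rewrite xz mem_rem_uniq // inE eqxx.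
by rewrite big_seq_cond big1 // => x /andP[xl /eqP xz]; move: xl; rewrite xz (negbTE zl).
Qed.
Definition ell2_delta z : L2 := mk_ell2 (delta_summable z).
Lemma deltaE z x : ell2_delta z x = (x == z)%:R. Proof. by []. Qed.

Lemma dot_delta u z : ell2_dot u (ell2_delta z) = u z.
Proof.
apply: (@eq_eps _ _ _ 1) => e e0; rewrite mul1r.
have h : eventually_on (fun l => z \in l) by exists [:: z] => l _; apply; rewrite inE.
have [l ul [h1 zl]] := ev_ex (ev_and (dot_approx u (ell2_delta z) e0) h).
suff <- : dot_sum u (ell2_delta z) l = u z by [].
rewrite /dot_sum (big_rem z zl) /= eqxx conjC1 mulr1 big_seq big1 ?addr0 // => x.
by rewrite mem_rem_uniq // inE => /andP[/negbTE xz _]; rewrite ?deltaE xz conjC0 mulr0.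
Qed.

Lemma norm_delta z : norm2 (ell2_delta z) = 1.
Proof.
apply: (@pexpIrn _ 2) => //; rewrite ?nnegrE ?norm2_ge0 // expr1n.
by apply/complexI; rewrite -ell2_dot_norm dot_delta deltaE eqxx.
Qed.

Lemma ell2_ev_le w x : cabs (w x) <= norm2 w.
Proof.
rewrite -(@ler_pXn2r _ 2) ?nnegrE ?cabs_ge0 ?norm2_ge0 // norm2_sq.
by have := sqsum_le w (isT : uniq [:: x]); rewrite /sqsum big_seq1.
Qed.

Lemma delta_dense u (e : R) : 0 < e -> exists l, norm2 (u - \sum_(z <- l) u z *: ell2_delta z) <= e.
Proof.
move=> e0; have e2 : 0 < e ^+ 2 by exact: exprn_gt0.
have [l0 h0] := sqn_approx u e2.
set l := undup l0; exists l.
have ul : uniq l := undup_uniq l0.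
have /andP[h1 _] : sqn u - e ^+ 2 <= sqsum u l <= sqn u by apply: h0 => // x; rewrite mem_undup.
have sE x : (\sum_(z <- l) u z *: ell2_delta z : L2) x = if x \in l then u x else 0.
  have -> : (\sum_(z <- l) u z *: ell2_delta z : L2) x = \sum_(z <- l) u z * ell2_delta z x.
    by elim: (l) => [|z l' IH]; [rewrite !big_nil|rewrite !big_cons -IH].
  case: ifP => xl; last first.
    rewrite big_seq big1 // => z zl; rewrite deltaE; case: eqP => [xz|_]; last by rewrite mulr0.
    by move: zl; rewrite -xz xl.
  rewrite (big_rem x xl) /= eqxx mulr1 big_seq big1 ?addr0 // => z.
  rewrite mem_rem_uniq // inE => /andP[/negbTE xz _]; rewrite ?deltaE eq_sym xz mulr0 //.
apply: norm2_le; first exact: ltW.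
move=> l' ul'.
have -> : sqsum (u - \sum_(z <- l) u z *: ell2_delta z) l' = sqsum u [seq x <- l' | x \notin l].
  rewrite /sqsum big_filter [RHS]big_mkcond; apply: eq_bigr => x _.
  have -> : (u - \sum_(z <- l) u z *: ell2_delta z) x = u x - (if x \in l then u x else 0) by rewrite -sE.
  by case: (x \in l); rewrite /= ?subrr ?cabs0 ?expr0n // subr0.
have uc : uniq (l ++ [seq x <- l' | x \notin l]).
  rewrite cat_uniq ul filter_uniq // andbT; apply/hasPn => x.
  by rewrite mem_filter => /andP[].
have := sqsum_le u uc; rewrite /sqsum big_cat /=; rewrite /sqsum in h1.
move: h1; lra.
Qed.

Lemma ell2_functional_ext (phi : L2 -> R[i]) (M : R) :
  (forall a u v, phi (a *: u + v) = a * phi u + phi v) ->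
  (forall u, cabs (phi u) <= M * norm2 u) -> (forall z, phi (ell2_delta z) = 0) ->
  forall u, phi u = 0.
Proof.
move=> phiP phiM phi0 u.
have phi00 : phi 0 = 0.
  have := phiP 1 0 0; rewrite scale1r addr0 mul1r => /(congr1 (fun z => z - phi 0)).
  by rewrite subrr addrK.
have phis l : phi (\sum_(z <- l) u z *: ell2_delta z) = 0.
  by elim: l => [|z l IH]; rewrite ?big_nil // big_cons phiP phi0 IH mulr0 addr0.
apply: (@eq_eps _ _ _ `|M|) => e e0; rewrite subr0.
have [l hl] := delta_dense u e0.
have -> : phi u = phi (u - \sum_(z <- l) u z *: ell2_delta z).
  have := phiP (-1) (\sum_(z <- l) u z *: ell2_delta z) u.
  by rewrite scaleN1r addrC phis mulr0 add0r => ->.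
apply: le_trans (phiM _) _; apply: (@le_trans _ _ (`|M| * norm2 (u - \sum_(z <- l) u z *: ell2_delta z))).
  by rewrite ler_wpM2r ?norm2_ge0 // ler_norm.
by rewrite ler_wpM2l.
Qed.

Let lin2 (a x y z w : R[i]) : a * x + y - (a * z + w) = a * (x - z) + (y - w).
Proof. ring. Qed.

(** Adjointness is checked on matrix coefficients: [ell2_functional_ext] extends the identity in the
    left variable and then, after conjugation, in the right one. *)
Lemma ell2_adjoint_ext (S T : L2 -> L2) (M : R) : linear S -> linear T ->
  (forall u, norm2 (S u) <= M * norm2 u) -> (forall u, norm2 (T u) <= M * norm2 u) ->
  (forall z x, S (ell2_delta z) x = (T (ell2_delta x) z)^*) ->
  forall u v, ell2_dot (S u) v = ell2_dot u (T v).
Proof.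
move=> lS lT bS bT ST u v.
pose H := ell2_hilbert R X.
have cs (x y : H) : cabs (ell2_dot x y) <= norm2 x * norm2 y by exact: (@hdot_cabs R H).
have step1 x w : ell2_dot (S w) (ell2_delta x) = ell2_dot w (T (ell2_delta x)).
  apply/eqP; rewrite -subr_eq0; apply/eqP.
  apply: (@ell2_functional_ext (fun w => ell2_dot (S w) (ell2_delta x) - ell2_dot w (T (ell2_delta x))) (M + M)).
  - by move=> a p q; rewrite lS !ell2_dotPl; exact: lin2.
  - move=> p; apply: le_trans (cabsD _ _) _; rewrite cabsN mulrDl.
    apply: lerD; apply: le_trans (cs _ _) _.
      by rewrite norm_delta mulr1.
    rewrite mulrC ler_wpM2r ?norm2_ge0 //.
    by have := bT (ell2_delta x); rewrite norm_delta mulr1.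
  - by move=> z; rewrite dot_delta ell2_dotC dot_delta ST subrr.
apply/eqP; rewrite -subr_eq0; apply/eqP.
have K := @ell2_functional_ext (fun v => ell2_dot v (S u) - ell2_dot (T v) u) ((M + M) * norm2 u).
rewrite (ell2_dotC (S u)) (ell2_dotC u) -rmorphB /= K ?conjC0 //.
- by move=> a p q; rewrite lT !ell2_dotPl; exact: lin2.
- move=> p; apply: le_trans (cabsD _ _) _; rewrite cabsN -mulrA mulrDl.
  apply: lerD; apply: le_trans (cs _ _) _.
    by rewrite mulrC mulrA; apply: le_trans (ler_wpM2r (norm2_ge0 p) (bS u)) _.
  by rewrite [leRHS]mulrCA [leRHS]mulrC ler_wpM2r ?norm2_ge0 // bT.
- by move=> x; rewrite ell2_dotC step1 -(ell2_dotC _ u) subrr.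
Qed.
End deltas.

(** * The regular representation of a groupoid on [l^2(Q)] *)

Section regular.
Variables (R : realType) (Q : topologicalType) (Gr : groupoid Q).
Local Notation C := (R[i] : numFieldType).
Hypothesis Qtop : topological_groupoid Gr.
Hypothesis Qh : hausdorff_space Q.
Hypothesis Qlc : locally_compact [set: Q].
Hypothesis Qrd : r_discrete Gr.
Local Notation r := (grng Gr).
Local Notation s := (gsrc Gr).
Local Notation inv := (ginv Gr).
Local Notation mul := (gmul Gr).
Local Notation conv := (groupoid_conv Gr).
Local Notation star := (conv_star Gr).
Local Notation L2 := (ell2 R Q).
Implicit Types (f g : Q -> R[i]).

Lemma fiber_sum_le f u (l : seq Q) : @Cc C Q f -> uniq l -> (forall y, y \in l -> r y = u) ->
  \sum_(y <- l) cabs (f y) <= \sum_(y \in rfiber Gr u) cabs (f y).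
Proof.
move=> Cf ul lu; have [K [cK fK]] := Cc_supp Cf.
have fF : finite_set ((rfiber Gr u `&` K) `|` [set` l]).
  by rewrite finite_setU; split; [exact: compact_fiber_finite|exact: finite_seq].
rewrite [leLHS]fsbig_seq // [leRHS](fsum_fin (S := (rfiber Gr u `&` K) `|` [set` l])); last first.
  by move=> y yu ny; rewrite fK ?cabs0 // => Ky; apply: ny; left.
rewrite (_ : rfiber Gr u `&` (rfiber Gr u `&` K `|` [set` l]) = (rfiber Gr u `&` K) `|` [set` l]); last first.
  by apply/seteqP; split => [y []//|y h]; split => //; case: h => [[]|/lu].
rewrite (fsbigID [set` l] _ _ fF) /=.
rewrite (_ : (_ `|` _) `&` _ = [set` l]); last first.
  by apply/seteqP; split => [y []//|y h]; split => //; right.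
by rewrite lerDl; apply: fsumr_ge0 => y _; exact: cabs_ge0.
Qed.

Lemma gmul_srcK z x : s z = s x -> mul (inv (mul x (inv z))) x = z.
Proof.
move=> zx; rewrite ginv_mul ?grngV // ginvK -(@gmulA _ Gr z (inv x) x) ?grngV ?gsrcV //.
by rewrite gmulVl -zx gmul1r.
Qed.

(** The substitution [z = y^-1 x] exhibits convolution by [f] as the matrix with entries
    [f (x z^-1)], block diagonal over the fibres of the source map. *)
Lemma conv_srcE f (h : Q -> R[i]) x :
  conv f h x = \sum_(z \in [set z | s z = s x]) f (mul x (inv z)) * h z.
Proof.
rewrite /groupoid_conv.
rewrite (@reindex_fsum _ _ _ (fun z => mul x (inv z)) (fun y => mul (inv y) x) [set z | s z = s x]).
- apply: eq_fsbigr => z; rewrite inE /= => zx.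
  by rewrite gmul_srcK.
- by move=> z /= zx; rewrite /rfiber /= grngM ?grngV.
- by move=> y /= yx; rewrite gsrcM ?gsrcV.
- move=> z /= zx; by rewrite gmul_srcK.
- move=> y /= yx; by rewrite ginv_mulV // gmulKV.
Qed.

(** The Schur test: [M1] and [M2] bound the row and column sums of the matrix [f (x z^-1)], which
    are fibre sums of [|f|] and [|star f|]. In [step], Cauchy-Schwarz is applied to [|f|] split into
    two square roots. *)
Lemma conv_ell2_bound f : @Cc C Q f -> exists2 M : R, 0 <= M & forall (h : L2) l, uniq l ->
  sqsum (conv f h) l <= M ^+ 2 * sqn h.
Proof.
move=> Cf; have [M1 M10 h1] := Cc_fiber_bound Qtop Qh Qlc Qrd Cf.
have Csf := star_Cc Qtop Qh Cf.
have [M2 M20 h2] := Cc_fiber_bound Qtop Qh Qlc Qrd Csf.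
have [K [cK fK]] := Cc_supp Cf.
exists (Num.sqrt (M1 * M2)); first exact: sqrtr_ge0.
move=> h l ul; rewrite sqr_sqrtr ?mulr_ge0 //.
have step x : cabs (conv f h x) ^+ 2 <=
    M1 * \sum_(y \in rfiber Gr (r x)) cabs (f y) * cabs (h (mul (inv y) x)) ^+ 2.
  have fS : finite_set (rfiber Gr (r x) `&` K) by exact: compact_fiber_finite.
  have f0 y : rfiber Gr (r x) y -> ~ (rfiber Gr (r x) `&` K) y -> f y = 0.
    by move=> yx ny; apply: fK => Ky; apply: ny.
  have [m [um mP mE]] := finite_enum (finite_setIr (rfiber Gr (r x)) fS).
  rewrite /groupoid_conv.
  rewrite (fsum_fin (S := rfiber Gr (r x) `&` K)); last by move=> y yx ny; rewrite f0 // mul0r.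
  rewrite [in leRHS](fsum_fin (S := rfiber Gr (r x) `&` K)); last by move=> y yx ny; rewrite f0 // cabs0 mul0r.
  rewrite !mE; set b := \sum_(y <- m) cabs (f y) * _.
  have b0 : 0 <= b by apply: sumr_ge0 => y _; rewrite mulr_ge0 ?cabs_ge0 ?sqr_ge0.
  have M1m : \sum_(y <- m) cabs (f y) <= M1.
    apply: le_trans (h1 (r x)); rewrite (fsum_fin (S := rfiber Gr (r x) `&` K)) ?mE //.
    by move=> y yx ny; rewrite f0 // cabs0.
  apply: le_trans (ler_wpM2r b0 M1m).
  have cs := sum_cs (fun y => Num.sqrt (cabs (f y))) (fun y => Num.sqrt (cabs (f y)) * cabs (h (mul (inv y) x))) m.
  have sq y : Num.sqrt (cabs (f y)) ^+ 2 = cabs (f y) by rewrite sqr_sqrtr ?cabs_ge0.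
  have e1 : \sum_(y <- m) Num.sqrt (cabs (f y)) ^+ 2 = \sum_(y <- m) cabs (f y) by apply: eq_bigr.
  have e2 : \sum_(y <- m) (Num.sqrt (cabs (f y)) * cabs (h (mul (inv y) x))) ^+ 2 = b.
    by apply: eq_bigr => y _; rewrite exprMn sq.
  rewrite e1 e2 in cs; apply: le_trans cs.
  rewrite ler_pXn2r ?nnegrE ?cabs_ge0 //; last first.
    by apply: sumr_ge0 => y _; rewrite !mulr_ge0 ?sqrtr_ge0 ?cabs_ge0.
  apply: le_trans (cabs_sum _ _ _) _; apply: ler_sum => y _.
  by rewrite cabsM mulrA -expr2 sq.
apply: (@le_trans _ _ (\sum_(x <- l) M1 * \sum_(y \in rfiber Gr (r x)) cabs (f y) * cabs (h (mul (inv y) x)) ^+ 2)).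
  by apply: ler_sum => x _; exact: step.
rewrite -mulr_sumr -mulrA ler_wpM2l //.
pose A x z := cabs (f (mul x (inv z))) * cabs (h z) ^+ 2.
pose T := \bigcup_(x in [set` l]) ((fun y => mul (inv y) x) @` (rfiber Gr (r x) `&` K)).
have fT : finite_set T.
  apply: bigcup_finite; first exact: finite_seq.
  by move=> x _; apply: finite_image; exact: compact_fiber_finite.
have [m [um mP mE]] := finite_enum fT.
have e x : x \in l -> \sum_(y \in rfiber Gr (r x)) cabs (f y) * cabs (h (mul (inv y) x)) ^+ 2 =
   \sum_(z <- m | s z == s x) A x z.
  move=> xl.
  transitivity (\sum_(z \in [set z | s z = s x]) A x z).
    rewrite (@reindex_fsum _ _ _ (fun z => mul x (inv z)) (fun y => mul (inv y) x) [set z | s z = s x]).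
    - apply: eq_fsbigr => z; rewrite inE /= => zx.
      by rewrite gmul_srcK.
    - by move=> z /= zx; rewrite /rfiber /= grngM ?grngV.
    - by move=> y /= yx; rewrite gsrcM ?gsrcV.
    - move=> z /= zx; by rewrite gmul_srcK.
    - move=> y /= yx; by rewrite ginv_mulV // gmulKV.
  rewrite [RHS]big_mkcond -mE [LHS](fsum_fin (S := T)) /=; last first.
    move=> z /= zx nT; rewrite /A fK ?cabs0 ?mul0r // => Kz; apply: nT; exists x => //.
    exists (mul x (inv z)); first by split => //; rewrite /rfiber /= grngM ?grngV.
    by rewrite gmul_srcK.
  rewrite setIC fsbig_mkcondr; apply: eq_fsbigr => z _.
  have [zx|zx] := eqVneq (s z) (s x); first by rewrite ifT // inE.
  by rewrite ifF //; apply/negbTE; rewrite notin_setE => /eqP; rewrite (negbTE zx).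
rewrite (eq_big_seq _ e) (exchange_big_dep xpredT) //=.
pose B z := cabs (h z) ^+ 2 * M2.
have inner z : \sum_(x <- l | s z == s x) A x z <= B z.
  rewrite /A -mulr_suml /B mulrC ler_wpM2l ?sqr_ge0 //.
  rewrite -big_filter; set l' := [seq x <- l | _].
  have -> : \sum_(x <- l') cabs (f (mul x (inv z))) = \sum_(y <- [seq mul z (inv x) | x <- l']) cabs (star f y).
    rewrite big_map big_seq [RHS]big_seq; apply: eq_bigr => x.
    rewrite mem_filter => /andP[/eqP zx _].
    by rewrite /conv_star cabsJ ginv_mul ?grngV // ginvK.
  apply: le_trans (h2 (r z)); apply: fiber_sum_le => //.
  - rewrite map_inj_in_uniq; first exact: filter_uniq.
    move=> x x'; rewrite !mem_filter => /andP[/eqP zx _] /andP[/eqP zx' _] e'.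
    rewrite -[x](ginvK Gr) -[x'](ginvK Gr); congr inv.
    by rewrite -[inv x](@gmulK _ Gr z) ?grngV // e' gmulK ?grngV.
  - move=> y /mapP[x]; rewrite mem_filter => /andP[/eqP zx _] ->.
    by rewrite grngM ?grngV.
apply: (@le_trans _ _ (\sum_(z <- m) B z)); first by apply: ler_sum => z _; exact: inner.
by rewrite /B -mulr_suml mulrC ler_wpM2l //; exact: sqsum_le.
Qed.

Lemma conv_ell2 f (h : L2) : @Cc C Q f -> sq_summable (conv f h).
Proof.
by move=> Cf; have [M M0 hM] := conv_ell2_bound Cf; exists (M ^+ 2 * sqn h) => l; exact: hM.
Qed.

(** A value in [ell2] carries a proof of square summability, which is at hand for [f] in [C_c];
    elsewhere 0 is a dummy value. *)
Definition reg f : L2 -> L2 :=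
  match pselect (@Cc C Q f) with
  | left Cf => fun h => mk_ell2 (conv_ell2 h Cf)
  | right _ => fun=> 0
  end.

Lemma regE f (h : L2) x : @Cc C Q f -> reg f h x = conv f h x.
Proof. by rewrite /reg => Cf; case: pselect. Qed.

Lemma reg_bound f : @Cc C Q f -> exists2 M : R, 0 <= M & forall h, norm2 (reg f h) <= M * norm2 h.
Proof.
move=> Cf; have [M M0 hM] := conv_ell2_bound Cf; exists M => // h.
apply: norm2_le; first by rewrite mulr_ge0 ?norm2_ge0.
move=> l ul; rewrite exprMn norm2_sq; apply: le_trans (hM h l ul).
by rewrite le_eqVlt; apply/orP; left; apply/eqP; apply: eq_bigr => x _; rewrite regE.
Qed.

Lemma reg_linear f : @Cc C Q f -> linear (reg f).
Proof.
move=> Cf a u v; apply: val_inj; apply/funext => x /=.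
transitivity (conv f (a *: (u : Q -> R[i]) + (v : Q -> R[i])) x); first by rewrite regE.
rewrite (conv_linr Qtop Qrd) //.
by transitivity (a * reg f u x + reg f v x); [rewrite !regE|].
Qed.

Lemma reg_rep : @star_rep R (Cc_groupoid R Gr) (ell2_hilbert R Q) reg.
Proof.
split.
- move=> f Cf; split; first exact: reg_linear.
  have [M M0 hM] := reg_bound Cf.
  have hM' (h : ell2_hilbert R Q) : normR (reg f h) <= M * normR h by exact: hM.
  have lin : linear (reg f : ell2_hilbert R Q -> ell2_hilbert R Q) by exact: reg_linear.
  exact: hilbert_bounded_continuous lin hM'.
- move=> a f g Cf Cg u; apply: val_inj; apply/funext => x.
  have Cfg : @Cc C Q (a *: f + g) by exact: (@Cc_lin C).
  transitivity (conv (a *: f + g) u x); first by rewrite -regE.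
  rewrite (conv_linl Qtop Qrd) //.
  by transitivity (a * reg f u x + reg g u x); [rewrite !regE|].
- move=> f g Cf Cg u; apply: val_inj; apply/funext => x.
  have Cfg : @Cc C Q (conv f g) by exact: conv_Cc.
  transitivity (conv (conv f g) u x); first by rewrite -regE.
  rewrite -(conv_assoc Qtop Qrd) //.
  transitivity (conv f (reg g u) x); last by rewrite -regE.
  by congr (conv f _ x); apply/funext => y; rewrite regE.
- move=> f Cf; have Csf := star_Cc Qtop Qh Cf.
  have [M M0 hM] := reg_bound Cf; have [N N0 hN] := reg_bound Csf.
  apply: (@ell2_adjoint_ext R Q (reg f) (reg (star f)) (M + N)).
  + exact: reg_linear.
  + exact: reg_linear.
  + by move=> u; apply: le_trans (hM u) _; rewrite ler_wpM2r ?norm2_ge0 // lerDl.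
  + by move=> u; apply: le_trans (hN u) _; rewrite ler_wpM2r ?norm2_ge0 // lerDr.
  have regd g z x : @Cc C Q g -> reg g (ell2_delta R z) x = if s z == s x then g (mul x (inv z)) else 0.
    move=> Cg; rewrite regE // conv_srcE.
    have [zx|zx] := eqVneq (s z) (s x).
      rewrite (fsum_fin (S := [set z])); last first.
        by move=> y /= yx yz; rewrite (_ : (y == z) = false) ?mulr0 //; apply/eqP.
      rewrite (_ : _ `&` [set z] = [set z]) ?fsbig_set1 /= ?eqxx ?mulr1 //.
      by apply/seteqP; split => [y []//|y ->].
    apply: fsbig1 => y /= yx; rewrite (_ : (y == z) = false) ?mulr0 //.
    by apply/eqP => yz; move: zx; rewrite -yz yx eqxx.
  move=> z x; rewrite !regd // eq_sym; case: eqP => xz; last by rewrite conjC0.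
  by rewrite /conv_star conjCK ginv_mul ?grngV // ginvK.
Qed.

(** The column of the matrix [f (x z^-1)] at [z = s x] is [f] itself on that source fibre, so each
    value of [f] is a coordinate of the image of a unit vector. *)
Lemma reg_delta f x : @Cc C Q f -> reg f (ell2_delta R (s x)) x = f x.
Proof.
move=> Cf; rewrite regE // conv_srcE.
rewrite (fsum_fin (S := [set s x])); last first.
  by move=> y /= yx yz; rewrite (_ : (y == s x) = false) ?mulr0 //; apply/eqP.
have iss : inv (s x) = s x by rewrite (unit_inv (Gr := Gr)) // grng_src.
rewrite (_ : _ `&` [set s x] = [set s x]) ?fsbig_set1 /= ?eqxx ?mulr1 ?iss ?gmul1r //.
by apply/seteqP; split => [y []//|y ->] /=; rewrite gsrc_src.
Qed.

Lemma reg_sup f x : @Cc C Q f -> cabs (f x) <= norm2 (reg f (ell2_delta R (s x))).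
Proof. by move=> Cf; rewrite -{1}(reg_delta x Cf) ell2_ev_le. Qed.
End regular.

(** * Representations of C*-algebras *)

Lemma dense_normR (R : realType) (V : normedModType R[i]) (S : set V) (b : V) (e : R) :
  dense S -> 0 < e -> exists2 x, S x & normR (b - x) < e.
Proof.
move=> dS e0.
have e0' : 0 < (e%:C)%C :> R[i] by rewrite ltcR.
have [] := dS (ball b (e%:C)%C).
- by exists b; exact: ballxx.
- exact: ball_open.
- move=> x []; rewrite -ball_normE /= => bx Sx; exists x => //.
  by rewrite -ltcR -normRE.
Qed.

(** Restricting to [e <= 1] allows [e * e] to be absorbed into [e] in [ext_mul]. *)
Lemma normR_eps (R : realType) (V : normedModType R[i]) (y y' : V) (M : R) :
  (forall e : R, 0 < e -> e <= 1 -> normR (y - y') <= M * e) -> y = y'.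
Proof.
move=> h; apply/eqP; rewrite -subr_eq0; apply/eqP; apply: normR0_eq0.
apply: le_anti; rewrite normR_ge0 andbT.
have M1 : 0 < `|M| + 1 by rewrite ltr_wpDl.
apply/ler_addgt0Pr => e e0; rewrite add0r.
pose d := Num.min 1 (e / (`|M| + 1)).
have d0 : 0 < d by rewrite lt_min ltr01 divr_gt0.
apply: le_trans (h d d0 _) _; first by rewrite ge_min lexx.
apply: (@le_trans _ _ ((`|M| + 1) * d)).
  by rewrite ler_wpM2r ?(ltW d0) //; apply: le_trans (ler_norm _) _; rewrite lerDl.
by rewrite mulrC -ler_pdivlMr // ge_min lexx orbT.
Qed.

Lemma linear_fun_sub (K : pzRingType) (V W : lmodType K) (f : V -> W) x y :
  linear f -> f (x - y) = f x - f y.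
Proof.
move=> lf; have := lf (-1) y x.
by rewrite !scaleN1r [- y + x]addrC [- f y + f x]addrC.
Qed.

Lemma sub_add_split (V : zmodType) (p q r q' r' : V) :
  p - (q + r) = (p - (q' + r')) - (q - q') - (r - r').
Proof.
rewrite !opprB !opprD !addrA [RHS](ACl (1*5*7*(2*4)*(3*6)))/=.
by rewrite !addNr !addr0.
Qed.

Section complete_lim.
Variables (R : realType) (V : completeNormedModType R[i]).

(** [S e] stands for the approximants of precision [e]. Keeping the rate [M * e] in the conclusion
    turns later limit arguments into norm estimates; it serves both [extension_lim] and the fixed
    point in [sqrt_one_minus]. *)
Lemma complete_lim (S : R -> set V) (M : R) :
  (forall e e', e <= e' -> S e `<=` S e') -> (forall e, 0 < e -> S e !=set0) ->
  (forall e u v, 0 < e -> S e u -> S e v -> normR (u - v) <= M * e) ->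
  exists y, forall e u, 0 < e -> S e u -> normR (y - u) <= M * e.
Proof.
move=> Smon S0 SM.
pose F := filter_from [set e : R | 0 < e] S.
have FF : ProperFilter F.
  apply: filter_from_proper; last by move=> e /= /S0.
  apply: filter_from_filter; first by exists 1 => /=.
  move=> e e' /= e0 e0'; exists (Num.min e e'); first by rewrite lt_min e0.
  by move=> x Sx; split; apply: Smon Sx; rewrite ge_min lexx ?orbT.
have cF : cvg F.
  apply: cauchy_cvg; apply/cauchyP => e e0.
  have er : e = (complex.Re e)%:C%C by rewrite RRe_real // gtr0_real.
  have e0' : 0 < complex.Re e by move: e0; rewrite er ltcR.
  have M1 : 0 < `|M| + 1 by rewrite ltr_wpDl.
  pose d := complex.Re e / (`|M| + 1).
  have d0 : 0 < d by rewrite divr_gt0.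
  have [u Su] := S0 d d0; exists u, d => // v Sv.
  rewrite -ball_normE /= normRE er ltcR; apply: le_lt_trans (SM _ _ _ d0 Su Sv) _.
  rewrite /d mulrA ltr_pdivrMr // mulrC ltr_pM2l //.
  by apply: le_lt_trans (ler_norm _) _; rewrite ltrDl.
move: cF => /cvg_ex[y Fy].
exists y => e u e0 Su; apply/ler_addgt0Pr => n n0.
have n0' : 0 < (n%:C)%C :> R[i] by rewrite ltcR.
have [d /= d0 Sd] : F (ball y (n%:C)%C) by apply: Fy; exact: nbhsx_ballx.
have m0 : 0 < Num.min d e by rewrite lt_min d0.
have [v Sv] := S0 _ m0.
have Sdv : S d v by apply: Smon Sv; rewrite ge_min lexx.
have Sev : S e v by apply: Smon Sv; rewrite ge_min lexx orbT.
have := Sd v Sdv; rewrite -ball_normE /= normRE ltcR => yv.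
have -> : y - u = (y - v) + (v - u) by rewrite addrA subrK.
apply: le_trans (normRD _ _) _; rewrite addrC; apply: lerD; last exact: ltW.
exact: SM.
Qed.
End complete_lim.

(** * Extension of a representation from a dense *-subalgebra *)

Section extend_rep.
Variables (R : realType) (A0 : star_algebra R) (B : cstar_algebra R) (k : A0 -> B).
Hypothesis hk : star_hom k.
Hypothesis dk : dense (k @` @sa_dom R A0).
Hypothesis d0 : @sa_dom R A0 0.
Hypothesis dlin : forall (a : R[i]) f g, @sa_dom R A0 f -> @sa_dom R A0 g -> @sa_dom R A0 (a *: f + g).
Hypothesis dmul : forall f g, @sa_dom R A0 f -> @sa_dom R A0 g -> @sa_dom R A0 (sa_mul f g).
Hypothesis dstar : forall f, @sa_dom R A0 f -> @sa_dom R A0 (sa_star f).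
Variables (H : hilbert R) (rho : A0 -> H -> H).
Hypothesis hrho : star_rep rho.
Hypothesis rle : forall f x, sa_dom f -> normR (rho f x) <= normR (k f) * normR x.

Lemma khom_lin a f g : sa_dom f -> sa_dom g -> k (a *: f + g) = a *: k f + k g.
Proof. by case: hk => h _ _; exact: h. Qed.
Lemma khom_mul f g : sa_dom f -> sa_dom g -> k (sa_mul f g) = ca_mul (k f) (k g).
Proof. by case: hk => _ h _; exact: h. Qed.
Lemma khom_star f : sa_dom f -> k (sa_star f) = ca_star (k f).
Proof. by case: hk => _ _ h; exact: h. Qed.
Lemma khom_sub f g : sa_dom f -> sa_dom g -> k ((-1) *: g + f) = k f - k g.
Proof. by move=> df dg; rewrite khom_lin // scaleN1r addrC. Qed.

Lemma rep_sub_le f g x : sa_dom f -> sa_dom g ->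
  normR (rho f x - rho g x) <= normR (k f - k g) * normR x.
Proof.
move=> df dg; rewrite -khom_sub //.
have -> : rho f x - rho g x = rho ((-1) *: g + f) x by rewrite (rep_lin hrho) // scaleN1r addrC.
by apply: rle; exact: dlin.
Qed.

(** Two approximants within [e] of [b] are within [2 * e] of each other, whence the factor 2. *)
Lemma extension_lim b x : exists y, forall f e, 0 < e -> sa_dom f -> normR (b - k f) <= e ->
  normR (y - rho f x) <= (2 * normR x) * e.
Proof.
pose S (e : R) := [set rho f x | f in [set f | sa_dom f /\ normR (b - k f) <= e]].
have Smon e e' : e <= e' -> S e `<=` S e'.
  by move=> ee' _ [f [df bf] <-]; exists f => //; split => //; exact: le_trans ee'.
have S0 e : 0 < e -> S e !=set0.
  move=> e0; have [_ [f df <-] bf] := dense_normR b dk e0.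
  by exists (rho f x), f => //; split => //; exact: ltW.
have SM e u v : 0 < e -> S e u -> S e v -> normR (u - v) <= 2 * normR x * e.
  move=> e0 [f [df bf] <-] [g [dg bg] <-].
  apply: le_trans (rep_sub_le x df dg) _.
  rewrite [leRHS]mulrAC ler_wpM2r ?normR_ge0 //.
  have -> : k f - k g = (b - k g) - (b - k f) by rewrite opprB [RHS]addrC addrA subrK.
  by apply: le_trans (normRD _ _) _; rewrite normRN; lra.
have [y hy] := complete_lim Smon S0 SM.
by exists y => f e e0 df bf; apply: hy => //; exists f.
Qed.

Definition ext b x : H := sval (cid (extension_lim b x)).

Lemma extP b x f e : 0 < e -> sa_dom f -> normR (b - k f) <= e ->
  normR (ext b x - rho f x) <= (2 * normR x) * e.
Proof. exact: (svalP (cid (extension_lim b x))). Qed.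

Lemma approx b (e : R) : 0 < e -> exists2 f, sa_dom f & normR (b - k f) <= e.
Proof. by move=> e0; have [_ [f df <-] /ltW bf] := dense_normR b dk e0; exists f. Qed.

Lemma ext_k f x : sa_dom f -> ext (k f) x = rho f x.
Proof.
move=> df; apply: (@normR_eps _ _ _ _ (2 * normR x)) => e e0 _.
by apply: extP => //; rewrite subrr normR0 ltW.
Qed.

Lemma ext_le b x : normR (ext b x) <= normR b * normR x.
Proof.
apply/ler_addgt0Pr => e e0.
pose d := e / (3 * normR x + 1).
have p0 : 0 < 3 * normR x + 1 by rewrite ltr_wpDl // mulr_ge0 ?normR_ge0.
have dd : 0 < d by rewrite divr_gt0.
have [f df bf] := approx b dd.
have h1 := extP x dd df bf.
have h2 := rle x df.
have h3 : normR (k f) <= normR b + d.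
  have -> : k f = b - (b - k f) by rewrite opprB addrC subrK.
  by apply: le_trans (normRD _ _) _; rewrite normRN lerD2l.
have -> : ext b x = (ext b x - rho f x) + rho f x by rewrite subrK.
apply: le_trans (normRD _ _) _.
have h4 : normR (k f) * normR x <= (normR b + d) * normR x by rewrite ler_wpM2r ?normR_ge0.
have h5 : d * (3 * normR x + 1) = e by rewrite /d divfK // gt_eqF.
lra.
Qed.

Lemma ext_linr b a x y : ext b (a *: x + y) = a *: ext b x + ext b y.
Proof.
apply: (@normR_eps _ _ _ _ (2 * normR (a *: x + y) + cabs a * (2 * normR x) + 2 * normR y)) => e e0 _.
have [f df bf] := approx b e0.
have -> : ext b (a *: x + y) - (a *: ext b x + ext b y) =
  (ext b (a *: x + y) - rho f (a *: x + y)) - a *: (ext b x - rho f x) - (ext b y - rho f y).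
  by rewrite (rep_linear hrho df) scalerBr; exact: sub_add_split.
have h1 := extP (a *: x + y) e0 df bf.
have h2 := extP x e0 df bf; have h3 := extP y e0 df bf.
apply: le_trans (normRD _ _) _; apply: le_trans (lerD (normRD _ _) (lexx _)) _.
rewrite !normRN normRZ.
have := ler_wpM2l (cabs_ge0 a) h2; lra.
Qed.

Lemma ext_lin a b c x : ext (a *: b + c) x = a *: ext b x + ext c x.
Proof.
apply: (@normR_eps _ _ _ _ (2 * normR x * (cabs a + 1) + cabs a * (2 * normR x) + 2 * normR x)) => e e0 _.
have [f df bf] := approx b e0; have [g dg bg] := approx c e0.
have -> : ext (a *: b + c) x - (a *: ext b x + ext c x) =
  (ext (a *: b + c) x - rho (a *: f + g) x) - a *: (ext b x - rho f x) - (ext c x - rho g x).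
  by rewrite (rep_lin hrho) // scalerBr; exact: sub_add_split.
have ca0 := cabs_ge0 a.
have e1 : 0 < (cabs a + 1) * e by rewrite mulr_gt0 // ltr_wpDl.
have bfg : normR (a *: b + c - k (a *: f + g)) <= (cabs a + 1) * e.
  rewrite khom_lin //.
  have -> : a *: b + c - (a *: k f + k g) = a *: (b - k f) + (c - k g).
    by rewrite scalerBr opprD addrACA.
  apply: le_trans (normRD _ _) _; rewrite normRZ.
  by have := ler_wpM2l ca0 bf; lra.
have h1 := extP x e1 (dlin a df dg) bfg.
have h2 := extP x e0 df bf; have h3 := extP x e0 dg bg.
apply: le_trans (normRD _ _) _; apply: le_trans (lerD (normRD _ _) (lexx _)) _.
rewrite !normRN normRZ.
have := ler_wpM2l ca0 h2; lra.
Qed.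

Lemma ext_sub b x y : ext b x - ext b y = ext b (x - y).
Proof. by rewrite (@linear_fun_sub _ _ _ (ext b)) // => a u v; exact: ext_linr. Qed.

Lemma ext_subl b c x : ext b x - ext c x = ext (b - c) x.
Proof. by rewrite (@linear_fun_sub _ _ _ (ext ^~ x)) // => a u v; exact: ext_lin. Qed.

Lemma ext_mul b c x : ext (ca_mul b c) x = ext b (ext c x).
Proof.
pose N := normR b + normR c + 1.
apply: (@normR_eps _ _ _ _ (4 * N * normR x)) => e e0 e1.
have [f df bf] := approx b e0; have [g dg bg] := approx c e0.
have nx := normR_ge0 x; have nb := normR_ge0 b; have nc := normR_ge0 c.
have kf : normR (k f) <= normR b + e.
  have -> : k f = b - (b - k f) by rewrite opprB addrC subrK.
  by apply: le_trans (normRD _ _) _; rewrite normRN lerD2l.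
have kg : normR (k g) <= normR c + e.
  have -> : k g = c - (c - k g) by rewrite opprB addrC subrK.
  by apply: le_trans (normRD _ _) _; rewrite normRN lerD2l.
have subMl (u v w : B) : ca_mul (u - v) w = ca_mul u w - ca_mul v w.
  by apply: (@linear_fun_sub _ _ _ (ca_mul (c := B) ^~ w)); exact: ca_mul_linearl.
have subMr (u v w : B) : ca_mul w (u - v) = ca_mul w u - ca_mul w v.
  by apply: (@linear_fun_sub _ _ _ (ca_mul (c := B) w)); exact: ca_mul_linearr.
have e2 : normR (ca_mul b c - ca_mul (k f) (k g)) <= 2 * N * e.
  have -> : ca_mul b c - ca_mul (k f) (k g) = ca_mul (b - k f) c + ca_mul (k f) (c - k g).
    by rewrite subMl subMr addrA subrK.
  apply: le_trans (normRD _ _) _.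
  have h1 := ca_norm_mul (b - k f) c; have h2 := ca_norm_mul (k f) (c - k g).
  have h3 : normR (b - k f) * normR c <= e * normR c by rewrite ler_wpM2r.
  have h4 : normR (k f) * normR (c - k g) <= (normR b + e) * e by apply: ler_pM; rewrite ?normR_ge0.
  have h5 : e * e <= e by rewrite -[leRHS]mulr1 ler_wpM2l // ltW.
  have h6 : 0 <= normR b * e by rewrite mulr_ge0 // ltW.
  have h7 : 0 <= normR c * e by rewrite mulr_ge0 // ltW.
  rewrite /N; lra.
have e3 : normR (ext (ca_mul b c) x - ext (ca_mul (k f) (k g)) x) <= 2 * N * e * normR x.
  by rewrite ext_subl; apply: le_trans (ext_le _ _) _; rewrite ler_wpM2r.
have e4 : ext (ca_mul (k f) (k g)) x = ext (k f) (ext (k g) x).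
  by rewrite -khom_mul // !ext_k ?(repM hrho) //; exact: dmul.
have -> : ext (ca_mul b c) x - ext b (ext c x) = (ext (ca_mul b c) x - ext (ca_mul (k f) (k g)) x)
   - (ext b (ext c x - ext (k g) x) + ext (b - k f) (ext (k g) x)).
  by rewrite e4 -ext_sub -ext_subl addrA subrK opprB addrA subrK.
apply: le_trans (normRD _ _) _; rewrite normRN.
apply: le_trans (lerD e3 (normRD _ _)) _.
have h1 : normR (ext b (ext c x - ext (k g) x)) <= normR b * (e * normR x).
  apply: le_trans (ext_le _ _) _; rewrite ler_wpM2l // ext_subl.
  by apply: le_trans (ext_le _ _) _; rewrite ler_wpM2r.
have h2 : normR (ext (b - k f) (ext (k g) x)) <= e * ((normR c + e) * normR x).
  apply: le_trans (ext_le _ _) _; apply: ler_pM; rewrite ?normR_ge0 //.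
  by apply: le_trans (ext_le _ _) _; rewrite ler_wpM2r.
have h5 : e * (e * normR x) <= e * normR x.
  by rewrite ler_wpM2l ?(ltW e0) // -[leRHS]mul1r ler_wpM2r.
have h6 : 0 <= normR b * e * normR x by rewrite !mulr_ge0 // ltW.
have h7 : 0 <= normR c * e * normR x by rewrite !mulr_ge0 // ltW.
have h8 : 0 <= e * normR x by rewrite mulr_ge0 // ltW.
rewrite /N; lra.
Qed.

Lemma ext_adj b x y : hdot H (ext b x) y = hdot H x (ext (ca_star b) y).
Proof.
have eqc (z w : R[i]) (M : R) : (forall e : R, 0 < e -> cabs (z - w) <= M * e) -> z = w.
  exact: eq_eps.
apply: (@eqc _ _ (2 * normR x * normR y + 2 * normR x * normR y)) => e e0.
have [f df bf] := approx b e0.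
have bf' : normR (ca_star b - k (sa_star f)) <= e.
  rewrite khom_star //; have -> : ca_star b - ca_star (k f) = ca_star (b - k f).
    rewrite ca_starD; congr (_ + _); rewrite -scaleN1r -[in RHS]scaleN1r ca_starZ.
    by rewrite rmorphN1.
  by rewrite ca_norm_adj.
have h1 := extP x e0 df bf; have h2 := extP y e0 (dstar df) bf'.
have -> : hdot H (ext b x) y - hdot H x (ext (ca_star b) y) =
   hdot H (ext b x - rho f x) y - hdot H x (ext (ca_star b) y - rho (sa_star f) y).
  by rewrite hdotBl hdotBr (rep_adj hrho x y df) opprB addrA subrK.
apply: le_trans (cabsD _ _) _; rewrite cabsN mulrDl; apply: lerD; apply: le_trans (hdot_cabs _ _) _.
  by rewrite mulrAC ler_wpM2r ?normR_ge0.
have := ler_wpM2l (normR_ge0 x) h2; lra.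
Qed.

Lemma extension_rep : exists sigma : B -> H -> H,
  @star_rep R (cstar_star B) H sigma /\ forall f x, sa_dom f -> sigma (k f) x = rho f x.
Proof.
exists ext; split; last exact: ext_k.
split.
- move=> b _; split; first by move=> a x y; exact: ext_linr.
  apply: (@hilbert_bounded_continuous _ _ _ (normR b)); last exact: ext_le.
  by move=> a x y; exact: ext_linr.
- by move=> a b c _ _ x; exact: ext_lin.
- by move=> b c _ _ x; exact: ext_mul.
- by move=> b _ x y; exact: ext_adj.
Qed.
End extend_rep.

(** * Contractivity of representations of a C*-algebra *)

Section contractive.
Variables (R : realType) (A : cstar_algebra R).
Local Notation "x ** y" := (@ca_mul R A x y) (at level 40, left associativity).
Local Notation st := (@ca_star R A).

Lemma ca_mulBl (u v w : A) : (u - v) ** w = u ** w - v ** w.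
Proof. by apply: (@linear_fun_sub _ _ _ (fun x => x ** w)); exact: ca_mul_linearl. Qed.
Lemma ca_mulBr (u v w : A) : w ** (u - v) = w ** u - w ** v.
Proof. by apply: (@linear_fun_sub _ _ _ (fun x => w ** x)); exact: ca_mul_linearr. Qed.
Lemma ca_starB (u v : A) : st (u - v) = st u - st v.
Proof.
by rewrite ca_starD -scaleN1r -[in RHS]scaleN1r ca_starZ rmorphN1.
Qed.

Section sqrt_one_minus.
Variable p : A.
Hypothesis p1 : normR p < 1.
Hypothesis psa : st p = p.
Let q := normR p.
(** Its fixed points are the solutions of [y ** y + p = 2 *: y]; on the ball of radius [q < 1] it is
    a contraction of ratio [q]. *)
Let F (k : A) := 2^-1 *: (k ** k + p).

Let half_abs : cabs (2^-1 : R[i]) = 2^-1.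
Proof. by rewrite (_ : 2^-1 = (2^-1)%:C%C) ?cabs_real ?ger0_norm // fmorphV rmorph_nat. Qed.

Let F_ball k : normR k <= q -> normR (F k) <= q.
Proof.
move=> kq; rewrite /F normRZ half_abs.
have q0 : 0 <= q := normR_ge0 p.
have h1 := normRD (k ** k) p; have h2 := ca_norm_mul k k.
have h3 : normR k * normR k <= q by rewrite -[leRHS]mulr1 ler_pM ?normR_ge0 // (le_trans kq) // ltW.
move: h1; rewrite -/q; lra.
Qed.

Let F_lip k l : normR k <= q -> normR l <= q -> normR (F k - F l) <= q * normR (k - l).
Proof.
move=> kq lq; rewrite /F -scalerBr normRZ half_abs.
have -> : k ** k + p - (l ** l + p) = k ** (k - l) + (k - l) ** l.
  by rewrite opprD addrACA subrr addr0 ca_mulBr ca_mulBl addrA subrK.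
have h0 := normRD (k ** (k - l)) ((k - l) ** l).
have h1 := ca_norm_mul k (k - l); have h2 := ca_norm_mul (k - l) l.
have h3 : normR k * normR (k - l) <= q * normR (k - l) by rewrite ler_wpM2r ?normR_ge0.
have h4 : normR (k - l) * normR l <= q * normR (k - l) by rewrite mulrC ler_wpM2r ?normR_ge0.
lra.
Qed.

Let iter_ball n k : normR k <= q -> normR (iter n F k) <= q.
Proof. by move=> kq; elim: n => //= n IH; exact: F_ball. Qed.

Let iter_lip n k l : normR k <= q -> normR l <= q ->
  normR (iter n F k - iter n F l) <= q ^+ n * normR (k - l).
Proof.
move=> kq lq; elim: n => [|n IH]; first by rewrite expr0 mul1r.
rewrite /= exprS -mulrA; apply: le_trans (F_lip (iter_ball n kq) (iter_ball n lq)) _.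
by rewrite ler_wpM2l // normR_ge0.
Qed.

(** [1 - y] is a square root of [1 - p]; [A] need not have a unit. *)
Lemma sqrt_one_minus : exists2 y : A, st y = y & y ** y + p = 2 *: y.
Proof.
have q0 : 0 <= q := normR_ge0 p.
pose u n := iter n F 0.
have z0 : normR (0 : A) <= q by rewrite normR0.
have uq n : normR (u n) <= q by exact: iter_ball.
pose S (e : R) := [set u n | n in [set n | q ^+ n <= e]].
have Smon e e' : e <= e' -> S e `<=` S e'.
  by move=> ee' _ [n ne <-]; exists n => //=; exact: le_trans ee'.
have S0 e : 0 < e -> S e !=set0.
  move=> e0; have [n ne] : exists n, q ^+ n <= e.
    have [q00|qn0] := eqVneq q 0; first by exists 1%N; rewrite q00 expr1 ltW.
    have qp : 0 < q by rewrite lt_neqAle eq_sym qn0.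
    have q1 : 1 < q^-1 by rewrite invf_gt1.
    have [n hn] := exists_expn_gt e^-1 q1; exists n.
    by rewrite -lef_pV2 ?posrE ?exprn_gt0 // -exprVn ltW.
  by exists (u n), n.
have SM0 e n m : (n <= m)%N -> q ^+ n <= e -> normR (u n - u m) <= 1 * e.
  move=> nm qn; rewrite /u -(subnKC nm) iterD; apply: le_trans (iter_lip n z0 (uq (m - n)%N)) _.
  rewrite mul1r; apply: le_trans qn; rewrite -[leRHS]mulr1 ler_wpM2l ?exprn_ge0 //.
  by rewrite sub0r normRN (le_trans (uq _)) // ltW.
have SM e v w : 0 < e -> S e v -> S e w -> normR (v - w) <= 1 * e.
  move=> e0 [n qn <-] [m qm <-]; case/orP: (leq_total n m) => nm.
    exact: SM0.
  by rewrite normRB; exact: SM0.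
have [y hy] := complete_lim Smon S0 SM.
have ex e : 0 < e -> exists2 n, normR (y - u n) <= e & normR (y - u n.+1) <= e.
  move=> e0; have [_ [n qn _]] := S0 e e0; exists n.
    by rewrite -[leRHS]mul1r; apply: hy => //; exists n.
  rewrite -[leRHS]mul1r; apply: hy => //; exists n.+1 => //=.
  apply: le_trans qn; rewrite exprS -[leRHS]mul1r ler_wpM2r ?exprn_ge0 // ltW //.
have yq : normR y <= q.
  apply/ler_addgt0Pr => e e0; have [n h _] := ex e e0.
  have -> : y = u n + (y - u n) by rewrite addrC subrK.
  by apply: le_trans (normRD _ _) _; rewrite lerD.
have usa n : st (u n) = u n.
  elim: n => [|n IH].
    by rewrite /u /= -[X in st X](subrr (0 : A)) ca_starB subrr.
  rewrite /u /= /F ca_starZ ca_starD ca_starM -/(u n) !IH psa; congr (_ *: _).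
  by rewrite rmorphV ?unitfE // rmorph_nat.
exists y.
  apply: (@normR_eps _ _ _ _ 2) => e e0 _; have [n h _] := ex e e0.
  have -> : st y - y = st (y - u n) - (y - u n) by rewrite ca_starB usa opprB addrA subrK.
  by apply: le_trans (normRD _ _) _; rewrite normRN ca_norm_adj; lra.
have Fy : y = F y.
  apply: (@normR_eps _ _ _ _ 2) => e e0 _; have [n h h'] := ex e e0.
  have -> : y - F y = (y - u n.+1) - (F y - F (u n)) by rewrite opprB addrA subrK.
  apply: le_trans (normRD _ _) _; rewrite normRN.
  have := F_lip yq (uq n).
  have : q * normR (y - u n) <= e.
    by apply: le_trans h; rewrite -[leRHS]mul1r ler_wpM2r ?normR_ge0 // ltW.
  lra.
by rewrite [in RHS]Fy /F scalerA mulfV ?scale1r // pnatr_eq0.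
Qed.
End sqrt_one_minus.

Variables (H : hilbert R) (pi : A -> H -> H).
Hypothesis hpi : @star_rep R (cstar_star A) H pi.

(** If [|b| < 1], then [1 - b^* b] is the square of [1 - y] for a selfadjoint [y], so
    [|h|^2 - |pi b h|^2 = |h - pi y h|^2 >= 0]. The general case follows by dividing [a] by
    [|a| + d] and letting [d] tend to 0. *)
Lemma cstar_rep_le a x : normR (pi a x) <= normR a * normR x.
Proof.
have T (b : A) : @sa_dom R (cstar_star A) b by [].
have unit_case b h : normR b < 1 -> normR (pi b h) <= normR h.
  move=> b1; pose p := st b ** b.
  have p1 : normR p < 1 by rewrite ca_norm_star expr_lt1 ?normR_ge0.
  have psa : st p = p by rewrite ca_starM ca_starK.
  have [y ysa ye] := sqrt_one_minus p1 psa.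
  rewrite -(@ler_pXn2r _ 2) ?nnegrE ?normR_ge0 //.
  have e1 : pi (y ** y) h + pi p h = 2%:R *: pi y h.
    by rewrite -(repD hpi h (T _) (T _)) [(_ + _ : cstar_star A)]ye (repZ hpi).
  have e2 : pi (y ** y) h = pi y (pi y h) by exact: (repM hpi).
  have e3 : hdot H h (pi p h) = (normR (pi b h) ^+ 2)%:C%C.
    by rewrite (rep_norm hpi).
  have e4 : hdot H h (pi y (pi y h)) = (normR (pi y h) ^+ 2)%:C%C.
    by rewrite -hdotE (rep_adj hpi _ _ (T y)) [sa_star _]ysa.
  have := congr1 (fun v => complex.Re (hdot H h v)) e1; rewrite /= hdotDr e2 e3 e4 hdotZr.
  set v := hdot H h (pi y h) => e5.
  have : 0 <= normR (h - pi y h) ^+ 2 by exact: sqr_ge0.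
  have -> : normR (h - pi y h) ^+ 2 = normR h ^+ 2 - complex.Re v *+ 2 + normR (pi y h) ^+ 2.
    apply/complexI; rewrite -hdotE hdotBl !hdotBr !hdotE.
    rewrite (hdotC (pi y h) h) -/v; case: v {e5} => c d.
    by apply/eqP; rewrite eq_complex /=; apply/andP; split; apply/eqP; ring.
  move: e5; rewrite rmorph_nat /=; case: v => c d /=.
  rewrite -mulr_natl; lra.
apply/ler_addgt0Pr => e e0.
pose d := e / (normR x + 1).
have nx := normR_ge0 x.
have x1 : 0 < normR x + 1 by rewrite ltr_wpDl.
have d0 : 0 < d by rewrite divr_gt0.
pose t := normR a + d.
have t0 : 0 < t by rewrite ltr_wpDl // normR_ge0.
have tc : (t%:C)%C != 0 :> R[i] by rewrite eq_complex /= gt_eqF.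
have b1 : normR ((t%:C)%C^-1 *: a) < 1.
  rewrite normRZ; have -> : cabs ((t%:C)%C^-1 : R[i]) = t^-1.
    by rewrite -fmorphV cabs_real ger0_norm // invr_ge0 ltW.
  by rewrite mulrC ltr_pdivrMr // mul1r /t ltrDl.
have := unit_case _ x b1; rewrite (repZ hpi) // normRZ.
have -> : cabs ((t%:C)%C^-1 : R[i]) = t^-1.
  by rewrite -fmorphV cabs_real ger0_norm // invr_ge0 ltW.
rewrite mulrC ler_pdivrMr // => h; apply: le_trans h _.
have h5 : d * (normR x + 1) = e by rewrite /d divfK // gt_eqF.
rewrite /t; lra.
Qed.
End contractive.

(** * Crossed products *)

Section linear_on.
Variables (K : pzRingType) (V W : lmodType K) (D : set V) (h : V -> W).
Hypothesis D0 : D 0.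
Hypothesis Dlin : forall a u v, D u -> D v -> D (a *: u + v).
Hypothesis hlin : forall a u v, D u -> D v -> h (a *: u + v) = a *: h u + h v.

Lemma lin_on0 : h 0 = 0.
Proof.
have := hlin 1 D0 D0; rewrite !scale1r addr0 => e.
by apply: (@addrI _ (h 0)); rewrite -e addr0.
Qed.

Lemma lin_onD u v : D u -> D v -> h (u + v) = h u + h v.
Proof. by move=> Du Dv; have := hlin 1 Du Dv; rewrite !scale1r. Qed.

Lemma lin_onB u v : D u -> D v -> h (u - v) = h u - h v.
Proof. by move=> Du Dv; rewrite addrC -scaleN1r hlin // scaleN1r addrC. Qed.

Lemma lin_on_seq (I : eqType) (l : seq I) (F : I -> V) : (forall i, i \in l -> D (F i)) ->
  D (\sum_(i <- l) F i) /\ h (\sum_(i <- l) F i) = \sum_(i <- l) h (F i).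
Proof.
elim: l => [|i l IH] Fl; first by rewrite !big_nil lin_on0.
have [Dl hl] := IH (fun j jl => Fl j (mem_behead (s := i :: l) jl)).
have Di : D (F i) by apply: Fl; rewrite mem_head.
rewrite !big_cons lin_onD // hl; split=> //.
by rewrite -[F i]scale1r; exact: Dlin.
Qed.

Lemma lin_on_fsum (I : choiceType) (S P : set I) (F : I -> V) : finite_set S ->
  (forall i, P i -> ~ S i -> F i = 0) -> (forall i, P i -> D (F i)) ->
  D (\sum_(i \in P) F i) /\ h (\sum_(i \in P) F i) = \sum_(i \in P) h (F i).
Proof.
move=> fS F0 FD; rewrite (fsum_fin F0) [in RHS](fsum_fin (S := S)); last first.
  by move=> i Pi Si; rewrite F0 // lin_on0.
have [l [_ lP lE]] := finite_enum (finite_setIr P fS).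
by rewrite !lE; apply: lin_on_seq => i /lP[Pi _]; exact: FD.
Qed.

End linear_on.

Lemma locally_constant_finite (X : topologicalType) (T : choiceType) (u : X -> T) (S : set X) :
  (forall x, nbhs x [set y | u y = u x]) -> compact S -> finite_set (u @` S).
Proof.
move=> lu; apply: (@compact_ind X (fun S => finite_set (u @` S))).
- by rewrite image_set0.
- by move=> S1 S2 f1 f2; rewrite image_setU finite_setU.
- by move=> S1 S2 S12; apply: sub_finite_set; exact: image_subset.
move=> x _; exists [set y | u y = u x] => //.
by apply: (sub_finite_set _ (finite_set1 (u x))) => _ [y [/= + _] <-].
Qed.

Lemma locally_constant_continuous (X : topologicalType) (Y : topologicalType) (T : Type)
    (u : X -> T) (F : T -> X -> Y) :
  (forall x, nbhs x [set y | u y = u x]) -> (forall t, continuous (F t)) ->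
  continuous (fun x => F (u x) x).
Proof.
move=> lu cF x; apply: (@cvg_trans _ (F (u x) @ nbhs x)); last exact: cF.
by apply: near_eq_cvg; apply: filterS (lu x) => y /= ->.
Qed.


Section ca_zero.
Variables (R : realType) (A : cstar_algebra R).

Lemma ca_mul0l (x : A) : ca_mul 0 x = 0.
Proof. by rewrite -(subrr 0) (linear_fun_sub (f := (@ca_mul R A)^~ x)) ?subrr //; exact: ca_mul_linearl. Qed.

Lemma ca_mul0r (x : A) : ca_mul x 0 = 0.
Proof. by rewrite -(subrr 0) (linear_fun_sub (f := @ca_mul R A x)) ?subrr //; exact: ca_mul_linearr. Qed.

Lemma ca_star0 : ca_star (0 : A) = 0.
Proof. by rewrite -{1}(subrr (0 : A)) ca_starB subrr. Qed.

End ca_zero.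

(** * The unit space and functions supported on it *)

Section units.
Variables (R : realType) (Q : topologicalType) (Gr : groupoid Q).
Local Notation C := (R[i] : numFieldType).
Hypothesis Qtop : topological_groupoid Gr.
Hypothesis Qh : hausdorff_space Q.
Hypothesis Qlc : locally_compact [set: Q].
Hypothesis Qrd : r_discrete Gr.
Local Notation r := (grng Gr).
Local Notation s := (gsrc Gr).
Local Notation inv := (ginv Gr).
Local Notation mul := (gmul Gr).

(** The unit space is open and closed: for [y] near a unit, [y] and [r y] lie in one bisection, on
    which [r] is injective, so they coincide; closedness comes from the Hausdorff property. *)
Lemma units_locally_constant x : nbhs x [set y | `[< r y = y >] = `[< r x = x >]].
Proof.
have rc := rng_continuous Qrd.
have [rx|rx] := pselect (r x = x).
  have [U [oU injU _ _] Ux] := bisection_ex Qtop Qrd x.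
  have nU : nbhs x U by exact: open_nbhs_nbhs.
  have nrU : nbhs x (r @^-1` U) by apply: rc; rewrite rx.
  apply: filterS (filterI nU nrU) => y [Uy Ury] /=.
  by rewrite (asboolT rx) asboolT //; apply: injU; rewrite ?inE // grng_rng.
have cl : closed [set y | r y = y] by apply: (closed_eqfun Qh) => // y; exact: cvg_id.
have oc := closed_openC cl.
have nx : nbhs x (~` [set y | r y = y]) by exact: open_nbhs_nbhs.
by apply: filterS nx => y /= ry; rewrite (asboolF rx) asboolF.
Qed.

Definition unit_cut (f : Q -> R[i]) : Q -> R[i] := fun x => if `[< r x = x >] then f x else 0.

Lemma unit_cut_Cc f : @Cc C Q f -> @Cc C Q (unit_cut f).
Proof.
move=> Cf; have [S [cS fS]] := Cc_supp Cf.
apply: (@CcI C _ Qh _ S) => //.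
- apply: (@locally_constant_continuous Q C bool _ (fun b x => if b then f x else 0)).
    exact: units_locally_constant.
  case; [exact: Cf.1|move=> p; exact: cvg_cst].
- by move=> x ns; rewrite /unit_cut fS // if_same.
Qed.

Lemma unit_cut_supported f : unit_supported Gr (unit_cut f).
Proof. by move=> x rx; rewrite /unit_cut asboolF. Qed.

(** By [conv_unit], such a [chi] is a left unit for the functions supported in [K]. *)
Lemma unit_plateau (K : set Q) : compact K -> exists chi : Q -> R[i],
  [/\ @Cc C Q chi, unit_supported Gr chi & forall x, K x -> chi (r x) = 1].
Proof.
move=> /(compact_rng Qrd) cK.
have [n [e [ce _ be e1]]] := partition_of_unity R Qtop Qh Qlc Qrd cK.
exists (unit_cut (\sum_(i < n) (fun y => (e i y)%:C%C : R[i]))); split.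
- apply: unit_cut_Cc; apply: (@Cc_sum C _ Qh) => i.
  have [U [S [_ cS _ eS]]] := be i.
  apply: (@CcI C _ Qh _ S) => //; last by move=> x /eS ->.
  move=> x; apply: (@continuous_comp Q R C (e i) (fun y : R => real_complex R y : C)).
    exact: ce.
  exact: real_complex_continuous.
- exact: unit_cut_supported.
- move=> x Kx; rewrite /unit_cut asboolT ?grng_rng // fct_sumE -rmorph_sum /= e1 //.
Qed.

Lemma conv_unitr (f g : Q -> R[i]) x : unit_supported Gr g ->
  groupoid_conv Gr f g x = f x * g (s x).
Proof.
move=> ug; rewrite /groupoid_conv (@fsum_fin _ _ [set x]); last first.
  move=> y /= yx ny; rewrite [g _]ug ?mulr0 // => e; apply: ny.
  have e1 : mul (inv y) x = s y by rewrite -e grngM ?gsrcV // grngV.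
  by rewrite -[x](gmulKV yx) e1 gmul1r.
have -> : rfiber Gr (r x) `&` [set x] = [set x].
  by apply/seteqP; split => [y []|_ ->].
by rewrite fsbig_set1 gmulVl.
Qed.

Lemma unit_supported_star (f : Q -> R[i]) : unit_supported Gr f -> unit_supported Gr (conv_star Gr f).
Proof.
move=> uf x rx; rewrite /conv_star uf ?conjC0 // => e; apply: rx.
have := unit_inv e; rewrite ginvK => xi; by rewrite {1}xi e -xi.
Qed.

End units.


(** * Integrated forms and generators of the crossed product *)

Section crossed.
Variables (R : realType) (G : groupType) (A : cstar_algebra R) (beta : G -> A -> A).
Hypothesis beta_action : cstar_action beta.

Definition single (t : G) (a : A) : G -> A := fun u => if u == t then a else 0.

Lemma single_finite t a : finite_set [set u | single t a u != 0].
Proof.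
apply: sub_finite_set (finite_set1 t) => u /=; rewrite /single.
by case: ifP => [/eqP//|_]; rewrite eqxx.
Qed.

Lemma beta0 u : beta u 0 = 0.
Proof.
have [h _ _] := beta_action; have [[l _ _] _] := h u.
exact: (lin_on0 (D := setT) (h := beta u) I (fun a x y _ _ => l a x y I I)).
Qed.

Lemma cp_mul_singlel a (F : G -> A) t : cp_mul beta (single 1%g a) F t = ca_mul a (F t).
Proof.
have [_ b1 _] := beta_action.
rewrite /cp_mul (fsum_fin (S := [set 1%g])); last first.
  by move=> u _ nu; rewrite /single; case: eqP => // _; rewrite ca_mul0l.
by rewrite setTI fsbig_set1 /single eqxx invg1 mul1g b1.
Qed.

Lemma cp_mul_singler a (F : G -> A) t : cp_mul beta F (single 1%g a) t = ca_mul (F t) (beta t a).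
Proof.
rewrite /cp_mul (fsum_fin (S := [set t])); last first.
  move=> u _ nu; rewrite /single; case: eqP => [e|_]; last by rewrite beta0 ca_mul0r.
  by case: nu; apply: (@mulgI _ u^-1%g); rewrite e mulVg.
by rewrite setTI fsbig_set1 /single mulVg eqxx.
Qed.

Section integrated.
Variables (H : hilbert R) (pi : A -> H -> H) (U : G -> H -> H).
Hypothesis cov : covariant_rep beta pi U.

Let pirep : star_rep (pi : cstar_star A -> H -> H). Proof. by case: cov. Qed.
Let Ulin s : linear (U s). Proof. by case: cov => _ [h _ _ _] _; exact: h. Qed.
Let U1 x : U 1%g x = x. Proof. by case: cov => _ [_ h _ _] _; exact: h. Qed.
Let UM s t x : U (s * t)%g x = U s (U t x). Proof. by case: cov => _ [_ _ h _] _; exact: h. Qed.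
Let Udot s x y : hdot H (U s x) (U s y) = hdot H x y.
Proof. by case: cov => _ [_ _ _ h] _; exact: h. Qed.
Let Upi s a x : U s (pi a x) = pi (beta s a) (U s x). Proof. by case: cov => _ _ h; exact: h. Qed.

Lemma unitary_normR s x : normR (U s x) = normR x.
Proof.
have : normR (U s x) ^+ 2 = normR x ^+ 2.
  by apply/complexI; rewrite -!hdotE Udot.
by move=> h; apply/eqP; rewrite -(eqrXn2 (n := 2)) ?normR_ge0 // h.
Qed.

Lemma unitary_adjoint s x y : hdot H (U s x) y = hdot H x (U s^-1%g y).
Proof. by rewrite -[RHS](Udot s) -UM mulgV U1. Qed.

Lemma pi_lin (a : R[i]) u v x : pi (a *: u + v) x = a *: pi u x + pi v x.
Proof. exact: (rep_lin pirep a x (f := u) (g := v) I I). Qed.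

Lemma pi0 x : pi 0 x = 0.
Proof. exact: (lin_on0 (D := setT) (h := pi^~ x) I (fun a u v _ _ => pi_lin a u v x)). Qed.

Lemma piD u v x : pi (u + v) x = pi u x + pi v x.
Proof. by have := pi_lin 1 u v x; rewrite !scale1r. Qed.

Lemma pi_linr a (z : R[i]) x y : pi a (z *: x + y) = z *: pi a x + pi a y.
Proof. exact: (rep_linear pirep (f := a) I). Qed.

Lemma integrated_seq (S : set G) : finite_set S -> exists l : seq G, forall F : G -> A,
  (forall s, ~ S s -> F s = 0) -> forall x, integrated pi U F x = \sum_(s <- l) pi (F s) (U s x).
Proof.
move=> fS; have [l [_ _ lE]] := finite_enum fS; exists l => F F0 x.
rewrite /integrated (fsum_fin (S := S)); first by rewrite setTI lE.
by move=> s _ /F0 ->; exact: pi0.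
Qed.

Lemma supp_out (F : G -> A) s : ~ [set s | F s != 0] s -> F s = 0.
Proof. by move=> /negP /negPn /eqP. Qed.

Lemma integrated_linear (F : G -> A) : finite_set [set s | F s != 0] -> linear (integrated pi U F).
Proof.
move=> /integrated_seq[l lE] a x y; rewrite !lE; try exact: supp_out.
rewrite scaler_sumr -big_split; apply: eq_bigr => s _ /=.
by rewrite (Ulin s a x y) pi_linr.
Qed.

Lemma integrated_bound (F : G -> A) : finite_set [set s | F s != 0] ->
  exists M, forall x, normR (integrated pi U F x) <= M * normR x.
Proof.
move=> /integrated_seq[l lE]; exists (\sum_(s <- l) normR (F s)) => x.
rewrite lE; last exact: supp_out.
elim: (l) => [|s l' IH]; first by rewrite !big_nil normR0 mul0r.
rewrite !big_cons mulrDl; apply: le_trans (normRD _ _) _; apply: lerD; last exact: IH.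
by apply: le_trans (cstar_rep_le pirep (F s) (U s x)) _; rewrite unitary_normR.
Qed.

Lemma integrated_lin (a : R[i]) (F F' : G -> A) x : finite_set [set s | F s != 0] ->
  finite_set [set s | F' s != 0] ->
  integrated pi U (a *: F + F') x = a *: integrated pi U F x + integrated pi U F' x.
Proof.
move=> fF fF'; have fU : finite_set ([set s | F s != 0] `|` [set s | F' s != 0]) by rewrite finite_setU.
have [l lE] := integrated_seq fU.
rewrite !lE => [|s nS|s nS|s nS].
- rewrite scaler_sumr -big_split; apply: eq_bigr => s _ /=; exact: pi_lin.
- by apply: supp_out => h; apply: nS; right.
- by apply: supp_out => h; apply: nS; left.
have -> : (a *: F + F') s = a *: F s + F' s by [].
have -> : F s = 0 by apply: supp_out => h; apply: nS; left.
have -> : F' s = 0 by apply: supp_out => h; apply: nS; right.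
by rewrite scaler0 addr0.
Qed.

Lemma integrated_mul (F F' : G -> A) x : finite_set [set s | F s != 0] ->
  finite_set [set s | F' s != 0] ->
  integrated pi U (cp_mul beta F F') x = integrated pi U F (integrated pi U F' x).
Proof.
move=> fF fF'; rewrite {1}/integrated.
have term t : pi (cp_mul beta F F' t) (U t x) =
    \sum_(s \in [set: G]) pi (ca_mul (F s) (beta s (F' (s^-1 * t)%g))) (U t x).
  rewrite /cp_mul (raddf_fsum (h := fun a => pi a (U t x)) (pi0 _) _ fF) //.
    by move=> u v; exact: piD.
  by move=> s _ /supp_out ->; rewrite ca_mul0l.
under eq_fsbigr do rewrite term.
have fT := finite_image2 (fun s t => s * t)%g fF fF'; set T := (X in finite_set X) in fT.
rewrite (exchange_fsum fT fF); last first.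
  move=> t s _ _ ne; have Fs : F s <> 0 by move=> e; apply: ne; rewrite e ca_mul0l pi0.
  split; last by apply/eqP.
  exists s; first by apply/eqP.
  exists (s^-1 * t)%g; last by rewrite mulVKg.
  apply/eqP => e; apply: ne; by rewrite e beta0 ca_mul0r pi0.
rewrite /integrated; apply: eq_fsbigr => s _.
rewrite (reindex_fsum (f := fun t => (s * t)%g) (g := fun t => (s^-1 * t)%g) (P := setT)) //; last 2 first.
- by move=> t _; rewrite mulKg.
- by move=> t _; rewrite mulVKg.
rewrite (raddf_fsum (h := fun y => pi (F s) (U s y)) _ _ fF'); first last.
- by move=> t _ /supp_out ->; exact: pi0.
- move=> y z; have := Ulin s 1 y z; rewrite !scale1r => ->.
  by have := pi_linr (F s) 1 (U s y) (U s z); rewrite !scale1r.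
- have U0 : U s 0 = 0 by apply: normR0_eq0; rewrite unitary_normR normR0.
  apply: normR0_eq0; apply/eqP; rewrite eq_le normR_ge0 andbT.
  by rewrite U0 (le_trans (cstar_rep_le pirep (F s) 0)) // normR0 mulr0.
apply: eq_fsbigr => t _; rewrite mulKg UM Upi.
exact: (repM pirep (f := F s) (g := beta s (F' t)) _ I I).
Qed.

Lemma integrated_adj (F : G -> A) x y : finite_set [set s | F s != 0] ->
  hdot H (integrated pi U F x) y = hdot H x (integrated pi U (cp_star beta F) y).
Proof.
move=> fF; rewrite /integrated.
rewrite (raddf_fsum (h := fun z => hdot H z y) (hdot0l _) _ fF); first last.
- by move=> t _ /supp_out ->; exact: pi0.
- by move=> u v; exact: hdotDl.
have term s : hdot H (pi (F s) (U s x)) y = hdot H x (pi (cp_star beta F s^-1%g) (U s^-1%g y)).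
  rewrite (rep_adj pirep (f := F s) (U s x) y I) unitary_adjoint Upi.
  by rewrite /cp_star invgK.
under eq_fsbigr do rewrite term.
rewrite (reindex_fsum (f := fun t => t^-1%g) (g := fun t => t^-1%g) (P := setT)) //; last 2 first.
- by move=> t _; rewrite invgK.
- by move=> t _; rewrite invgK.
rewrite (raddf_fsum (h := fun z => hdot H x z) (hdot0r _) _ (finite_image (fun s => s^-1%g) fF)); first last.
- move=> t _ nt; rewrite /cp_star (@supp_out F t^-1%g).
    by rewrite ca_star0 beta0 pi0.
  by move=> h; apply: nt; exists t^-1%g => //; rewrite invgK.
- by move=> u v; exact: hdotDr.
by apply: eq_fsbigr => t _; rewrite invgK.
Qed.

Lemma integrated_rep : star_rep (integrated pi U : Cc_crossed beta -> H -> H).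
Proof.
split.
- move=> F fF; split; first exact: integrated_linear.
  have [M hM] := integrated_bound fF.
  exact: hilbert_bounded_continuous (integrated_linear fF) hM.
- by move=> a F F' fF fF' x; exact: integrated_lin.
- by move=> F F' fF fF' x; exact: integrated_mul.
- by move=> F fF x y; exact: integrated_adj.
Qed.

End integrated.

Lemma full_norm_le (F : G -> A) (M : R) : 0 <= M ->
  (forall (H : hilbert R) (pi : A -> H -> H) (U : G -> H -> H), covariant_rep beta pi U ->
    forall x, normR (integrated pi U F x) <= M * normR x) ->
  (full_norm beta F <= M%:E)%E.
Proof.
move=> M0 h; apply: ge_ereal_sup => _ [H [pi [U [cov ->]]]].
apply: ge_ereal_sup => _ [x /= x1 <-]; rewrite lee_fin.
by apply: le_trans (h _ _ _ cov x) _; rewrite -[leRHS]mulr1 ler_wpM2l.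
Qed.

Variables (B : cstar_algebra R) (k : (G -> A) -> B).
Hypothesis B_full : full_crossed_product beta k.
Local Notation fin F := (finite_set [set s | (F : G -> A) s != 0]).

Lemma fin0 : fin 0.
Proof. by apply: sub_finite_set (finite_set0 G) => s /=; rewrite eqxx. Qed.

Lemma fin_lin (a : R[i]) (F F' : G -> A) : fin F -> fin F' -> fin (a *: F + F').
Proof.
move=> fF fF'; have fU : finite_set ([set s | F s != 0] `|` [set s | F' s != 0]) by rewrite finite_setU.
apply: sub_finite_set fU => s /=.
have -> : (a *: F + F') s = a *: F s + F' s by [].
case: (eqVneq (F s) 0) => [->|Fs]; last by left.
case: (eqVneq (F' s) 0) => [->|F's]; last by right.
by rewrite scaler0 addr0 eqxx.
Qed.

Lemma k_lin (a : R[i]) (F F' : G -> A) : fin F -> fin F' -> k (a *: F + F') = a *: k F + k F'.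
Proof. by have [[h _ _] _ _] := B_full; exact: h. Qed.
Lemma k_mul (F F' : G -> A) : fin F -> fin F' -> k (cp_mul beta F F') = ca_mul (k F) (k F').
Proof. by have [[_ h _] _ _] := B_full; exact: h. Qed.
Lemma k_star (F : G -> A) : fin F -> k (cp_star beta F) = ca_star (k F).
Proof. by have [[_ _ h] _ _] := B_full; exact: h. Qed.
Lemma k_norm_le (F : G -> A) (M : R) : fin F -> 0 <= M ->
  (forall (H : hilbert R) (pi : A -> H -> H) (U : G -> H -> H), covariant_rep beta pi U ->
    forall x, normR (integrated pi U F x) <= M * normR x) -> normR (k F) <= M.
Proof.
have [_ kn _] := B_full => fF M0 h.
by rewrite -lee_fin (kn F fF); exact: full_norm_le.
Qed.

Lemma k_single_le t a : normR (k (single t a)) <= normR a.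
Proof.
apply: k_norm_le; [exact: single_finite|exact: normR_ge0|] => H pi U cov x.
rewrite /integrated (fsum_fin (S := [set t])); last first.
  by move=> s _ st; rewrite /single; case: eqP => // _; exact: (pi0 cov).
rewrite setTI fsbig_set1 /single eqxx -(unitary_normR cov t x).
by apply: cstar_rep_le; case: cov.
Qed.

Lemma single_sum (F : G -> A) (l : seq G) : uniq l -> (forall s, s \notin l -> F s = 0) ->
  F = \sum_(s <- l) single s (F s).
Proof.
move=> ul F0; apply/funext => t; rewrite fct_sumE.
have [tl|nt] := boolP (t \in l); last first.
  rewrite F0 // big1_seq // => s /= sl; rewrite /single; case: eqP => // ts.
  by move: nt; rewrite ts sl.
rewrite (bigD1_seq t) //= big1_seq; first by rewrite addr0 /single eqxx.
by move=> s /= /andP[st _]; rewrite /single eq_sym (negPf st).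
Qed.

(** A finitely supported function is a sum of singles, and [a |-> k (single t a)] is contractive by
    [k_single_le], so the singles with values in a dense set generate [B] under sums and limits. *)
Lemma crossed_ind (D : set A) (V : set B) : dense D ->
  V 0 -> (forall u v, V u -> V v -> V (u + v)) ->
  (forall u, (forall e, 0 < e -> exists2 v, V v & normR (u - v) <= e) -> V u) ->
  (forall t a, D a -> V (k (single t a))) -> forall u, V u.
Proof.
move=> dD V0 VD Vc VD1 u.
have Vs t a : V (k (single t a)).
  apply: Vc => e e0; have [a' Da' aa'] := dense_normR a dD e0.
  exists (k (single t a')); first exact: VD1.
  apply: ltW; apply: le_lt_trans aa'.
  have -> : k (single t a) - k (single t a') = k (single t (a - a')).
    rewrite -(lin_onB k_lin); try exact: single_finite.
    congr k; apply/funext => s.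
    have -> : (single t a - single t a') s = single t a s - single t a' s by [].
    by rewrite /single; case: ifP => // _; rewrite subr0.
  exact: k_single_le.
apply: Vc => e e0; have [_ _ dk] := B_full.
have [_ [F fF <-] uF] := dense_normR u dk e0.
exists (k F); last exact: ltW.
have /finite_seqP[l Fl] := fF.
have -> : F = \sum_(s <- undup l) single s (F s).
  apply: single_sum; first exact: undup_uniq.
  move=> s; rewrite mem_undup => sl; apply: supp_out; rewrite Fl /=.
  exact/negP.
rewrite (lin_on_seq fin0 fin_lin k_lin (F := fun s => single s (F s)) (fun s _ => single_finite _ _)).2.
by apply: big_ind => // s _; exact: Vs.
Qed.

End crossed.

Lemma opnorm_bound (R : realType) (H : hilbert R) (T : H -> H) (M : R) :
  (forall (a : R[i]) x, T (a *: x) = a *: T x) -> (opnorm T <= M%:E)%E ->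
  forall x, normR (T x) <= M * normR x.
Proof.
move=> TZ TM x; have [x0|x0] := eqVneq (normR x) 0.
  by rewrite x0 mulr0 (normR0_eq0 x0) -(scale0r 0) TZ scale0r normR0.
have xp : 0 < normR x by rewrite lt_neqAle eq_sym x0 normR_ge0.
pose z : R[i] := ((normR x)^-1)%:C%C.
have zE : cabs z = (normR x)^-1 by rewrite cabs_real ger0_norm // invr_ge0 normR_ge0.
have zx : normR (z *: x) <= 1 by rewrite normRZ zE mulVf.
have : ((normR (T (z *: x)))%:E <= M%:E)%E.
  by apply: le_trans TM; apply: ereal_sup_ubound; exists (z *: x).
by rewrite lee_fin TZ normRZ zE ler_pdivrMl // mulrC.
Qed.

Section l2.
Variables (R : realType) (G : groupType) (H : hilbert R).
Implicit Type xi : G -> H.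

Lemma l2norm_ge xi t : ((normR (xi t))%:E <= l2norm xi)%E.
Proof.
have -> : (normR (xi t))%:E = sqrte ((normR (xi t) ^+ 2)%:E).
  by rewrite /= sqrtr_sqr ger0_norm // normR_ge0.
rewrite /l2norm lee_sqrt; last by apply: esum_ge0 => s _; rewrite lee_fin sqr_ge0.
apply: esum_ge; exists [set t]; first by split=> //; exact: finite_set1.
by rewrite fsbig_set1.
Qed.

Lemma l2norm_point (t : G) (x : H) :
  l2norm (fun s => if s == t then x else 0) = (normR x)%:E.
Proof.
have -> : (normR x)%:E = sqrte ((normR x ^+ 2)%:E).
  by rewrite /= sqrtr_sqr ger0_norm // normR_ge0.
congr sqrte; rewrite -(@esum_set1 R G t (fun=> (normR x ^+ 2)%:E)) ?lee_fin ?sqr_ge0 //.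
rewrite [RHS]esum_mkcond; apply: eq_esum => s _.
case: eqP => [->|ne]; first by rewrite mem_set.
by rewrite memNset // normR0 expr0n.
Qed.

End l2.

Section reduced.
Variables (R : realType) (G : groupType) (A : cstar_algebra R) (beta : G -> A -> A).

(** The test vector is [x] placed at the identity of [G]: in the coordinate [t] of its image only
    the term [s = t] survives. *)
Lemma reduced_norm_ge (H : hilbert R) (pi : A -> H -> H) (F : G -> A) (t : G) (x : H) :
  star_rep (pi : cstar_star A -> H -> H) -> normR x <= 1 ->
  ((normR (pi (beta t^-1%g (F t)) x))%:E <= reduced_norm beta F)%E.
Proof.
move=> hpi x1.
have pi0r a : pi a 0 = 0 by exact: (rep0r hpi (f := a) I).
pose xi : G -> H := fun s => if s == 1%g then x else 0.
have -> : pi (beta t^-1%g (F t)) x = regular_integrated beta pi F xi t.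
  rewrite /regular_integrated (fsum_fin (S := [set t])).
    by rewrite setTI fsbig_set1 /regular_pi /regular_U /xi mulVg eqxx.
  move=> s _ st; rewrite /regular_pi /regular_U /xi; case: eqP => [e|_]; last exact: pi0r.
  by case: st; apply: (@mulgI _ s^-1%g); rewrite mulVg -e.
apply: le_trans (l2norm_ge _ t) _.
apply: (@le_trans _ _ (l2opnorm (regular_integrated beta pi F))).
  by apply: ereal_sup_ubound; exists xi => //=; rewrite l2norm_point lee_fin.
by apply: ereal_sup_ubound; exists H, pi.
Qed.

End reduced.

(** * Skew products and corners *)

Section skew.
Variables (R : realType) (Q : topologicalType) (Gr : groupoid Q) (G : groupType) (c : Q -> G).
Hypothesis cM : groupoid_hom Gr c.
Hypothesis Qtop : topological_groupoid Gr.
Hypothesis Qh : hausdorff_space Q.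
Hypothesis Qlc : locally_compact [set: Q].
Hypothesis Qrd : r_discrete Gr.
Hypothesis c_cont : continuous (c : Q -> discrete_topology G).
Local Notation PG := (Q * discrete_topology G)%type.
Local Notation P := (skew_product cM).
Local Notation C := (R[i] : numFieldType).
Local Notation r := (grng Gr).
Local Notation s := (gsrc Gr).
Local Notation inv := (ginv Gr).
Local Notation mul := (gmul Gr).

(** * The skew product as a locally compact Hausdorff r-discrete groupoid *)

Lemma hom_locally_constant x : nbhs x [set y | c y = c x].
Proof. by have := c_cont (x:=x) => /discrete_cvg. Qed.

Lemma nbhs_slice (p : PG) (A : set Q) :
  nbhs p.1 A -> nbhs p [set q : PG | A q.1 /\ q.2 = p.2].
Proof.
move=> nA; exists (A, [set p.2]); last by move=> q [].
by split=> //=; rewrite nbhs_principalE; exact: principal_filterP.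
Qed.

Lemma open_slice (A : set Q) (t : G) : open A -> open [set q : PG | A q.1 /\ q.2 = t].
Proof.
move=> oA; rewrite openE => p [Ap pt]; rewrite -pt.
by apply: nbhs_slice; exact: open_nbhs_nbhs.
Qed.

Lemma slice_cvg (T : Type) (F : set_system T) (FF : Filter F) (f : T -> PG) p :
  (f t).1 @[t --> F] --> (p.1 : Q) -> F [set t | (f t).2 = p.2] -> f @ F --> (p : PG).
Proof.
case: p => x t /= f1 f2.
have -> : f = (fun z => ((f z).1, (f z).2)) by apply/funext => z; case: (f z).
apply: (cvg_pair (G := nbhs x) (H := nbhs t)) => //.
by apply/discrete_cvg.
Qed.

Lemma near_slice (T : Type) (F : set_system T) (FF : Filter F) (f : T -> PG) p :
  f @ F --> (p : PG) -> F [set t | (f t).2 = p.2].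
Proof.
move=> fp; have : F (f @^-1` [set q : PG | setT q.1 /\ q.2 = p.2]).
  by apply: fp; apply: nbhs_slice; exact: filterT.
by apply: filterS => t [].
Qed.

Lemma slice_continuous (t : G) : continuous (fun y : Q => (y, t) : PG).
Proof. by move=> y; apply: slice_cvg => //; exact: filterS filterT. Qed.

Lemma skew_topological : topological_groupoid P.
Proof.
split.
  move=> p; apply: slice_cvg.
    apply: (@continuous_comp _ _ _ fst (ginv Gr)); first exact: cvg_fst.
    by case: Qtop => iv _; exact: iv.
  by apply: filterS (nbhs_slice (hom_locally_constant p.1)) => q [/= -> ->].
apply/subspace_continuousP => -[p q] /= [pq1 pq2].
have W1 : (fun z : PG * PG => z.1) z @[z --> within [set z : PG * PG | gsrc P z.1 = grng P z.2] (nbhs (p, q))] --> p.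
  by apply: cvg_trans (@cvg_fst _ _ (nbhs p) (nbhs q) _); apply: cvg_app; exact: cvg_within.
have W2 : (fun z : PG * PG => z.2) z @[z --> within [set z : PG * PG | gsrc P z.1 = grng P z.2] (nbhs (p, q))] --> q.
  by apply: cvg_trans (@cvg_snd _ _ (nbhs p) (nbhs q) _); apply: cvg_app; exact: cvg_within.
apply: slice_cvg; last exact: near_slice W2.
apply: (mul_cvg Qtop).
- apply: (cvg_comp _ fst W1); exact: cvg_fst.
- apply: (cvg_comp _ fst W2); exact: cvg_fst.
- exact: pq1.
- by apply: filterS (withinT _ _) => z [].
Qed.

Lemma skew_hausdorff : hausdorff_space PG.
Proof. exact: hausdorff_prod Qh discrete_hausdorff. Qed.

Lemma skew_locally_compact : locally_compact [set: PG].
Proof.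
move=> [x t] _; have := Qlc (x:=x) I.
rewrite /= !withinET => -[N nN [cN clN]].
exists [set q : PG | N q.1 /\ q.2 = t].
  exact: (@nbhs_slice (x, t)).
have cNt : compact [set q : PG | N q.1 /\ q.2 = t].
  exact: (compact_setX (Q := [set t]) cN (@compact_set1 _ _)).
by split=> //; apply: compact_closed => //; exact: skew_hausdorff.
Qed.

(** On the slice at [t], where [c] takes the value [c x], the range map is [y |-> (r y, c x * t)]
    with constant second coordinate; a bisection of [Q] cut down to this set is therefore adapted to
    the range map of [P]. *)
Lemma skew_r_discrete : r_discrete P.
Proof.
split=> //.
  move=> p; apply: slice_cvg.
    apply: (@continuous_comp _ _ _ fst (grng Gr)); first exact: cvg_fst.
    exact: (rng_continuous Qrd).
  by apply: filterS (nbhs_slice (hom_locally_constant p.1)) => q [/= -> ->].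
move=> [x t]; have [U [oU injU homU _] Ux] := bisection_ex Qtop Qrd x.
have oc : open [set y | c y = c x].
  by rewrite openE => y /= yx; rewrite /interior -yx; exact: hom_locally_constant.
exists [set q : PG | (U `&` [set y | c y = c x]) q.1 /\ q.2 = t]; split=> //.
- by apply: open_slice; exact: openI.
- move=> [y t1] [z t2]; rewrite !inE /= => -[[Uy _] ->] [[Uz _] ->] [ryz _].
  by congr pair; apply: injU; rewrite ?inE.
move=> V oV VU.
have oV1 : open [set y | V (y, t)].
  by apply: (@open_comp _ _ (fun y : Q => (y, t) : PG) V) => // y _; exact: slice_continuous.
have V1U : [set y | V (y, t)] `<=` U by move=> y /VU [[]].
have [W oW WE] := homU _ oV1 V1U.
exists [set q : PG | W q.1 /\ q.2 = (c x * t)%g]; first exact: open_slice.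
apply/seteqP; split=> [q [[y t1] Vy <-]|[w t1] [[/= Ww ->]] [[y t2] _ [yw _]]].
  split; last by exists (y, t1).
  have [[/= _ cy] /= t1t] := VU _ Vy; rewrite /= t1t cy; split=> //.
  have [] // : (W `&` units Gr) (grng Gr y).
  by rewrite -WE; exists y => //=; rewrite -t1t.
have [z Vz zw] : [set grng Gr x | x in [set y | V (y, t)]] w.
  by rewrite WE; split=> //; exists y.
exists (z, t) => //; rewrite /skew_product /= /skew_rng /= zw.
by have [[/= _ ->]] := VU _ Vz.
Qed.


(** * Slices of the skew product and the grading of [C_c(Q)] by [c] *)

Definition slice (a : Q -> R[i]) (t : G) : PG -> R[i] :=
  fun p => if (p.2 : G) == t then a p.1 else 0.

(** The component of degree [g] in the grading of [C_c(Q)] over [G] that [c] induces. *)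
Definition piece (a : Q -> R[i]) (g : G) : Q -> R[i] :=
  fun x => if c x == g then a x else 0.

Lemma snd_locally_constant (p : PG) : nbhs p [set q : PG | q.2 = p.2].
Proof. by apply: filterS (nbhs_slice (@filterT _ (nbhs p.1) _)) => q []. Qed.

Lemma slice_Cc a t : @Cc C Q a -> @Cc C PG (slice a t).
Proof.
move=> Ca; have [S [cS aS]] := Cc_supp Ca.
apply: (@CcI C _ skew_hausdorff _ (S `*` [set t])).
- exact: (compact_setX cS (@compact_set1 _ _)).
- apply: (@locally_constant_continuous PG C G (fun p => p.2)
    (fun t' p => if t' == t then a p.1 else 0)); first exact: snd_locally_constant.
  move=> t'; case: eqP => _; last by move=> p; exact: cvg_cst.
  move=> p; apply: (@continuous_comp PG Q C fst a); first exact: cvg_fst.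
  exact: Ca.1.
- move=> -[x t'] ns; rewrite /slice /=; case: eqP => // e.
  by apply: aS => Sx; apply: ns.
Qed.

Lemma piece_Cc a g : @Cc C Q a -> @Cc C Q (piece a g).
Proof.
move=> Ca; have [S [cS aS]] := Cc_supp Ca.
apply: (@CcI C _ Qh _ S) => //.
- apply: (@locally_constant_continuous Q C G c (fun t x => if t == g then a x else 0)).
    exact: hom_locally_constant.
  move=> t'; case: eqP => _; last by move=> p; exact: cvg_cst.
  exact: Ca.1.
- by move=> x ns; rewrite /piece aS // if_same.
Qed.

Lemma unslice_Cc (f : PG -> R[i]) t : @Cc C PG f -> @Cc C Q (fun x => f (x, t)).
Proof.
move=> Cf; have [S [cS fS]] := Cc_supp Cf.
apply: (@CcI C _ Qh _ (fst @` S)).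
- by apply: continuous_compact => //; apply: continuous_subspaceT => x; exact: cvg_fst.
- move=> x; apply: (@continuous_comp Q PG C (fun y => (y, t)) f); first exact: slice_continuous.
  exact: Cf.1.
- by move=> x nx; apply: fS => Sx; apply: nx; exists (x, t).
Qed.

(** A point [(y, u)] of the range fibre of [(x, t)] is determined by [y], because
    [c y * u = c x * t]. *)
Lemma skew_convE (f g : PG -> R[i]) x t : groupoid_conv P f g (x, t) =
  \sum_(y \in rfiber Gr (r x)) f (y, (c y)^-1 * c x * t)%g * g (mul (inv y) x, t).
Proof.
rewrite /groupoid_conv.
rewrite (@reindex_fsum _ Q PG (fun y => (y, (c y)^-1 * c x * t)%g) fst (rfiber Gr (r x))) //.
- by move=> y yx; rewrite /rfiber /= /skew_rng /= yx !mulgA mulgV mul1g.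
- by move=> [y u] [].
- by move=> [y u] [/= yx e]; congr pair; rewrite -mulgA -e mulKg.
Qed.

Lemma slice0 t : slice 0 t = 0.
Proof. by apply/funext => p; rewrite /slice; case: ifP. Qed.

Lemma slice_lin (z : R[i]) a b t : slice (z *: a + b) t = z *: slice a t + slice b t.
Proof.
apply/funext => p; rewrite fct_addE fct_scaleE /slice; case: ifP => _.
  by rewrite fct_addE fct_scaleE.
by rewrite mulr0 addr0.
Qed.

Lemma piece_lin (z : R[i]) a b g : piece (z *: a + b) g = z *: piece a g + piece b g.
Proof.
apply/funext => p; rewrite fct_addE fct_scaleE /piece; case: ifP => _.
  by rewrite fct_addE fct_scaleE.
by rewrite mulr0 addr0.
Qed.

Lemma piece_finite a : @Cc C Q a -> finite_set [set g | exists2 x, c x = g & a x <> 0].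
Proof.
move=> /Cc_supp[S [cS aS]].
apply: (sub_finite_set _ (locally_constant_finite hom_locally_constant cS)).
by move=> _ [x <- ax]; exists x => //; apply: contrapT => /aS.
Qed.

Lemma piece_eq0 a g : ~ (exists2 x, c x = g & a x <> 0) -> piece a g = 0.
Proof.
move=> h; apply/funext => x; rewrite /piece; case: eqP => // cx.
by apply: contrapT => ax; apply: h; exists x.
Qed.

(** * The corner homomorphisms *)

Variables (A : cstar_algebra R) (iA : (PG -> R[i]) -> A).
Hypothesis A_env : groupoid_cstar P iA.
Variable beta : G -> A -> A.
Hypothesis beta_action : cstar_action beta.
Hypothesis betaE : forall (s : G) (f : PG -> R[i]), @Cc C PG f ->
  beta s (iA f) = iA (fun p => f (p.1, (p.2 * s)%g)).
Local Notation CP := (@Cc C PG).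
Local Notation CQ := (@Cc C Q).

Let iA_hom : @star_hom R (Cc_groupoid R P) A iA. Proof. by case: A_env. Qed.


Lemma CP_lin (z : R[i]) f g : CP f -> CP g -> CP (z *: f + g).
Proof. exact: (@Cc_lin C _ skew_hausdorff). Qed.
Lemma CP0 : CP 0. Proof. exact: (@Cc0 C _ skew_hausdorff). Qed.
Lemma iA_lin (z : R[i]) f g : CP f -> CP g -> iA (z *: f + g) = z *: iA f + iA g.
Proof. by case: iA_hom => h _ _; exact: h. Qed.
Lemma CP_conv f g : CP f -> CP g -> CP (groupoid_conv P f g).
Proof.
exact: (conv_Cc skew_topological skew_hausdorff skew_locally_compact
  skew_r_discrete).
Qed.
Lemma CP_star f : CP f -> CP (conv_star P f).
Proof. exact: (star_Cc skew_topological skew_hausdorff). Qed.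
Lemma iA_mul f g : CP f -> CP g -> iA (groupoid_conv P f g) = ca_mul (iA f) (iA g).
Proof. by case: iA_hom => _ h _; exact: h. Qed.
Lemma iA_star f : CP f -> iA (conv_star P f) = ca_star (iA f).
Proof. by case: iA_hom => _ _ h; exact: h. Qed.
Lemma iA0 : iA 0 = 0. Proof. exact: (lin_on0 CP0 iA_lin). Qed.

(** At [s], the copy of [a] on the [(x, t)] of range in [Q^0 x {m}] with [x] of
    degree [m s m^-1]. *)
Definition corner (m : G) (a : Q -> R[i]) : G -> A := fun s =>
  iA (slice (piece a (m * s * m^-1)%g) (m * s^-1)%g).

Lemma corner_finite m a : CQ a -> finite_set [set t | corner m a t != 0].
Proof.
move=> Ca; apply: (sub_finite_set _ (finite_image (fun g => (m^-1 * g * m)%g) (piece_finite Ca))).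
move=> t /= ct; exists (m * t * m^-1)%g; last by rewrite !mulgA mulVg mul1g mulgVK.
apply: contrapT => /piece_eq0 e; move: ct.
by rewrite /corner e slice0 iA0 eqxx.
Qed.

Lemma corner_lin m (z : R[i]) a b : CQ a -> CQ b ->
  corner m (z *: a + b) = z *: corner m a + corner m b.
Proof.
move=> Ca Cb; apply/funext => t; rewrite /corner piece_lin slice_lin iA_lin //.
- by apply: slice_Cc; exact: piece_Cc.
- by apply: slice_Cc; exact: piece_Cc.
Qed.

Lemma corner_star m a : CQ a -> corner m (conv_star Gr a) = cp_star beta (corner m a).
Proof.
move=> Ca; apply/funext => t; rewrite /cp_star /corner.
have Cs u v : CP (slice (piece a u) v) by apply: slice_Cc; exact: piece_Cc.
rewrite -iA_star // betaE; last exact: CP_star.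
congr iA; apply/funext => -[x u]; rewrite [RHS]/conv_star /conv_star /slice /piece /=.
rewrite invgK (groupoid_homV cM).
have -> : ((c x * (u * t) == m * t) = (c x * u == m))%g by rewrite mulgA (inj_eq (mulIg t)).
have -> : ((c x)^-1 == m * t^-1 * m^-1)%g = (c x == m * t * m^-1)%g.
  by rewrite -(inj_eq invg_inj) invgK !invgM !invgK mulgA.
case: (eqVneq (c x) (m * t * m^-1)%g) => [->|_]; last by rewrite !if_same conjC0.
have -> : (m * t * m^-1 * u == m)%g = (u == m * t^-1)%g.
  apply/eqP/eqP => [e|->]; last by rewrite !mulgA mulgVK mulgK.
  by apply: (@mulgI _ (m * t / m)%g); rewrite e !mulgA mulgVK mulgK.
by case: ifP => //; rewrite conjC0.
Qed.

Lemma slice_piece_Cc a g t : CQ a -> CP (slice (piece a g) t).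
Proof. by move=> Ca; apply: slice_Cc; exact: piece_Cc. Qed.

Lemma beta_slice a t u : CQ a -> beta u (iA (slice a t)) = iA (slice a (t * u^-1)%g).
Proof.
move=> Ca; rewrite betaE; last exact: slice_Cc.
congr iA; apply/funext => -[x v]; rewrite /slice /=.
by rewrite -[in RHS](inj_eq (mulIg u)) mulgVK.
Qed.

Lemma corner_mul m a b : CQ a -> CQ b ->
  corner m (groupoid_conv Gr a b) = cp_mul beta (corner m a) (corner m b).
Proof.
move=> Ca Cb; apply/funext => t; rewrite /cp_mul.
(* [beta u] moves the slice of the second factor from [m t^-1 u] to [m t^-1], which is the slice of
   the left-hand side for every [u]. *)
pose F u := groupoid_conv P (slice (piece a (m * u * m^-1)%g) (m * u^-1)%g)
  (slice (piece b (m * (u^-1 * t) * m^-1)%g) (m * t^-1)%g).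
have FE u : ca_mul (corner m a u) (beta u (corner m b (u^-1 * t)%g)) = iA (F u).
  rewrite /corner beta_slice; last exact: piece_Cc.
  have -> : (m / (u^-1 * t) / u = m / t)%g by rewrite invgM invgK !mulgA mulgK.
  by rewrite iA_mul //; exact: slice_piece_Cc.
under eq_fsbigr do rewrite FE.
have fS := finite_image (fun g => (m^-1 * g * m)%g) (piece_finite Ca).
set S := (X in finite_set X) in fS.
have F0 u : ~ S u -> F u = 0.
  move=> nu; rewrite /F piece_eq0 ?slice0; first exact: conv0l.
  move=> h; apply: nu; exists (m * u * m^-1)%g => //; by rewrite !mulgA mulVg mul1g mulgVK.
have FC u : CP (F u) by apply: CP_conv; exact: slice_piece_Cc.
rewrite -(lin_on_fsum CP0 CP_lin iA_lin fS (fun u _ => F0 u) (fun u _ => FC u)).2.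
congr iA; apply/funext => -[x u].
rewrite (raddf_fsum (h := fun f : PG -> R[i] => f (x, u)) _ _ fS (fun u _ => F0 u)) //.
rewrite /F; under eq_fsbigr do rewrite skew_convE.
have [K [cK aK]] := Cc_supp Ca.
rewrite (exchange_fsum fS (compact_fiber_finite Qtop Qrd (r x) cK)); last first.
  move=> v y _ yx Fy; split.
    apply: contrapT => nv; apply: Fy; rewrite piece_eq0 ?slice0 ?mul0r // => h.
    apply: nv; exists (m * v * m^-1)%g => //; by rewrite !mulgA mulVg mul1g mulgVK.
  split=> //; apply: contrapT => nK; apply: Fy.
  by rewrite /slice /piece /= aK // !if_same mul0r.
rewrite {1}/slice {1}/piece /=; case: (eqVneq u (m * t^-1)%g) => [->|ut]; last first.
  rewrite fsbig1 // => y yx; rewrite fsbig1 // => v _.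
  by rewrite /slice /= (negPf ut) mulr0.
rewrite /slice /piece /= eqxx.
have cyx y : r y = r x -> c (mul (inv y) x) = ((c y)^-1 * c x)%g.
  by move=> yx; rewrite cM ?gsrcV ?grng_inv // (groupoid_homV cM).
(* Degrees multiply: nonzero factors of degrees [m v m^-1] and [m (v^-1 t) m^-1] force
   [c x = m t m^-1], so otherwise both sides vanish. *)
case: eqP => [cx|cx]; last first.
  rewrite fsbig1 // => y yx; rewrite fsbig1 // => v _.
  case: eqP => _; last by rewrite mul0r.
  case: eqP => [cy|_]; last by rewrite mul0r.
  case: eqP => [e|_]; last by rewrite mulr0.
  case: cx; apply: (@mulgI _ (c y)^-1%g); rewrite -cyx // e cy.
  by rewrite !invgM !invgK !mulgA mulgVK.
apply: eq_fsbigr => y; rewrite inE => yx.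
(* The degree of [y] determines the group element, so the sum over [G] has one term and the
   convolution over [Q] remains. *)
rewrite (fsum_fin (S := [set (m^-1 * c y * m)%g])); last first.
  move=> v _ nv; case: eqP => _; last by rewrite mul0r.
  case: eqP => [cy|_]; last by rewrite mul0r.
  by case: nv; rewrite /= cy !mulgA mulVg mul1g mulgVK.
rewrite setTI fsbig_set1 cyx // cx.
have -> : (m * (m^-1 * c y * m) / m = c y)%g by rewrite !mulgA mulgV mul1g mulgK.
have -> : (m / (m^-1 * c y * m) = (c y)^-1 * m)%g.
  by rewrite !invgM invgK !mulgA mulgV mul1g.
have -> : ((c y)^-1 * (m * t / m) * (m / t) = (c y)^-1 * m)%g by rewrite !mulgA mulgVK mulgK.
have -> : (m * ((m^-1 * c y * m)^-1 * t) / m = (c y)^-1 * (m * t / m))%g.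
  by rewrite !invgM invgK !mulgA mulgV mul1g.
by rewrite !eqxx.
Qed.
Lemma unit_supported_hom (chi : Q -> R[i]) x : unit_supported Gr chi -> chi x <> 0 -> c x = 1%g.
Proof.
move=> uc cx; have [<-|/uc//] := pselect (r x = x).
exact: groupoid_hom_rng cM x.
Qed.

(** Units have degree 1, so only the group element 1 contributes. *)
Lemma corner_unit m chi : unit_supported Gr chi -> corner m chi = single 1%g (iA (slice chi m)).
Proof.
move=> uc; apply/funext => t; rewrite /corner /single; case: eqP => [->|t1].
  congr iA; apply/funext => -[x u]; rewrite /slice /= invg1 mulg1; case: eqP => // _.
  rewrite /piece; case: eqP => // cx; apply/esym; apply: contrapT => h.
  by case: cx; rewrite mulgV; exact: unit_supported_hom uc h.
rewrite piece_eq0 ?slice0 ?iA0 // => -[x cx /(unit_supported_hom uc)]; rewrite cx => e.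
apply: t1; apply: (@mulgI _ m); apply: (@mulIg _ m^-1%g); by rewrite e mulg1 mulgV.
Qed.

Lemma slice_unit_supported (chi : Q -> R[i]) m : unit_supported Gr chi -> unit_supported P (slice chi m).
Proof.
move=> uc -[x t] xt; rewrite /slice /=; case: ifP => // _; apply: contrapT => chx; apply: xt.
have rx : r x = x by apply: contrapT => /uc.
by rewrite /= /skew_rng /= rx (unit_supported_hom uc chx) mul1g.
Qed.

Lemma slice_unit_conv chi m (f : PG -> R[i]) x t : unit_supported Gr chi ->
  groupoid_conv P (slice chi m) f (x, t) = if (c x * t)%g == m then chi (r x) * f (x, t) else 0.
Proof.
move=> uc; rewrite conv_unit; last exact: slice_unit_supported.
by rewrite /slice /=; case: ifP => // _; rewrite mul0r.
Qed.

(** The two outer factors select range and source in [Q^0 x {m}]. Against the group element [t] this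
    leaves the points [(x, m t^-1)] with [c x = m t m^-1], and these are the points that [corner m]
    reads off the piece of [h] of that degree. *)
Lemma corner_compress m chi chi' t f : CQ chi -> CQ chi' ->
  unit_supported Gr chi -> unit_supported Gr chi' -> CP f ->
  exists2 a, CQ a & cp_mul beta (cp_mul beta (corner m chi') (single t (iA f)))
    (corner m chi) = corner m a.
Proof.
move=> Cc1 Cc2 u1 u2 Cf.
pose h x := chi' (r x) * f (x, (m * t^-1)%g) * chi (s x).
have rc := rng_continuous Qrd; have sc := src_continuous Qtop Qrd.
have Ch : CQ h.
  have C1 : CQ (fun x => chi' (r x) * f (x, (m * t^-1)%g)).
    apply: (@CcM C _ Qh); last exact: unslice_Cc.
    by move=> x; apply: (@continuous_comp Q Q C r chi'); [exact: rc|exact: Cc2.1].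
  have -> : h = (fun x => chi (s x) * (chi' (r x) * f (x, (m * t^-1)%g))).
    by apply/funext => x; rewrite mulrC.
  apply: (@CcM C _ Qh) => // x.
  by apply: (@continuous_comp Q Q C s chi); [exact: sc|exact: Cc1.1].
exists (piece h (m * t * m^-1)%g); first exact: piece_Cc.
have S1 := slice_Cc m Cc1; have S2 := slice_Cc m Cc2.
apply/funext => u; rewrite (corner_unit m u1) (corner_unit m u2) (cp_mul_singler beta_action) (cp_mul_singlel beta_action).
rewrite /corner /single; case: eqP => [->|ut]; last first.
  rewrite ca_mul0r ca_mul0l piece_eq0 ?slice0 ?iA0 // => -[x cx].
  rewrite /piece; case: eqP => // e _; apply: ut; apply: (@mulgI _ m); apply: (@mulIg _ m^-1%g).
  by rewrite -cx e.
rewrite beta_slice // -iA_mul // -iA_mul //; first last.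
- exact: slice_Cc.
- exact: CP_conv.
congr iA; apply/funext => -[x v].
rewrite conv_unitr; last exact: slice_unit_supported.
rewrite slice_unit_conv // /slice /piece /=.
have [->|_] := eqVneq (v : G) (m * t^-1)%g; last by rewrite mulr0.
case: (eqVneq (c x) (m * t * m^-1)%g) => [->|ne].
  by rewrite !mulgA mulgVK mulgK eqxx.
case: eqP => [e|_]; last by rewrite mul0r.
by case/eqP: ne; apply: (@mulIg _ (m * t^-1)%g); rewrite e !mulgA mulgVK mulgK.
Qed.

(** [chi] is 1 on the ranges of the support of [f], and the second coordinate [c x * t] of the range
    takes finitely many values [m] on this compact support. The left factors are the ones that
    [corner_unit] identifies with corner elements. *)
Lemma unit_decomposition f : CP f -> exists (chi : Q -> R[i]) (l : seq G),
  [/\ CQ chi, unit_supported Gr chi &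
      iA f = \sum_(m <- l) ca_mul (iA (slice chi m)) (iA f)].
Proof.
move=> Cf; have [K [cK fK]] := Cc_supp Cf.
have cK1 : compact (fst @` K).
  by apply: continuous_compact => //; apply: continuous_subspaceT => x; exact: cvg_fst.
have [chi [Cchi uchi chi1]] := unit_plateau R Qtop Qh Qlc Qrd cK1.
have lu (p : PG) : nbhs p [set q : PG | (c q.1 * q.2 = c p.1 * p.2)%g].
  apply: filterS (nbhs_slice (hom_locally_constant p.1)) => q [/= -> ->] //.
have fS := locally_constant_finite lu cK; set S := (X in finite_set X) in fS.
pose F m := groupoid_conv P (slice chi m) f.
have CF m : CP (F m) by apply: CP_conv => //; exact: slice_Cc.
have F0 m : ~ S m -> F m = 0.
  move=> nm; apply/funext => -[x t]; rewrite /F slice_unit_conv //; case: eqP => // e.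
  rewrite fK ?mulr0 // => Kx; apply: nm; by exists (x, t).
have [l [_ _ lE]] := finite_enum fS.
exists chi, l; split=> //.
have -> : \sum_(m <- l) ca_mul (iA (slice chi m)) (iA f) = \sum_(m \in [set: G]) iA (F m).
  rewrite (fsum_fin (S := S)); last by move=> m _ /F0 ->; exact: iA0.
  rewrite setTI lE; apply: eq_bigr => m _; rewrite /F iA_mul //; exact: slice_Cc.
rewrite -(lin_on_fsum CP0 CP_lin iA_lin fS (fun u _ => F0 u) (fun u _ => CF u)).2.
congr iA; apply/funext => -[x t].
rewrite (raddf_fsum (h := fun f : PG -> R[i] => f (x, t)) _ _ fS (fun u _ => F0 u)) //.
rewrite (fsum_fin (S := [set (c x * t)%g])).
  rewrite setTI fsbig_set1 /F slice_unit_conv // eqxx.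
  have [Kx|nK] := pselect (K (x, t)); last by rewrite fK // mulr0.
  by rewrite chi1 ?mul1r //; exists (x, t).
by move=> m _ nm; rewrite /F slice_unit_conv //; case: eqP => // e; case: nm.
Qed.

Lemma universal_rep_le (H : hilbert R) (rho : (PG -> R[i]) -> H -> H) f x :
  @star_rep R (Cc_groupoid R P) H rho -> CP f -> normR (rho f x) <= normR (iA f) * normR x.
Proof.
move=> hrho Cf; apply: opnorm_bound => [a y|].
  exact: (repZr hrho (f := f)).
have [_ nE _] := A_env; rewrite (nE f Cf).
by apply: ereal_sup_ubound; exists H, rho.
Qed.

Lemma corner_sup m (a : Q -> R[i]) x : CQ a ->
  ((cabs (a x))%:E <= reduced_norm beta (corner m a))%E.
Proof.
move=> Ca.
pose rho := @reg R _ _ skew_topological skew_hausdorff skew_locally_compact skew_r_discrete.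
have hrho : @star_rep R (Cc_groupoid R P) (ell2_hilbert R PG) rho by exact: reg_rep.
have [_ _ dA] := A_env.
(* [reduced_norm] runs over representations of [A], so the regular representation is first extended
   from [C_c]. *)
have [sigma [hsigma sigmaE]] := @extension_rep R (Cc_groupoid R P) A iA iA_hom dA
  CP_lin CP_conv CP_star
  (ell2_hilbert R PG) rho hrho (fun f y Cf => universal_rep_le y hrho Cf).
(* The group element at which [corner m a] carries the value [a x]. Applying [beta t^-1] brings this
   value to the point [(x, m)], and [d] is the unit vector at the source of that point. *)
pose t := (m^-1 * c x * m)%g.
pose d : ell2_hilbert R PG := ell2_delta R (gsrc P (x, m)).
have d1 : normR d <= 1 by rewrite ell2_normR norm_delta.
apply: le_trans (reduced_norm_ge beta (corner m a) t hsigma d1).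
pose f := slice (piece a (c x)) m.
have Cf : CP f by apply: slice_Cc => //; exact: piece_Cc.
have -> : beta t^-1%g (corner m a t) = iA f.
  rewrite /corner beta_slice; last exact: piece_Cc.
  have -> : (m * t / m)%g = c x by rewrite /t !mulgA mulgV mul1g mulgK.
  by have -> : (m / t / t^-1)%g = m by rewrite invgK mulgVK.
rewrite sigmaE // lee_fin ell2_normR.
apply: le_trans (reg_sup skew_topological skew_hausdorff skew_locally_compact skew_r_discrete (x, m) Cf).
by rewrite /f /slice /piece /= !eqxx.
Qed.


(** * The kernel of the regular representation *)

Variables (B : cstar_algebra R) (k : (G -> A) -> B).
Hypothesis B_full : full_crossed_product beta k.
Variables (Br : cstar_algebra R) (kr : (G -> A) -> Br).
Hypothesis Br_red : reduced_crossed_product beta kr.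
Variable L : B -> Br.
Hypothesis L_reg : regular_representation beta k kr L.
Hypothesis Qam : amenable R Gr.

Local Notation E := corner.

Lemma regL_lin (z : R[i]) u v : L (z *: u + v) = z *: L u + L v.
Proof. by have [[h _ _] _ _] := L_reg; exact: h. Qed.
Lemma regL_mul u v : L (ca_mul u v) = ca_mul (L u) (L v).
Proof. by have [[_ h _] _ _] := L_reg; exact: h. Qed.
Lemma regL_sub u v : L (u - v) = L u - L v.
Proof. exact: (lin_onB (D := setT) (fun z u v _ _ => regL_lin z u v) I I). Qed.
Lemma regL_near v (e : R) : 0 < e -> exists2 d : R, 0 < d &
  forall u, normR (v - u) < d -> normR (L v - L u) < e.
Proof.
move=> e0; have [_ cL _] := L_reg.
have := cL v; move=> /cvgrPdist_lt /(_ (e%:C%C)).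
rewrite ltcR => /(_ e0); rewrite -filter_from_ballE => -[d /= d0 hd].
have d0' : 0 < complex.Re d by rewrite -ltcR RRe_real // gtr0_real.
exists (complex.Re d) => // u uv; have /hd : ball v d u.
  by rewrite -ball_normE /ball_ /= normRE -[d]RRe_real ?gtr0_real // ltcR.
by rewrite /= normRE ltcR.
Qed.

(** Composition with [corner m] turns the integrated form of a covariant representation into the
    [rho], and [kr] into the [kap], of [amenable_rep_le]. *)
Lemma full_corner_le m a : CQ a -> normR (k (E m a)) <= normR (L (k (E m a))).
Proof.
move=> Ca; have [_ _ Lk] := L_reg; rewrite (Lk (E m a)); last exact: corner_finite.
apply: (k_norm_le B_full); [exact: corner_finite|exact: normR_ge0|] => H pi U cov h.
have [irl irlin irmul iradj] := integrated_rep beta_action cov.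
have [[krl krm krs] krn _] := Br_red.
pose rho (a : Q -> R[i]) := integrated pi U (E m a).
have hrho : @star_rep R (Cc_groupoid R Gr) H rho.
  split.
  - move=> f Cf; apply: irl; exact: corner_finite.
  - move=> z f g Cf Cg x; rewrite /rho corner_lin //; apply: irlin; exact: corner_finite.
  - move=> f g Cf Cg x; rewrite /rho [E _ _]corner_mul //; apply: irmul; exact: corner_finite.
  - move=> f Cf x y; rewrite /rho [E m (sa_star f)]corner_star //; apply: iradj; exact: corner_finite.
have hkap : @star_hom R (Cc_groupoid R Gr) Br (fun a => kr (E m a)).
  split.
  - move=> z f g Cf Cg; rewrite corner_lin //; apply: krl; exact: corner_finite.
  - move=> f g Cf Cg; rewrite [E _ _]corner_mul //; apply: krm; exact: corner_finite.
  - move=> f Cf; rewrite [E m (sa_star f)]corner_star //; apply: krs; exact: corner_finite.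
apply: (amenable_rep_le Qtop Qh Qlc Qrd hrho hkap _ h Qam Ca) => f Cf x.
rewrite -lee_fin (krn (E m f)); last exact: corner_finite.
exact: corner_sup.
Qed.

Let kE m a := k (E m a).
Let kcorner_lin m (z : R[i]) a b : CQ a -> CQ b -> kE m (z *: a + b) = z *: kE m a + kE m b.
Proof. by move=> Ca Cb; rewrite /kE corner_lin // (k_lin B_full) //; exact: corner_finite. Qed.

Lemma crossed_generators (V : set B) : V 0 -> (forall u v, V u -> V v -> V (u + v)) ->
  (forall u, (forall e, 0 < e -> exists2 v, V v & normR (u - v) <= e) -> V u) ->
  (forall t f, CP f -> V (k (single t (iA f)))) -> forall u, V u.
Proof.
move=> V0 VD Vc Vk; have [_ _ dA] := A_env.
by apply: (crossed_ind B_full dA) => // t _ [f Cf <-]; exact: Vk.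
Qed.

(** On generators [corner_compress] places the compression in the corner exactly; sums and limits
    follow because [T] is additive and bounded. *)
Lemma corner_compressed m chi b (e : R) : CQ chi -> unit_supported Gr chi -> 0 < e ->
  exists2 a, CQ a & normR (ca_mul (ca_mul (ca_star (kE m chi)) b) (kE m chi) - kE m a) <= e.
Proof.
move=> Cchi uchi; move: e.
have Cs := star_Cc Qtop Qh Cchi.
have us := unit_supported_star uchi.
pose T b := ca_mul (ca_mul (ca_star (kE m chi)) b) (kE m chi).
have TB u v : T u - T v = T (u - v) by rewrite /T ca_mulBr ca_mulBl.
have kE0 : kE m 0 = 0 := lin_on0 (@Cc0 C _ Qh) (@kcorner_lin m).
apply: (crossed_generators (V := fun b => forall e : R, 0 < e -> exists2 a, CQ a &
  normR (T b - kE m a) <= e)).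
- move=> e e0; exists 0; first exact: (@Cc0 C).
  by rewrite kE0 /T ca_mul0r ca_mul0l subr0 normR0 ltW.
- move=> u v hu hv e e0; have e2 : 0 < e / 2 by rewrite divr_gt0.
  have [a1 C1 n1] := hu _ e2; have [a2 C2 n2] := hv _ e2.
  exists (a1 + a2); first exact: (@CcD C).
  have -> : T (u + v) - kE m (a1 + a2) = (T u - kE m a1) + (T v - kE m a2).
    rewrite (lin_onD (@kcorner_lin m)) //.
    have -> : T (u + v) = T u + T v by apply/eqP; rewrite -subr_eq TB addrK.
    by rewrite opprD addrACA.
  by apply: le_trans (normRD _ _) _; rewrite [leRHS](splitr e); exact: lerD.
- move=> u hu e e0; have e2 : 0 < e / 2 by rewrite divr_gt0.
  pose M := normR (ca_star (kE m chi)) * normR (kE m chi) + 1.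
  have M0 : 0 < M by rewrite ltr_wpDl // mulr_ge0 // normR_ge0.
  have [v hv uv] := hu (e / 2 / M) (divr_gt0 e2 M0).
  have [a Ca na] := hv _ e2; exists a => //.
  have -> : T u - kE m a = (T u - T v) + (T v - kE m a) by rewrite addrA subrK.
  apply: le_trans (normRD _ _) _; rewrite [leRHS](splitr e); apply: lerD => //.
  rewrite TB; apply: le_trans (ca_norm_mul _ _) _.
  apply: (@le_trans _ _ (M * normR (u - v))); last first.
    by rewrite -ler_pdivlMl // mulrC.
  apply: (@le_trans _ _ (normR (ca_star (kE m chi)) * normR (u - v) * normR (kE m chi))).
    by apply: ler_wpM2r; [exact: normR_ge0|exact: ca_norm_mul].
  by rewrite mulrAC /M mulrDl lerDl mul1r normR_ge0.
move=> t f Cf e e0.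
have [a Ca aE] := corner_compress m t Cchi Cs uchi us Cf.
exists a => //; rewrite /T /kE -aE.
have fs := @single_finite R G A t (iA f).
rewrite (k_mul B_full); last 2 first.
- apply: sub_finite_set fs => s /=; rewrite (corner_unit m us) (cp_mul_singlel beta_action).
  by apply: contraNN => /eqP ->; rewrite ca_mul0r.
- exact: corner_finite.
rewrite (k_mul B_full) //; last exact: corner_finite.
rewrite corner_star // (k_star B_full); last exact: corner_finite.
by rewrite subrr normR0 ltW.
Qed.

Lemma kernel_corner0 m chi b : CQ chi -> unit_supported Gr chi -> L b = 0 ->
  ca_mul b (kE m chi) = 0.
Proof.
move=> Cchi uchi Lb; set e := kE m chi.
pose v := ca_mul (ca_mul (ca_star e) (ca_mul (ca_star b) b)) e.
have vE : v = ca_mul (ca_star (ca_mul b e)) (ca_mul b e) by rewrite /v ca_starM !ca_mulA.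
have Lv : L v = 0 by rewrite vE !regL_mul Lb ca_mul0l ca_mul0r.
apply: normR0_eq0; apply/eqP; rewrite -sqrf_eq0 -ca_norm_star -vE eq_le normR_ge0 andbT.
(* [full_corner_le] concerns only corner elements [kE m a], so [v] is approximated by one of them:
   since [L v = 0], continuity makes [L (kE m a)] small, hence [kE m a], hence [v]. *)
apply/ler_addgt0Pr => d d0; rewrite add0r.
have d2 : 0 < d / 2 by rewrite divr_gt0.
have [d' d'0 hd'] := regL_near v d2.
have m0 : 0 < Num.min (d / 2) (d' / 2) by rewrite lt_min d2 divr_gt0.
have [a Ca na] := corner_compressed m (ca_mul (ca_star b) b) Cchi uchi m0.
have na1 : normR (v - kE m a) <= d / 2 by apply: le_trans na _; rewrite ge_min lexx.
have na2 : normR (v - kE m a) < d'.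
  apply: le_lt_trans na _; rewrite gt_min; apply/orP; right.
  by rewrite ltr_pdivrMr // ltr_pMr // ltr1n.
have := hd' _ na2; rewrite Lv sub0r normRN => nL.
have -> : v = (v - kE m a) + kE m a by rewrite subrK.
apply: le_trans (normRD _ _) _; rewrite (splitr d); apply: lerD => //.
by apply: le_trans (full_corner_le m Ca) _; exact: ltW.
Qed.

(** By [unit_decomposition] a generator is a sum of products with left factors [k (corner m chi)],
    each annihilated by [b]. *)
Lemma kernel_generator0 b t f : CP f -> L b = 0 -> ca_mul b (k (single t (iA f))) = 0.
Proof.
move=> Cf Lb.
have [chi [l [Cchi uchi ->]]] := unit_decomposition Cf.
have sl (z : R[i]) x y : k (single t (z *: x + y)) = z *: k (single t x) + k (single t y).
  rewrite -(k_lin B_full); try exact: single_finite.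
  congr k; apply/funext => u.
  have -> : (z *: single t x + single t y) u = z *: single t x u + single t y u by [].
  by rewrite /single; case: ifP => // _; rewrite scaler0 addr0.
rewrite (lin_on_seq (D := setT) (h := fun x => k (single t x)) I (fun _ _ _ _ _ => I)
  (fun z x y _ _ => sl z x y) (fun _ _ => I)).2.
rewrite (lin_on_seq (D := setT) (h := ca_mul b) I (fun _ _ _ _ _ => I)
  (fun z x y _ _ => ca_mul_linearr b z x y) (fun _ _ => I)).2.
apply: big1 => m _.
have -> : single t (ca_mul (iA (slice chi m)) (iA f)) =
    cp_mul beta (E m chi) (single t (iA f)).
  apply/funext => u; rewrite (corner_unit m uchi) (cp_mul_singlel beta_action).
  by rewrite /single; case: ifP => // _; rewrite ca_mul0r.
rewrite (k_mul B_full); [|exact: corner_finite|exact: single_finite].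
by rewrite ca_mulA kernel_corner0 // ca_mul0l.
Qed.

Lemma regular_representation_kernel0 b : L b = 0 -> b = 0.
Proof.
move=> Lb; have bs0 : ca_mul b (ca_star b) = 0.
  apply: (crossed_generators (V := fun u => ca_mul b u = 0)).
  - exact: ca_mul0r.
  - by move=> u v bu bv; have := ca_mulBr u (- v) b; rewrite opprK => ->;
      rewrite bu sub0r -[- v]sub0r ca_mulBr bv ca_mul0r subr0 oppr0.
  - move=> u hu; apply: (normR_eps (M := normR b)) => e e0 _.
    have [v bv uv] := hu e e0.
    rewrite subr0 -[ca_mul b u]subr0 -bv -ca_mulBr.
    by apply: le_trans (ca_norm_mul _ _) _; apply: ler_wpM2l => //; exact: normR_ge0.
  - by move=> t f Cf; exact: kernel_generator0.
apply: normR0_eq0; apply/eqP; rewrite -ca_norm_adj -sqrf_eq0 -ca_norm_star ca_starK bs0 normR0.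
exact: eqxx.
Qed.

End skew.

Theorem proposition5p6 (R : realType) (Q : topologicalType) (Gr : groupoid Q)
    (G : groupType) (c : Q -> G) (cM : groupoid_hom Gr c)
    (* Q is an amenable r-discrete locally compact Hausdorff groupoid and c is
       continuous for the discrete topology of G *)
    (Qtop : topological_groupoid Gr)
    (Qhausdorff : hausdorff_space Q)
    (Qlc : locally_compact [set: Q])
    (Qrd : r_discrete Gr)
    (Qam : amenable R Gr)
    (c_cont : continuous (c : Q -> discrete_topology G))
    (* A = C^*(Q x_c G) *)
    (A : cstar_algebra R) (iA : (Q * discrete_topology G -> R[i]) -> A)
    (A_env : groupoid_cstar (skew_product cM) iA)
    (* the action beta *)
    (beta : G -> A -> A) (beta_action : cstar_action beta)
    (betaE : forall (s : G) (f : Q * discrete_topology G -> R[i]),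
       Cc f -> beta s (iA f) = iA (fun p => f (p.1, (p.2 * s)%g)))
    (* the full and reduced crossed products, and the regular representation *)
    (B : cstar_algebra R) (k : (G -> A) -> B)
    (B_full : full_crossed_product beta k)
    (Br : cstar_algebra R) (kr : (G -> A) -> Br)
    (Br_red : reduced_crossed_product beta kr)
    (L : B -> Br) (L_reg : regular_representation beta k kr L) :
  injective L.
Proof.
move=> u v Luv; apply/eqP; rewrite -subr_eq0; apply/eqP.
apply: (regular_representation_kernel0 Qtop Qhausdorff Qlc Qrd c_cont A_env beta_action
  betaE B_full Br_red L_reg Qam).
by rewrite (regL_sub L_reg) Luv subrr.
Qed.
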